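(* For every group $G$ there is a natural isomorphism $$\mathrm{lim}^2(\mathbf{rr}+\mathbf{ffr}+\mathbf{rff})\cong G_{ab}\otimes G_{ab}$$ and a short exact sequence $$0\to\frac{(\mathbf r+\mathbf{ff})^2}{\mathbf{rr}+\mathbf{rff}+\mathbf{ffr}}\to\mathrm{lim}^1(\mathbf{rr}+\mathbf{ffr}+\mathbf{rff})\to\mathrm{Tor}(G_{ab},G_{ab})\to 0,$$ where the left-hand term is a constant functor on $\mathrm{Pres}(G)$, a natural quotient of $\mathbf g^2\otimes_{\mathbb Z[G]}\mathbf g^2$. Moreover $\mathrm{lim}^3(\mathbf{rr}+\mathbf{ffr}+\mathbf{rff})=0$.
   Context: For a group $G$, $\mathrm{Pres}(G)$ is the category whose objects are epimorphisms $F\twoheadrightarrow G$ from free groups and whose morphisms are group homomorphisms over $G$. Functorial ideals of $\mathbb Z[F]$: $\mathbf f=\ker\{\mathbb Z[F]\to\mathbb Z\}$, $\mathbf r=\ker\{\mathbb Z[F]\to\mathbb Z[G]\}$. Words in $\mathbf f,\mathbf r$ denote products of ideals (e.g. $\mathbf{ffr}=\mathbf f\cdot\mathbf f\cdot\mathbf r$), $+$ is the sum of ideals, and $(\mathbf r+\mathbf{ff})^2$ is the square of the ideal $\mathbf r+\mathbf{ff}$; such expressions and their quotients are functors $\mathrm{Pres}(G)\to\mathrm{Ab}$. $\mathrm{lim}^i$ denotes the $i$-th right derived functor of the limit functor $\mathrm{Ab}^{\mathrm{Pres}(G)}\to\mathrm{Ab}$ (set-theoretic existence assumed, e.g. in a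 larger universe). $\mathbf g$ is the augmentation ideal of $\mathbb Z[G]$, $G_{ab}$ is the abelianization of $G$; $\otimes$ without subscript and $\mathrm{Tor}=\mathrm{Tor}_1$ are over $\mathbb Z$. A functor is constant if it is naturally isomorphic to one sending every object to the same group and every morphism to the identity. *)

(* Defs.v *)
From HB Require Import structures.
From mathcomp Require Import all_boot all_algebra finmap boolp classical_sets.
From mathcomp.multinomials Require Import monalg.

Set Implicit Arguments.
Unset Strict Implicit.
Unset Printing Implicit Defensive.

Import GRing.Theory.
Local Open Scope classical_set_scope.
Local Open Scope ring_scope.
Local Open Scope quotient_scope.

Notation "{ 'ghom' G -> H }" := (UMagmaMorphism.type G H)
  (at level 0, G at level 98, H at level 99, format "{ 'ghom'  G  ->  H }").

Section Span.
Variables (V : zmodType) (S : set V).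

Definition span_pred : {pred V} :=
  fun x =>
    `[< forall A : zmodClosed V, (forall s, S s -> s \in A) -> x \in A >].

Fact span_zmod_closed : zmod_closed span_pred.
Proof.
split=> [|x y /asboolP xS /asboolP yS]; apply/asboolP => A SA.
  exact: rpred0.
by rewrite rpredB ?xS ?yS.
Qed.

HB.instance Definition _ :=
  GRing.isZmodClosed.Build V span_pred span_zmod_closed.

Definition spanz : zmodClosed V := span_pred.

Lemma spanP (A : zmodClosed V) :
  (forall s, S s -> s \in A) -> forall x, x \in spanz -> x \in A.
Proof. by move=> SA x /asboolP; apply. Qed.

Lemma mem_span s : S s -> s \in spanz.
Proof. by move=> Ss; apply/asboolP => A; apply. Qed.

End Span.

Section KernelImage.
Variables (V W : zmodType) (h : {additive V -> W}).

Definition ker_pred : {pred V} := fun x => h x == 0.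
Fact ker_zmod_closed : zmod_closed ker_pred.
Proof.
split=> [|x y]; rewrite -!topredE /= /ker_pred ?raddf0 // raddfB.
by move=> /eqP -> /eqP ->; rewrite subr0.
Qed.
HB.instance Definition _ := GRing.isZmodClosed.Build V ker_pred ker_zmod_closed.
Definition kerz : zmodClosed V := ker_pred.

Definition im_pred : {pred W} := fun y => `[< exists x, h x = y >].
Fact im_zmod_closed : zmod_closed im_pred.
Proof.
split=> [|_ _ /asboolP[x <-] /asboolP[y <-]]; apply/asboolP.
  by exists 0; rewrite raddf0.
by exists (x - y); rewrite raddfB.
Qed.
HB.instance Definition _ := GRing.isZmodClosed.Build W im_pred im_zmod_closed.
Definition imz : zmodClosed W := im_pred.

Lemma kerE x : (x \in kerz) = (h x == 0). Proof. by []. Qed.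

Lemma imP y : y \in imz <-> exists x, h x = y.
Proof. by split=> [/asboolP|?] //; apply/asboolP. Qed.

Variable B : zmodClosed W.
Definition preim_pred : {pred V} := fun x => h x \in B.
Fact preim_zmod_closed : zmod_closed preim_pred.
Proof.
by split=> [|x y xB yB]; rewrite -topredE /= /preim_pred ?raddf0 ?raddfB;
  rewrite ?rpred0 ?rpredB.
Qed.
HB.instance Definition _ :=
  GRing.isZmodClosed.Build V preim_pred preim_zmod_closed.
Definition preimz : zmodClosed V := preim_pred.
End KernelImage.

Definition zero_pred (V : zmodType) : {pred V} := pred1 0.
Fact zero_zmod_closed V : zmod_closed (@zero_pred V).
Proof.
by split=> [|x y]; rewrite ?inE // => /eqP -> /eqP ->; rewrite subr0.
Qed.
HB.instance Definition _ V :=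
  GRing.isZmodClosed.Build V (@zero_pred V) (@zero_zmod_closed V).
Definition zeroz (V : zmodType) : zmodClosed V := @zero_pred V.

Record subz (V : zmodType) (A : zmodClosed V) := Subz {
  subz_val :> V;
  subz_valP : subz_val \in A }.
HB.instance Definition _ V A := [isSub for @subz_val V A].
HB.instance Definition _ V A := [Choice of @subz V A by <:].
HB.instance Definition _ V A := [SubChoice_isSubZmodule of @subz V A by <:].

Section SubMap.
Variables (V W : zmodType) (A : zmodClosed V) (B : zmodClosed W).
Variable h : {additive V -> W}.
Hypothesis hAB : forall x, x \in A -> h x \in B.

Definition subz_map (x : subz A) : subz B := Subz (hAB (subz_valP x)).
Fact subz_map_zmod_morphism : zmod_morphism subz_map.
Proof. by move=> x y; apply: val_inj; rewrite /= raddfB. Qed.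
HB.instance Definition _ :=
  GRing.isZmodMorphism.Build (subz A) (subz B) subz_map subz_map_zmod_morphism.

Definition quot_map of (forall x, x \in A -> h x \in B) :=
  fun x : {ideal_quot A} => \pi_{ideal_quot B} (h (repr x)).
Lemma quot_map_pi x :
  quot_map hAB (\pi_{ideal_quot A} x) = \pi_{ideal_quot B} (h x).
Proof.
by apply/eqP; rewrite -Quotient.idealrBE -raddfB hAB // Quotient.idealrBE reprK.
Qed.
Fact quot_map_zmod_morphism : zmod_morphism (quot_map hAB).
Proof.
by move=> x y; rewrite -[x]reprK -[y]reprK -raddfB !quot_map_pi !raddfB.
Qed.
HB.instance Definition _ :=
  GRing.isZmodMorphism.Build {ideal_quot A} {ideal_quot B} (quot_map hAB)
    quot_map_zmod_morphism.
End SubMap.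

(* A / (A :&: B), which is A / B whenever B is contained in A. *)
Definition subquot (V : zmodType) (A B : zmodClosed V) : zmodType :=
  {ideal_quot preimz (val : subz A -> V) B}.

Definition subquot_pi (V : zmodType) (A B : zmodClosed V) (x : subz A) :
  subquot A B := \pi_{ideal_quot preimz (val : subz A -> V) B} x.

Lemma subquot_ind (V : zmodType) (A B : zmodClosed V)
  (P : subquot A B -> Prop) :
  (forall x, P (subquot_pi B x)) -> forall u, P u.
Proof. by move=> Ppi u; rewrite -[u]reprK; exact: Ppi. Qed.

Section SubquotMap.
Variables (V W : zmodType) (A B : zmodClosed V) (A' B' : zmodClosed W).
Variables (h : {additive V -> W}) (hA : forall x, x \in A -> h x \in A').
Hypothesis hB : forall x, x \in B -> h x \in B'.
Fact subquot_map_subproof x :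
  x \in preimz (val : subz A -> V) B ->
  subz_map hA x \in preimz (val : subz A' -> W) B'.
Proof. exact: hB. Qed.
Definition subquot_map : {additive subquot A B -> subquot A' B'} :=
  quot_map subquot_map_subproof.
Lemma subquot_map_pi x :
  subquot_map (subquot_pi B x) = subquot_pi B' (subz_map hA x).
Proof. exact: quot_map_pi. Qed.
End SubquotMap.

(* {malg int[K]} is the free abelian group on K. *)
Section FreeLift.
Variables (K : choiceType) (V : zmodType) (h : K -> V).

Definition flift (x : {malg int[K]}) : V := \sum_(k <- msupp x) h k *~ x@_k.

Lemma fliftEw (d : {fset K}) x :
  {subset msupp x <= d} -> flift x = \sum_(k <- d) h k *~ x@_k.
Proof.
move=> /fsubsetP le.
rewrite [LHS](big_fset_incl _ le) => //= k _ /mcoeff_outdom ->.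
by rewrite mulr0z.
Qed.

Fact flift_zmod_morphism : zmod_morphism flift.
Proof.
move=> x y; pose d := (msupp x `|` msupp y)%fset.
rewrite !(@fliftEw d) -?sumrB; last 3 first.
- by move=> k ky; rewrite in_fsetU ky orbT.
- by move=> k kx; rewrite in_fsetU kx.
- by apply/fsubsetP; exact: msuppB_le.
by apply: eq_bigr => k _; rewrite mcoeffB mulrzBr.
Qed.
HB.instance Definition _ :=
  GRing.isZmodMorphism.Build {malg int[K]} V flift flift_zmod_morphism.

Lemma fliftU k : flift << k >> = h k.
Proof.
rewrite (@fliftEw [fset k]%fset); last by apply/fsubsetP; exact: msuppU_le.
by rewrite big_seq_fset1 mcoeffUU.
Qed.
End FreeLift.

Lemma fliftD (K : choiceType) (V : zmodType) (h h' : K -> V) x :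
  flift (fun k => h k + h' k) x = flift h x + flift h' x.
Proof. by rewrite -big_split; apply: eq_bigr => k _; rewrite mulrzDl. Qed.

Lemma malg_int_ind (K : choiceType) (A : zmodClosed {malg int[K]}) :
  (forall k, << k >> \in A) -> forall x, x \in A.
Proof.
move=> AK x; rewrite [x]monalgE; apply: rpred_sum => k _.
suff -> : << x@_k *g k >> = << k >> *~ x@_k by exact: rpredMz.
by rewrite -[X in << X *g _ >>]intz raddfMz.
Qed.

Lemma malg_int_ext (K : choiceType) (V : zmodType)
  (f g : {additive {malg int[K]} -> V}) :
  (forall k, f << k >> = g << k >>) -> f =1 g.
Proof.
move=> fg x; apply/eqP; rewrite -subr_eq0.
have := @malg_int_ind _ (kerz (f \- g)) _ x.
by rewrite kerE; apply=> k; rewrite kerE /= fg subrr.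
Qed.

Definition gring (G : groupType) : Type := {malg int[G]}.
HB.instance Definition _ (G : groupType) := GRing.Zmodule.on (gring G).

Section GroupRing.
Variable G : groupType.
Implicit Types x y z : {malg int[G]}.

Definition gring_one : {malg int[G]} := << 1%g >>.
Definition gring_mul x y : {malg int[G]} :=
  flift (fun a : G => flift (fun b : G => << (a * b)%g >>) y) x.

Fact gring_mulDl : left_distributive gring_mul +%R.
Proof. by move=> x y z; exact: raddfD. Qed.

Fact gring_mulDr : right_distributive gring_mul +%R.
Proof.
move=> x y z; rewrite /gring_mul -fliftD; congr (flift _ x).
by apply/funext => a; exact: raddfD.
Qed.

Definition gring_mulr y x := gring_mul x y.
Fact gring_mul_zmod x : zmod_morphism (gring_mul x).
Proof.
move=> y z; apply: (addIr (gring_mul x z)).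
by rewrite -gring_mulDr !subrK.
Qed.
HB.instance Definition _ x :=
  GRing.isZmodMorphism.Build _ _ (gring_mul x) (gring_mul_zmod x).
Fact gring_mulr_zmod y : zmod_morphism (gring_mulr y).
Proof. by move=> x z; rewrite /gring_mulr /gring_mul raddfB. Qed.
HB.instance Definition _ y :=
  GRing.isZmodMorphism.Build _ _ (gring_mulr y) (gring_mulr_zmod y).

Lemma gring_mulUU (a b : G) :
  gring_mul << a >> << b >> = << (a * b)%g >>.
Proof. by rewrite /gring_mul !fliftU. Qed.

Fact gring_mulA : associative gring_mul.
Proof.
move=> x y z.
apply: (malg_int_ext (f := gring_mulr (gring_mul y z))
  (g := gring_mulr z \o gring_mulr y)) => a /=.
rewrite /gring_mulr.
apply: (malg_int_ext (f := gring_mul << a >> \o gring_mulr z)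
  (g := gring_mulr z \o gring_mul << a >>)) => b /=.
rewrite /gring_mulr.
apply: (malg_int_ext (f := gring_mul << a >> \o gring_mul << b >>)
  (g := gring_mul (gring_mul << a >> << b >>))) => c /=.
by rewrite !gring_mulUU mulgA.
Qed.

Fact gring_mul1 : left_id gring_one gring_mul.
Proof.
by apply: (malg_int_ext (f := gring_mul gring_one) (g := idfun)) => a; rewrite
  /= /gring_one gring_mulUU mul1g.
Qed.
Fact gring_mulr1 : right_id gring_one gring_mul.
Proof.
by apply: (malg_int_ext (f := gring_mulr gring_one) (g := idfun)) => a; rewrite
  /= /gring_mulr /gring_one gring_mulUU mulg1.
Qed.
Fact gring_one_neq0 : gring_one != 0.
Proof. by rewrite monalgU_eq0. Qed.

HB.instance Definition _ := GRing.Zmodule_isNzRing.Build (gring G)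
  gring_mulA gring_mul1 gring_mulr1 gring_mulDl gring_mulDr gring_one_neq0.
End GroupRing.

Section GroupRingMap.
Variables (G H : groupType) (phi : {ghom G -> H}).

Definition gring_map : gring G -> gring H := flift (fun a : G => << phi a >>).
Fact gring_map_zmod : zmod_morphism gring_map.
Proof. exact: raddfB. Qed.
HB.instance Definition _ :=
  GRing.isZmodMorphism.Build (gring G) (gring H) gring_map gring_map_zmod.

Lemma gring_mapM : {morph gring_map : x y / x * y}.
Proof.
move=> x y.
apply: (malg_int_ext (f := gring_map \o @gring_mulr G y)
  (g := @gring_mulr H (gring_map y) \o gring_map)) => a /=.
apply: (malg_int_ext (f := gring_map \o @gring_mul G << a >>)
  (g := @gring_mul H (gring_map << a >>) \o gring_map)) => b /=.
by rewrite gring_mulUU /gring_map !fliftU gring_mulUU gmulfM.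
Qed.
End GroupRingMap.

Definition gring_aug (G : groupType) : gring G -> int := flift (fun=> 1).
HB.instance Definition _ G :=
  GRing.Additive.copy (@gring_aug G) (flift (fun _ : G => (1 : int))).

Section Tensor.
Variables M N : zmodType.

Definition tens_rel : set {malg int[(M * N)%type]} :=
  [set x | (exists m m' n,
             x = << (m + m', n) >> - << (m, n) >> - << (m', n) >>)
        \/ (exists m n n',
             x = << (m, n + n') >> - << (m, n) >> - << (m, n') >>)].

Definition tens : zmodType := {ideal_quot spanz tens_rel}.
Definition pure (m : M) (n : N) : tens :=
  \pi_{ideal_quot spanz tens_rel} << (m, n) >>.
End Tensor.

Section TensorMap.
Variables (M N M' N' : zmodType).
Variables (f : {additive M -> M'}) (g : {additive N -> N'}).

Definition tens_premap :
    {additive {malg int[(M * N)%type]} -> {malg int[(M' * N')%type]}} :=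
  flift (fun p : (M * N)%type => << (f p.1, g p.2) >>).

Fact tens_map_subproof x :
  x \in spanz (@tens_rel M N) -> tens_premap x \in spanz (@tens_rel M' N').
Proof.
apply: (spanP (A := preimz tens_premap (spanz _))) => s.
by case=> [[m [m' [n ->]]]|[m [n [n' ->]]]]; apply: mem_span;
  rewrite /= !raddfB /= !fliftU /= raddfD; [left|right]; repeat eexists.
Qed.

Definition tens_map : {additive tens M N -> tens M' N'} :=
  quot_map tens_map_subproof.

Lemma tens_map_pure m n : tens_map (pure m n) = pure (f m) (g n).
Proof. by rewrite [LHS]quot_map_pi /= fliftU. Qed.
End TensorMap.

(* The tensor product over a ring S of a right module M and a left module N;
   of the module structures only the two scalar multiplications are needed. *)
Section TensorOver.
Variables (S : Type) (M N : zmodType) (mr : M -> S -> M) (nl : S -> N -> N).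

Definition bal_rel : set (tens M N) :=
  [set x | exists m s n, x = pure (mr m s) n - pure m (nl s n)].
Definition tens_over : zmodType := {ideal_quot spanz bal_rel}.
End TensorOver.

Section TensorOverMap.
Variables (S S' : Type) (M N M' N' : zmodType).
Variables (mr : M -> S -> M) (nl : S -> N -> N).
Variables (mr' : M' -> S' -> M') (nl' : S' -> N' -> N').
Variables (f : {additive M -> M'}) (g : {additive N -> N'}) (h : S -> S').
Hypothesis fP : forall m s, f (mr m s) = mr' (f m) (h s).
Hypothesis gP : forall s n, g (nl s n) = nl' (h s) (g n).

Fact tens_over_map_subproof x :
  x \in spanz (bal_rel mr nl) -> tens_map f g x \in spanz (bal_rel mr' nl').
Proof.
apply: (spanP (A := preimz (tens_map f g) (spanz _))) => _ [m [s [n ->]]].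
apply: mem_span; rewrite raddfB !tens_map_pure fP gP.
by repeat eexists.
Qed.

Definition tens_over_map : {additive tens_over mr nl -> tens_over mr' nl'} :=
  quot_map tens_over_map_subproof.
End TensorOverMap.

(* Tor_1(A, B) over the integers is the first homology of P (x) B, for the
   standard free resolution ... -> P2 -> P1 -> P0 of A, in which P0 is free on
   the underlying set of A and each further term is free on the underlying set
   of the previous kernel. *)
Section Tor.
Variables A B : zmodType.

Definition tor_P0 : zmodType := {malg int[A]}.
Definition tor_d0 : {additive tor_P0 -> A} := flift (@id A).
Definition tor_P1 : zmodType := {malg int[subz (kerz tor_d0)]}.
Definition tor_d1 : {additive tor_P1 -> tor_P0} :=
  flift (@subz_val _ (kerz tor_d0)).
Definition tor_P2 : zmodType := {malg int[subz (kerz tor_d1)]}.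
Definition tor_d2 : {additive tor_P2 -> tor_P1} :=
  flift (@subz_val _ (kerz tor_d1)).

Definition Tor : zmodType :=
  subquot (kerz (tens_map tor_d1 (@idfun B)))
    (imz (tens_map tor_d2 (@idfun B))).
End Tor.

Section Abelianization.
Variable G : groupType.

Definition derived_pred : {pred G} := fun x =>
  `[< forall A : groupClosed G,
        (forall a b : G, [~ a, b]%g \in A) -> x \in A >].

Fact derived_group_closed :
  [/\ (1%g \in derived_pred),
      {in derived_pred, forall x, x^-1%g \in derived_pred} &
      {in derived_pred &, forall x y, (x * y)%g \in derived_pred}].
Proof.
split=> [|x /asboolP xD|x y /asboolP xD /asboolP yD]; apply/asboolP => A AD.
- exact: gpred1.
- by rewrite gpredVr ?xD.
- by rewrite gpredM ?xD ?yD.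
Qed.

Lemma mem_derived (a b : G) : [~ a, b]%g \in derived_pred.
Proof. by apply/asboolP => A. Qed.

Definition ab_equiv (x y : G) : bool := (x^-1 * y)%g \in derived_pred.

Fact ab_equiv_class : equiv_class_of ab_equiv.
Proof.
have [D1 DV DM] := derived_group_closed; rewrite /ab_equiv.
have sym x y : (x^-1 * y)%g \in derived_pred -> (y^-1 * x)%g \in derived_pred.
  by move=> /DV; rewrite invgM invgK.
split=> [x|x y|y x z].
- by rewrite mulVg.
- by apply/idP/idP; exact: sym.
- by move=> xy yz; rewrite -[z](mulVKg y) mulgA DM.
Qed.

Canonical ab_equiv_equiv := EquivRelPack ab_equiv_class.
Canonical ab_equiv_encModRel := defaultEncModRel ab_equiv.

Definition ab := {eq_quot ab_equiv}.
HB.instance Definition _ := Choice.on ab.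

Definition ab_pi (x : G) : ab := \pi_ab x.

Lemma ab_piP x y : ab_pi x = ab_pi y <-> (x^-1 * y)%g \in derived_pred.
Proof. by rewrite -/(ab_equiv x y); split=> [/eqmodP|/eqmodP]. Qed.

Lemma ab_ind (P : ab -> Prop) : (forall x, P (ab_pi x)) -> forall u, P u.
Proof. by move=> Ppi u; rewrite -[u]reprK. Qed.

Definition ab_add (u v : ab) : ab := ab_pi (repr u * repr v)%g.
Definition ab_opp (u : ab) : ab := ab_pi (repr u)^-1%g.
Definition ab_zero : ab := ab_pi 1%g.

Lemma derivedJ x y : x \in derived_pred -> (y^-1 * x * y)%g \in derived_pred.
Proof.
have [_ _ DM] := derived_group_closed => xD.
have -> : (y^-1 * x * y = x * [~ x, y])%g by rewrite /commg /conjg mulVKg mulgA.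
exact: DM (mem_derived _ _).
Qed.

Lemma repr_ab x : ((repr (ab_pi x))^-1 * x)%g \in derived_pred.
Proof. by apply/ab_piP; rewrite /ab_pi reprK. Qed.

Lemma ab_piM x y : ab_add (ab_pi x) (ab_pi y) = ab_pi (x * y)%g.
Proof.
have [_ _ DM] := derived_group_closed; apply/ab_piP.
set x' := repr (ab_pi x); set y' := repr (ab_pi y).
have -> : ((x' * y')^-1 * (x * y) =
  (y'^-1 * (x'^-1 * x) * y') * (y'^-1 * y))%g.
  by rewrite invgM !mulgA mulgK.
by apply: DM; rewrite ?derivedJ // repr_ab.
Qed.

Lemma ab_piV x : ab_opp (ab_pi x) = ab_pi x^-1%g.
Proof.
have [_ DV _] := derived_group_closed; apply/ab_piP; rewrite invgK.
set x' := repr (ab_pi x).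
have := derivedJ x'^-1%g (DV _ (repr_ab x)).
by rewrite -/x' invgM !invgK !mulgA mulgK.
Qed.

Fact ab_addA : associative ab_add.
Proof.
by elim/ab_ind=> x; elim/ab_ind=> y; elim/ab_ind=> z; rewrite !ab_piM mulgA.
Qed.
Fact ab_addC : commutative ab_add.
Proof.
elim/ab_ind=> x; elim/ab_ind=> y; rewrite !ab_piM; apply/ab_piP.
have -> : ((x * y)^-1 * (y * x) = [~ y, x])%g.
  by rewrite /commg /conjg invgM !mulgA.
exact: mem_derived.
Qed.
Fact ab_add0 : left_id ab_zero ab_add.
Proof. by elim/ab_ind=> x; rewrite ab_piM mul1g. Qed.
Fact ab_addN : left_inverse ab_zero ab_opp ab_add.
Proof. by elim/ab_ind=> x; rewrite ab_piV ab_piM mulVg. Qed.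
HB.instance Definition _ :=
  GRing.isZmodule.Build ab ab_addA ab_addC ab_add0 ab_addN.
End Abelianization.

Section AbMap.
Variables (G H : groupType) (phi : {ghom G -> H}).

Section PreimGroup.
Variable A : groupClosed H.
Definition gpreim_pred : {pred G} := fun x => phi x \in A.
Fact gpreim1 : 1%g \in gpreim_pred.
Proof. by rewrite -topredE /= /gpreim_pred gmulf1 gpred1. Qed.
Fact gpreimM : mulg_closed gpreim_pred.
Proof. by move=> y z yA zA; rewrite -topredE /= /gpreim_pred gmulfM gpredM. Qed.
Fact gpreimV : invg_closed gpreim_pred.
Proof. by move=> y yA; rewrite -topredE /= /gpreim_pred gmulfV gpredVr. Qed.
HB.instance Definition _ := isMulClosed.Build G gpreim_pred gpreimM.
HB.instance Definition _ := isMul1Closed.Build G gpreim_pred gpreim1.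
HB.instance Definition _ := isInvClosed.Build G gpreim_pred gpreimV.
End PreimGroup.

Fact derived_map x : x \in @derived_pred G -> phi x \in @derived_pred H.
Proof.
move=> /asboolP xD; apply/asboolP => A AD.
apply: (xD (gpreim_pred A)) => a b.
by rewrite -topredE /= /gpreim_pred gmulfR AD.
Qed.

Definition ab_map (u : ab G) : ab H := ab_pi (phi (repr u)).

Lemma ab_map_pi x : ab_map (ab_pi x) = ab_pi (phi x).
Proof. by apply/ab_piP; rewrite -gmulfV -gmulfM derived_map ?repr_ab. Qed.

Fact ab_map_nmod : nmod_morphism ab_map.
Proof.
split=> [|u v]; first by rewrite -[0]/(ab_pi 1%g) ab_map_pi gmulf1.
elim/ab_ind: u => x; elim/ab_ind: v => y.
rewrite -[ab_pi x + _]/(ab_add _ _) ab_piM !ab_map_pi gmulfM.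
by rewrite -[RHS]/(ab_add _ _) ab_piM.
Qed.
HB.instance Definition _ :=
  GRing.isNmodMorphism.Build (ab G) (ab H) ab_map ab_map_nmod.
End AbMap.

Record category := Category {
  ob :> Type;
  chom : ob -> ob -> Type;
  idc : forall c, chom c c;
  ccomp : forall c d e, chom c d -> chom d e -> chom c e;
  comp_idl : forall c d (f : chom c d), ccomp (idc c) f = f;
  comp_idr : forall c d (f : chom c d), ccomp f (idc d) = f;
  comp_assoc : forall c d e k (f : chom c d) (g : chom d e) (h : chom e k),
    ccomp f (ccomp g h) = ccomp (ccomp f g) h }.
Arguments chom {_} _ _.
Arguments idc {_} _.
Arguments ccomp {_ _ _ _} _ _.

Record functor (C D : category) := Functor {
  fob :> C -> D;
  fhom : forall c d, chom c d -> chom (fob c) (fob d);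
  fhom_id : forall c, fhom (idc c) = idc (fob c);
  fhom_comp : forall c d e (f : chom c d) (g : chom d e),
    fhom (ccomp f g) = ccomp (fhom f) (fhom g) }.
Arguments fhom {_ _} _ {_ _} _.

Record abfunctor (C : category) := AbFunctor {
  aob :> C -> zmodType;
  ahom : forall c d, chom c d -> {additive aob c -> aob d};
  ahom_id : forall c x, ahom (idc c) x = x;
  ahom_comp : forall c d e (f : chom c d) (g : chom d e) x,
    ahom (ccomp f g) x = ahom g (ahom f x) }.
Arguments ahom {_} _ {_ _} _.

Record abnat (C : category) (S T : abfunctor C) := AbNat {
  abcomp :> forall c, {additive S c -> T c};
  abcompP : forall c d (f : chom c d) x,
    abcomp d (ahom S f x) = ahom T f (abcomp c x) }.

Definition abiso (C : category) (S T : abfunctor C) (t : abnat S T) : Prop :=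
  forall c, bijective (t c).

Definition abconst (C : category) (A : zmodType) : abfunctor C :=
  @AbFunctor C (fun=> A) (fun _ _ _ => idfun)
    (fun _ _ => erefl) (fun _ _ _ _ _ _ => erefl).

Definition is_constant (C : category) (T : abfunctor C) : Prop :=
  exists (A : zmodType) (t : abnat T (abconst C A)), abiso t.

Section Pullback.
Variables (C D : category) (K : functor D C) (T : abfunctor C).
Definition abpull : abfunctor D.
Proof.
apply: (@AbFunctor D (fun d => T (K d)) (fun _ _ f => ahom T (fhom K f))).
- by move=> c x; rewrite fhom_id ahom_id.
- by move=> c d e f g x; rewrite fhom_comp ahom_comp.
Defined.
End Pullback.

Section Limit.
Variables (C : category) (T : abfunctor C).

Record lim := Lim {
  lim_val :> forall c, T c;
  limP : forall c d (f : chom c d), ahom T f (lim_val c) = lim_val d }.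

Lemma lim_eq (x y : lim) : (forall c, x c = y c) -> x = y.
Proof.
case: x y => [x xP] [y yP] /= xy.
have E : x = y by apply: functional_extensionality_dep.
by rewrite E in xP *; rewrite (Prop_irrelevance xP yP).
Qed.

HB.instance Definition _ := gen_eqMixin lim.
HB.instance Definition _ := gen_choiceMixin lim.

Definition lim_zero : lim.
Proof. by exists (fun=> 0) => c d f; rewrite raddf0. Defined.
Definition lim_opp (x : lim) : lim.
Proof. by exists (fun c => - x c) => c d f; rewrite raddfN limP. Defined.
Definition lim_add (x y : lim) : lim.
Proof. by exists (fun c => x c + y c) => c d f; rewrite raddfD !limP. Defined.

Fact lim_addA : associative lim_add.
Proof. by move=> x y z; apply: lim_eq => c /=; rewrite addrA. Qed.
Fact lim_addC : commutative lim_add.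
Proof. by move=> x y; apply: lim_eq => c /=; rewrite addrC. Qed.
Fact lim_add0 : left_id lim_zero lim_add.
Proof. by move=> x; apply: lim_eq => c /=; rewrite add0r. Qed.
Fact lim_addN : left_inverse lim_zero lim_opp lim_add.
Proof. by move=> x; apply: lim_eq => c /=; rewrite addNr. Qed.
HB.instance Definition _ :=
  GRing.isZmodule.Build lim lim_addA lim_addC lim_add0 lim_addN.
End Limit.

Section LimitMap.
Variables (C : category) (S T : abfunctor C) (t : abnat S T).
Definition lim_map (x : lim S) : lim T.
Proof. by exists (fun c => t c (x c)) => c d f; rewrite -abcompP limP. Defined.
Fact lim_map_zmod : zmod_morphism lim_map.
Proof. by move=> x y; apply: lim_eq => c /=; rewrite raddfB. Qed.
HB.instance Definition _ :=
  GRing.isZmodMorphism.Build (lim S) (lim T) lim_map lim_map_zmod.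
End LimitMap.

Section LimitRestriction.
Variables (C D : category) (K : functor D C) (T : abfunctor C).
Definition lim_res (x : lim T) : lim (abpull K T).
Proof. by exists (fun d => x (K d)) => c d f; rewrite /= limP. Defined.
Fact lim_res_zmod : zmod_morphism lim_res.
Proof. by move=> x y; apply: lim_eq. Qed.
HB.instance Definition _ :=
  GRing.isZmodMorphism.Build (lim T) (lim (abpull K T)) lim_res lim_res_zmod.
End LimitRestriction.

Record complex := Complex {
  cob :> nat -> zmodType;
  cd : forall n, {additive cob n -> cob n.+1};
  cdd : forall n x, cd n.+1 (cd n x) = 0 }.

Definition bound (K : complex) (n : nat) : zmodClosed (K n) :=
  if n is m.+1 then imz (cd K m) else zeroz _.

Definition coh (K : complex) (n : nat) : zmodType :=
  subquot (kerz (cd K n)) (bound K n).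

Record cmap (K L : complex) := CMap {
  cmap_val :> forall n, {additive K n -> L n};
  cmapP : forall n x, cmap_val n.+1 (cd K n x) = cd L n (cmap_val n x) }.

Section CohMap.
Variables (K L : complex) (f : cmap K L) (n : nat).
Fact coh_map_ker x : x \in kerz (cd K n) -> f n x \in kerz (cd L n).
Proof. by rewrite !kerE -cmapP => /eqP ->; rewrite raddf0. Qed.
Fact coh_map_bound x : x \in bound K n -> f n x \in bound L n.
Proof.
case: n x => [|m] x /=; first by rewrite !inE => /eqP ->; rewrite raddf0.
by move=> /imP[y <-]; apply/imP; exists (f m y); rewrite cmapP.
Qed.
Definition coh_map : {additive coh K n -> coh L n} :=
  subquot_map coh_map_ker coh_map_bound.
End CohMap.

(* Injective objects of the category of functors C -> Ab, whose monomorphisms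
   are the pointwise injective natural transformations. *)
Definition injective_abfunctor (C : category) (J : abfunctor C) : Prop :=
  forall (S T : abfunctor C) (i : abnat S T) (f : abnat S J),
    (forall c, injective (i c)) ->
    exists g : abnat T J, forall c x, g c (i c x) = f c x.

Record injres (C : category) (T : abfunctor C) := InjRes {
  res :> nat -> abfunctor C;
  res_d : forall n, abnat (res n) (res n.+1);
  res_aug : abnat T (res 0);
  res_inj : forall n, injective_abfunctor (res n);
  res_aug_inj : forall c, injective (res_aug c);
  res_exact0 : forall c x,
    res_d 0 c x = 0 <-> exists y, res_aug c y = x;
  res_exact : forall n c x,
    res_d n.+1 c x = 0 <-> exists y, res_d n c y = x }.
Arguments res_d {_ _} _ _.
Arguments res_aug {_ _} _.

Section DerivedLimit.
Variables (C : category) (T : abfunctor C) (R : injres T).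

Fact lim_res_dd n (x : lim (R n)) :
  lim_map (res_d R n.+1) (lim_map (res_d R n) x) = 0.
Proof. by apply: lim_eq => c /=; apply/res_exact; exists (x c). Qed.
Definition lim_complex : complex :=
  @Complex (fun n => lim (R n)) (fun n => lim_map (res_d R n)) lim_res_dd.

(* lim^i T. The resolution R is kept as a parameter: T has one, and different
   choices give canonically isomorphic groups. *)
Definition rlim (i : nat) : zmodType := coh lim_complex i.
End DerivedLimit.

(* A functor K : D -> C and a natural transformation t : T o K -> T' induce
   maps lim^i T -> lim^i T': the restriction to D followed by the map induced
   by a lift of t to the resolutions. *)
Section DerivedLimitMap.
Variables (C D : category) (K : functor D C).
Variables (T : abfunctor C) (T' : abfunctor D) (t : abnat (abpull K T) T').
Variables (R : injres T) (R' : injres T').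

Record res_lift := ResLift {
  lift_val :> forall n, abnat (abpull K (R n)) (R' n);
  lift_d : forall n d x,
    lift_val n.+1 d (res_d R n (K d) x) = res_d R' n d (lift_val n d x);
  lift_aug : forall d x,
    lift_val 0 d (res_aug R (K d) x) = res_aug R' d (t d x) }.

Variable l : res_lift.
Fact rlim_cmap_subproof n (x : lim (R n)) :
  (lim_map (l n.+1) \o lim_res K (T := R n.+1)) (cd (lim_complex R) n x) =
  cd (lim_complex R') n ((lim_map (l n) \o lim_res K (T := R n)) x).
Proof. by apply: lim_eq => d /=; rewrite lift_d. Qed.
Definition rlim_cmap : cmap (lim_complex R) (lim_complex R') :=
  @CMap (lim_complex R) (lim_complex R')
    (fun n => lim_map (l n) \o lim_res K (T := R n)) rlim_cmap_subproof.
Definition rlim_map (i : nat) : {additive rlim R i -> rlim R' i} :=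
  coh_map rlim_cmap i.
End DerivedLimitMap.

(* A group carried by a type in a universe strictly below the one that hosts
   zmodType. The presentations of such a group by such groups then form a type
   small enough for products of abelian groups over it to be abelian groups,
   so that limits over Pres(G) exist. *)
Structure grp := Grp { grp_sort : Type; grp_class : Group.axioms_ grp_sort }.
Definition grp_group (G : grp) : groupType := Group.Pack (grp_class G).
Coercion grp_group : grp >-> Group.type.

(* F has a basis B. *)
Definition is_free (F : groupType) : Prop :=
  exists B : set F, forall (H : groupType) (h : F -> H),
    exists2 u : {ghom F -> H}, (forall b, B b -> u b = h b) &
      forall v : {ghom F -> H}, (forall b, B b -> v b = h b) -> v =1 u.

Record pres (G : grp) := Pres {
  pgrp :> grp;
  pproj : {ghom pgrp -> G};
  pproj_surj : forall g, exists x, pproj x = g;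
  pgrp_free : is_free pgrp }.

(* Morphisms of presentations lying over a map phi : G -> H; the morphisms of
   Pres(G) are those over the identity. *)
Record pmor (G H : grp) (phi : G -> H) (c : pres G) (d : pres H) := PMor {
  pmor_val :> {ghom c -> d};
  pmorP : forall x, pproj d (pmor_val x) = phi (pproj c x) }.

Lemma ghom_eq (G H : groupType) (u v : {ghom G -> H}) : u =1 v -> u = v.
Proof.
case: u v => [u [[u1] [uM]]] [v [[v1] [vM]]] /= uv.
have E : u = v by apply: functional_extensionality_dep.
rewrite E in u1 uM *.
by rewrite (Prop_irrelevance u1 v1) (Prop_irrelevance uM vM).
Qed.

Lemma pmor_eq (G H : grp) (phi : G -> H) (c : pres G) (d : pres H)
  (f g : pmor phi c d) : f =1 g -> f = g.
Proof.
move=> fg; have E : pmor_val f = pmor_val g by exact: ghom_eq.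
case: f g fg E => [f fP] [g gP] /= _ E; rewrite E in fP *.
by rewrite (Prop_irrelevance fP gP).
Qed.

Section PresCategory.
Variable G : grp.
Definition pmor_id (c : pres G) : pmor idfun c c :=
  @PMor G G idfun c c idfun (fun=> erefl).
Definition pmor_comp (c d e : pres G)
  (f : pmor idfun c d) (g : pmor idfun d e) :
  pmor idfun c e.
Proof. by exists (g \o f) => x /=; rewrite !pmorP. Defined.

Definition pres_cat : category.
Proof.
by apply: (@Category (pres G) (pmor idfun) pmor_id pmor_comp) => *;
  apply: pmor_eq.
Defined.
End PresCategory.

Section Ideals.
Variable R : nzRingType.
Implicit Types I J : zmodClosed R.

Definition idmul I J : zmodClosed R :=
  spanz [set x | exists a b, [/\ a \in I, b \in J & x = a * b]].
Definition idadd I J : zmodClosed R := spanz [set x | x \in I \/ x \in J].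
End Ideals.

Declare Scope ideal_scope.
Delimit Scope ideal_scope with I.
Bind Scope ideal_scope with GRing.ZmodClosed.type.
Notation "I * J" := (idmul I J) : ideal_scope.
Notation "I + J" := (idadd I J) : ideal_scope.

Section IdealMap.
Variables (G H : groupType) (phi : {ghom G -> H}).
Variables (I J : zmodClosed (gring G)) (I' J' : zmodClosed (gring H)).
Hypothesis hI : forall x, x \in I -> gring_map phi x \in I'.
Hypothesis hJ : forall x, x \in J -> gring_map phi x \in J'.

Lemma idmul_map x : x \in (I * J)%I -> gring_map phi x \in (I' * J')%I.
Proof.
apply: (spanP (A := preimz (gring_map phi) (I' * J')%I)) => s.
case=> a [b [aI bJ ->]].
apply: mem_span; exists (gring_map phi a), (gring_map phi b).
by split; [exact: hI | exact: hJ | exact: gring_mapM].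
Qed.

Lemma idadd_map x : x \in (I + J)%I -> gring_map phi x \in (I' + J')%I.
Proof.
apply: (spanP (A := preimz (gring_map phi) (I' + J')%I)) => y yIJ.
by apply: mem_span; case: yIJ => ?; [left; apply: hI | right; apply: hJ].
Qed.
End IdealMap.

(* The ideals denoted f (or g) and r. *)
Definition augI (G : groupType) : zmodClosed (gring G) := kerz (@gring_aug G).
Definition relI (G : grp) (c : pres G) : zmodClosed (gring c) :=
  kerz (gring_map (pproj c)).

Section FRIdeals.
Variables (G : grp) (c : pres G).
Let f := augI c.
Let r := relI c.
Definition frI : zmodClosed (gring c) := (r * r + f * f * r + r * f * f)%I.
Definition sqI : zmodClosed (gring c) := ((r + f * f) * (r + f * f))%I.
End FRIdeals.

Lemma augI_map (G H : groupType) (phi : {ghom G -> H}) x :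
  x \in augI G -> gring_map phi x \in augI H.
Proof.
rewrite !kerE => /eqP <-; apply/eqP.
apply: (malg_int_ext (f := @gring_aug H \o gring_map phi)
  (g := @gring_aug G)) => a /=.
by rewrite /gring_map !fliftU /gring_aug !fliftU.
Qed.

Section FRMap.
Variables (G H : grp) (phi : {ghom G -> H}) (c : pres G) (d : pres H).
Variable f : pmor phi c d.

Lemma relI_map x : x \in relI c -> gring_map f x \in relI d.
Proof.
rewrite !kerE => /eqP x0; apply/eqP.
rewrite -[RHS](raddf0 (gring_map phi)) -x0.
apply: (malg_int_ext (f := gring_map (pproj d) \o gring_map f)
  (g := gring_map phi \o gring_map (pproj c))) => a /=.
by rewrite /gring_map !fliftU pmorP.
Qed.

Lemma frI_map x : x \in frI c -> gring_map f x \in frI d.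
Proof.
by do ?[apply: idadd_map | apply: idmul_map] => ?;
  (apply: relI_map || apply: augI_map).
Qed.

Lemma sqI_map x : x \in sqI c -> gring_map f x \in sqI d.
Proof.
by do ?[apply: idadd_map | apply: idmul_map] => ?;
  (apply: relI_map || apply: augI_map).
Qed.

Definition fr_map : {additive subz (frI c) -> subz (frI d)} := subz_map frI_map.
Definition sqfr_map :
    {additive subquot (sqI c) (frI c) -> subquot (sqI d) (frI d)} :=
  subquot_map sqI_map frI_map.
End FRMap.

Lemma gring_map_id (G : groupType) (u : {ghom G -> G}) x :
  u =1 id -> gring_map u x = x.
Proof.
move=> u1; apply: (malg_int_ext (f := gring_map u) (g := idfun)) => a /=.
by rewrite /gring_map fliftU u1.
Qed.

Lemma gring_map_comp (G H K : groupType) (u : {ghom G -> H}) (v : {ghom H -> K})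
    (w : {ghom G -> K}) x :
  w =1 v \o u -> gring_map w x = gring_map v (gring_map u x).
Proof.
move=> wE; apply: (malg_int_ext (f := gring_map w)
  (g := gring_map v \o gring_map u)) => a /=.
by rewrite /gring_map !fliftU wE.
Qed.

Section PresFunctors.
Variable G : grp.

Definition frF : abfunctor (pres_cat G).
Proof.
apply: (@AbFunctor (pres_cat G) (fun c : pres G => subz (frI c))
  (fun c d (f : pmor idfun c d) => fr_map (phi := idfun) f)).
- by move=> c x; apply: val_inj; exact: gring_map_id.
- by move=> c d e f g x; apply: val_inj; exact: gring_map_comp.
Defined.

(* sqI c contains frI c, so that subquot is here the quotient sqI c / frI c. *)
Definition sqfrF : abfunctor (pres_cat G).
Proof.
apply: (@AbFunctor (pres_cat G) (fun c : pres G => subquot (sqI c) (frI c))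
  (fun c d (f : pmor idfun c d) => sqfr_map (phi := idfun) f)).
- move=> c; elim/subquot_ind => x; rewrite subquot_map_pi; congr subquot_pi.
  by apply: val_inj; exact: gring_map_id.
- move=> c d e f g; elim/subquot_ind => x; rewrite subquot_map_pi /sqfr_map.
  rewrite (subquot_map_pi (sqI_map f) (@frI_map _ _ idfun _ _ f)).
  rewrite [RHS]subquot_map_pi; congr subquot_pi; apply: val_inj.
  exact: gring_map_comp.
Defined.
End PresFunctors.

Section AugSquare.
Variable G : groupType.
Definition aug2I : zmodClosed (gring G) := (augI G * augI G)%I.

Lemma gring_augM : {morph @gring_aug G : x y / x * y}.
Proof.
move=> x y.
apply: (malg_int_ext (f := @gring_aug G \o @gring_mulr G y)
  (g := gring_aug y \o* @gring_aug G)) => a /=.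
apply: (malg_int_ext (f := @gring_aug G \o @gring_mul G << a >>)
  (g := gring_aug (<< a >> : gring G) \*o @gring_aug G)) => b /=.
by rewrite gring_mulUU /gring_aug !fliftU.
Qed.

Fact augI_mulr x s : x \in augI G -> x * s \in augI G.
Proof. by rewrite !kerE /= gring_augM => /eqP ->; rewrite mul0r. Qed.
Fact augI_mull s x : x \in augI G -> s * x \in augI G.
Proof. by rewrite !kerE /= gring_augM => /eqP ->; rewrite mulr0. Qed.

Fact aug2I_mulr x s : x \in aug2I -> x * s \in aug2I.
Proof.
apply: (spanP (A := preimz (@gring_mulr G s) aug2I)) => _ [a [b [aI bI ->]]].
apply: mem_span; exists a, (b * s); split=> //; first exact: augI_mulr.
by rewrite mulrA.
Qed.
Fact aug2I_mull s x : x \in aug2I -> s * x \in aug2I.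
Proof.
apply: (spanP (A := preimz (@gring_mul G s) aug2I)) => _ [a [b [aI bI ->]]].
apply: mem_span; exists (s * a), b; split=> //; first exact: augI_mull.
by rewrite -mulrA.
Qed.

Definition aug2_mulr (x : subz aug2I) (s : gring G) : subz aug2I :=
  Subz (aug2I_mulr s (subz_valP x)).
Definition aug2_mull (s : gring G) (x : subz aug2I) : subz aug2I :=
  Subz (aug2I_mull s (subz_valP x)).

Definition aug2_tens : zmodType := tens_over aug2_mulr aug2_mull.
End AugSquare.

Section AugSquareMap.
Variables (G H : groupType) (phi : {ghom G -> H}).
Fact aug2I_map x : x \in aug2I G -> gring_map phi x \in aug2I H.
Proof. by apply: idmul_map; apply: augI_map. Qed.

Fact aug2_map_mulr (m : subz (aug2I G)) (s : gring G) :
  subz_map aug2I_map (aug2_mulr m s) =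
  aug2_mulr (subz_map aug2I_map m) (gring_map phi s).
Proof. by apply: val_inj; exact: gring_mapM. Qed.
Fact aug2_map_mull (s : gring G) (m : subz (aug2I G)) :
  subz_map aug2I_map (aug2_mull s m) =
  aug2_mull (gring_map phi s) (subz_map aug2I_map m).
Proof. by apply: val_inj; exact: gring_mapM. Qed.

Definition aug2_tens_map : {additive aug2_tens G -> aug2_tens H} :=
  tens_over_map aug2_map_mulr aug2_map_mull.
End AugSquareMap.

(* A group morphism phi : G -> H induces lim^i frF(G) -> lim^i frF(H) along any
   functor K : Pres(H) -> Pres(G) equipped with natural morphisms K d -> d over
   phi; for instance K d may be the free group on the underlying set of the
   fibre product of d and G over H. The induced map does not depend on K. *)
Record base_change (G H : grp) (phi : G -> H) := BaseChange {
  bc_fun :> functor (pres_cat H) (pres_cat G);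
  bc_mor : forall d : pres H, pmor phi (bc_fun d : pres G) d;
  bc_nat : forall (d e : pres_cat H) (f : chom d e) x,
    bc_mor e (fhom bc_fun f x) = f (bc_mor d x) }.

Section BaseChangeFr.
Variables (G H : grp) (phi : {ghom G -> H}) (K : base_change phi).
Definition frF_bc : abnat (abpull K (frF G)) (frF H).
Proof.
apply: (@AbNat _ (abpull K (frF G)) (frF H)
  (fun d : pres H => fr_map (bc_mor K d))).
move=> d e f x; apply: val_inj => /=.
rewrite -(@gring_map_comp _ _ _ _ _ (bc_mor K e \o fhom K f)) //.
rewrite -(@gring_map_comp _ _ _ _ _ (bc_mor K e \o fhom K f)) // => y.
by rewrite /= bc_nat.
Defined.
End BaseChangeFr.

(* Main.v *)
(* Write a = r + ff.  The category Pres(G) has binary coproducts and its hom-sets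
   are nonempty, so lim^n T is the cohomology of the cochain complex
   T(e) -> T(e + e) -> T(e + e + e) -> ... for any fixed presentation e: an
   injective functor J splits off J(- + e), hence has no higher cohomology.
   Functors of the free group alone that kill trivial homomorphisms (ff, F_ab (x) A,
   ...) have no cohomology at all, and constant functors none in positive degrees.

   Fox calculus gives af, aa and w = aa + fff by their quotients
     ff / af = G_ab (x) F_ab,   w / aa = G_ab (x) F_ab (x) G_ab,
     af / q = ker (F_ab (x) G_ab -> G_ab (x) G_ab),
   where q is the kernel of af -> F_ab (x) G_ab, uv |-> [u] (x) [v].  Hence af has
   no cohomology, while q / w = Tor(G_ab, G_ab) and aa / fr are constant and w / aa
   has no cohomology, so q / fr has none in positive degrees.  The low degree
   cohomology of fr is then read off from fr < q < af and from the exact sequence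
   af -> F_ab (x) G_ab -> G_ab (x) G_ab -> 0.  *)

(* The injective resolution in the statement is arbitrary, so its limits cannot be computed
   directly. The groups [R k (CE m)] form a double complex with exact rows and columns in positive
   degrees, and a staircase leads from the limit complex to the Cech complex. Every step of a
   staircase, like every connecting map later on, picks preimages. These maps are therefore kept as
   relations between cochains, which compose and can be pushed along a base change; homomorphisms
   are extracted only at the end.

   Fox calculus needs a basis, and morphisms of presentations do not respect bases. A symbol map is
   natural only on suitable products of ideals, which is why additivity and naturality are always
   asked on a subfunctor.

   Tor is defined by a resolution of G_ab unrelated to F, whereas q / w sees the free presentation
   F_ab -> G_ab. Lifts of the identity of G_ab in both directions, with the two homotopies they
   produce, compare them. *)
Require Import Defs.
From HB Require Import structures.
From mathcomp Require Import all_boot all_algebra finmap boolp classical_sets.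
From mathcomp.multinomials Require Import monalg.

Set Implicit Arguments.
Unset Strict Implicit.
Unset Printing Implicit Defensive.

Import GRing.Theory.
Local Open Scope classical_set_scope.
Local Open Scope ring_scope.
Local Open Scope quotient_scope.

(** * Cohomology of functors on a category with coproducts *)

(* A base object [cpe], and its coproduct with each object [c]. *)
Record copr (C : category) := Copr {
  cpe : C;
  cp : C -> C;
  cp1 : forall c, chom c (cp c);
  cp2 : forall c, chom cpe (cp c);
  cpair : forall c d, chom c d -> chom cpe d -> chom (cp c) d;
  cpair1 : forall c d (f : chom c d) g, ccomp (cp1 c) (cpair f g) = f;
  cpair2 : forall c d (f : chom c d) g, ccomp (cp2 c) (cpair f g) = g;
  cp_ext : forall c d (f g : chom (cp c) d),
    ccomp (cp1 c) f = ccomp (cp1 c) g -> ccomp (cp2 c) f = ccomp (cp2 c) g ->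
    f = g;
  cp_pt : forall c, chom cpe c }.

(** Subfunctors are predicates, so that all ideals live in the single functor [gringF] and quotients
    S' / S need not be formed. *)
Record subfun (C : category) (T : abfunctor C) := SubFun {
  sf_mem :> forall c, T c -> Prop;
  sf0 : forall c, sf_mem (c := c) 0;
  sfB : forall c x y, sf_mem (c := c) x -> sf_mem y -> sf_mem (x - y);
  sf_map : forall c d (f : chom c d) x, sf_mem x -> sf_mem (ahom T f x) }.

Lemma subrACA (V : zmodType) (a b c d : V) :
  (a - b) - (c - d) = (a - c) - (b - d).
Proof. by rewrite !opprB [d - c]addrC [d - b]addrC addrACA. Qed.

Section SubFunTheory.
Variables (C : category) (T : abfunctor C).

Lemma sfN (S : subfun T) c (x : T c) : S c x -> S c (- x).
Proof. by move=> Sx; rewrite -sub0r; apply: sfB => //; exact: sf0. Qed.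
Lemma sfD (S : subfun T) c (x y : T c) : S c x -> S c y -> S c (x + y).
Proof. by move=> Sx Sy; rewrite -[y]opprK; apply: sfB => //; exact: sfN. Qed.

Definition szero : subfun T.
Proof.
exists (fun c x => x = 0) => //.
- by move=> c x y -> ->; rewrite subr0.
- by move=> c d f x ->; rewrite raddf0.
Defined.
Definition sall : subfun T.
Proof. by exists (fun c x => True). Defined.
End SubFunTheory.

Section Cech.
Variables (C : category) (X : copr C).
Implicit Types T V : abfunctor C.

Let e := cpe X.
Let cp := cp X.

Definition cpf c d (f : chom c d) : chom (cp c) (cp d) :=
  cpair (ccomp f (cp1 X d)) (cp2 X d).

Lemma cpf1 c d (f : chom c d) : ccomp (cp1 X c) (cpf f) = ccomp f (cp1 X d).
Proof. exact: cpair1. Qed.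
Lemma cpf2 c d (f : chom c d) : ccomp (cp2 X c) (cpf f) = cp2 X d.
Proof. exact: cpair2. Qed.
Lemma cpf_pair b c d (f : chom b c) (g : chom c d) h :
  ccomp (cpf f) (cpair (c := c) g h) = cpair (ccomp f g) h.
Proof.
apply: cp_ext; first by rewrite comp_assoc cpf1 -comp_assoc !cpair1.
by rewrite comp_assoc cpf2 !cpair2.
Qed.
Lemma cpf_id c : cpf (idc c) = idc (cp c).
Proof. by apply: cp_ext; rewrite ?cpf1 ?cpf2 comp_idr ?comp_idl. Qed.
Lemma cpf_comp b c d (f : chom b c) (g : chom c d) :
  cpf (ccomp f g) = ccomp (cpf f) (cpf g).
Proof. by rewrite [cpf g]/cpf cpf_pair comp_assoc. Qed.

Definition Sh T : abfunctor C.
Proof.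
apply: (@AbFunctor C (fun c => T (cp c)) (fun c d f => ahom T (cpf f))).
- by move=> c x; rewrite cpf_id ahom_id.
- by move=> c d k f g x; rewrite cpf_comp ahom_comp.
Defined.

Definition sSh T (S : subfun T) : subfun (Sh T).
Proof.
exists (fun c x => S (cp c) x).
- by move=> c; exact: sf0.
- by move=> c x y; exact: sfB.
- by move=> c d f x; exact: sf_map.
Defined.

Fixpoint CE n : C := if n is m.+1 then cp (CE m) else e.

Fixpoint cpt n c : chom (CE n) c :=
  if n is m.+1 then cpair (cpt m c) (cp_pt X c) else cp_pt X c.

(* The alternating sum of the coface maps: the first one, minus the
   differential of [T (- + e)] for the others. *)
Fixpoint chd T n : T (CE n) -> T (CE n.+1) :=
  match n return T (CE n) -> T (CE n.+1) with
  | 0 => fun x => ahom T (cp1 X e) x - ahom T (cp2 X e) x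
  | m.+1 => fun x : T (CE m.+1) =>
      ahom T (cp1 X (CE m.+1)) x - @chd (Sh T) m x
  end.

Lemma chdS T n (x : T (CE n.+1)) :
  chd x = ahom T (cp1 X (CE n.+1)) x - @chd (Sh T) n x.
Proof. by []. Qed.

Lemma chdB T n : {morph @chd T n : x y / x - y}.
Proof.
elim: n T => [|n IH] T x y.
  by rewrite /= raddfB (raddfB (ahom T (cp2 X e))) subrACA.
by rewrite chdS (IH (Sh T)) !chdS raddfB subrACA.
Qed.
Lemma chd0 T n : @chd T n 0 = 0.
Proof. by rewrite -(subrr 0) chdB subrr. Qed.
Lemma chdD T n : {morph @chd T n : x y / x + y}.
Proof.
by move=> x y; have := chdB (x + y) y; rewrite addrK => ->; rewrite subrK.
Qed.

Lemma chd_mem T (S : subfun T) n x : S (CE n) x -> S (CE n.+1) (chd x).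
Proof.
elim: n T S x => [|n IH] T S x Sx; first by apply: sfB; exact: sf_map.
by rewrite chdS; apply: sfB; [exact: sf_map | exact: (IH _ (sSh S))].
Qed.

(** [P] is constrained on [S] only, because the symbol maps of Fox calculus have junk values
    elsewhere. The induction passes to the shifts of [T], [V] and [S]. *)
Lemma chd_nat T V (S : subfun T) (P : forall c, T c -> V c) :
  (forall c x y, S c x -> S c y -> P c (x - y) = P c x - P c y) ->
  (forall c d (f : chom c d) x, S c x -> P d (ahom T f x) = ahom V f (P c x)) ->
  forall n x, S (CE n) x -> P (CE n.+1) (chd x) = chd (P (CE n) x).
Proof.
move=> PB Pn n.
elim: n T V S P PB Pn => [|n IH] T V S P PB Pn x Sx.
  by rewrite /= PB ?Pn //; exact: sf_map.
rewrite chdS PB ?Pn //; [|exact: sf_map|exact: (@chd_mem _ (sSh S))].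
rewrite chdS; congr (_ - _).
apply: (IH (Sh T) (Sh V) (sSh S) (fun c => P (cp c))) => //.
- by move=> c y z; exact: PB.
- by move=> c d f y; exact: Pn.
Qed.

Lemma chd_abnat T V (t : abnat T V) n x : t (CE n.+1) (chd x) = chd (t (CE n) x).
Proof.
apply: (chd_nat (S := sall T) (P := fun c => t c)) => // [c y z _ _|c d f y _].
  exact: raddfB.
exact: abcompP.
Qed.

Definition sh_unit T : abnat T (Sh T).
Proof.
apply: (@AbNat _ T (Sh T) (fun c => ahom T (cp1 X c))) => c d f x.
by rewrite /= -!ahom_comp cpf1.
Defined.

(** The unit [T -> Sh T] is natural, hence commutes with [chd]: the two terms containing it cancel,
    and what remains is the square of the differential of [Sh T]. In degree 0 that remainder
    vanishes because [cpf] fixes the second inclusion. *)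
Lemma chdd T n (x : T (CE n)) : chd (chd x) = 0.
Proof.
elim: n T x => [|n IH] T x.
  rewrite chdS.
  have Ea := chd_abnat (sh_unit T) (n := 0) x.
  have Eb : @chd (Sh T) 0 (ahom T (cp2 X e) x) = 0.
    by rewrite /= -!ahom_comp !cpf2; exact: subrr.
  have -> : @chd (Sh T) 0 (chd x) =
    @chd (Sh T) 0 (sh_unit T _ x) - @chd (Sh T) 0 (ahom T (cp2 X e) x).
    by rewrite -chdB.
  by rewrite Eb subr0 -Ea subrr.
rewrite chdS.
have Ea := chd_abnat (sh_unit T) (n := n.+1) x.
have -> : @chd (Sh T) n.+1 (chd x) =
  @chd (Sh T) n.+1 (sh_unit T _ x) - @chd (Sh T) n.+1 (@chd (Sh T) n x).
  by rewrite -chdB.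
by rewrite (IH (Sh T)) subr0 -Ea subrr.
Qed.

(* The degree [n] cohomology of the quotient [S' / S] vanishes. *)
Definition racyc T (S S' : subfun T) n : Prop :=
  match n return Prop with
  | 0 => forall v : T (CE 0), S' _ v -> S _ (chd v) -> S _ v
  | m.+1 => forall v : T (CE m.+1), S' _ v -> S _ (chd v) ->
      exists2 w : T (CE m), S' _ w & S _ (v - chd w)
  end.
Definition acyc T n := racyc (szero T) (sall T) n.

(** A piece of the long exact sequence of 0 -> S' / S -> S2 / S -> S2 / S' -> 0, read at the middle
    term. *)
Lemma racyc_trans T (S S' S2 : subfun T) n :
  (forall c x, S c x -> S' c x) -> (forall c x, S' c x -> S2 c x) ->
  racyc S S' n -> racyc S' S2 n -> racyc S S2 n.
Proof.
case: n => [|n] SS SS2 H1 H2 v v2 vS.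
  by apply: (H1 _ _ vS); apply: H2 => //; exact: SS.
have [w w2 vw] := H2 v v2 (SS _ _ vS).
have [|w' w'1 vw'] := H1 _ vw; first by rewrite chdB chdd subr0.
exists (w + w'); first by apply: sfD => //; exact: SS2.
by rewrite chdD opprD addrA.
Qed.

(** The same long exact sequence, read at S' / S, which sits between degree n - 1 of S2 / S' and
    degree n of S2 / S. *)
Lemma racyc_sub T (S S' S2 : subfun T) n :
  (forall c x, S c x -> S' c x) -> (forall c x, S' c x -> S2 c x) ->
  racyc S S2 n -> (if n is m.+1 then racyc S' S2 m else True) -> racyc S S' n.
Proof.
case: n => [|n] SS SS2 H1 H2 v v2 vS; first by apply: H1 => //; exact: SS2.
have [w w2 vw] := H1 v (SS2 _ _ v2) vS.
have dw : S' _ (chd w).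
  by rewrite -[chd w](subKr v); apply: sfB => //; exact: SS.
case: n H1 H2 v v2 vS w w2 vw dw => [|n] H1 H2 v v2 vS w w2 vw dw.
  by exists w => //; exact: H2.
have [w' w'2 ww'] := H2 w w2 dw.
by exists (w - chd w') => //; rewrite chdB chdd subr0.
Qed.

Lemma racyc_quot T V (S S' : subfun T) (P : forall c, T c -> V c) n :
  (forall c x y, S' c x -> S' c y -> P c (x - y) = P c x - P c y) ->
  (forall c d (f : chom c d) x, S' c x -> P d (ahom T f x) = ahom V f (P c x)) ->
  (forall c x, S c x -> S' c x) ->
  (forall c x, S' c x -> S c x <-> P c x = 0) ->
  (forall c y, exists2 x, S' c x & P c x = y) ->
  acyc V n -> racyc S S' n.
Proof.
move=> PB Pn SS Pk Ps; case: n => [|n] H v v' dv.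
  have E : chd (P _ v) = 0.
    by rewrite -(chd_nat PB Pn (n := 0)) //; apply/Pk => //; exact: SS.
  by apply/Pk => //; exact: (H _ I E).
have E : chd (P _ v) = 0.
  by rewrite -(chd_nat PB Pn (n := n.+1)) //; apply/Pk => //; exact: SS.
have [y _ yP] := H _ I E.
have [w w' wy] := Ps _ y; exists w => //.
have dw' : S' _ (chd w) by exact: chd_mem.
apply/Pk; first exact: sfB.
by rewrite PB // (chd_nat PB Pn) // wy.
Qed.

(** The differential out of degree n is an alternating sum of n + 2 maps that agree modulo [S]: they
    cancel for even n and leave a single one for odd n. *)
Lemma racyc_const_aux T (S S' : subfun T) n :
  (forall c d (f g : chom c d) x, S' c x -> S d (ahom T f x - ahom T g x)) ->
  forall (j : chom (CE n) (CE n.+1)) v, S' _ v ->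
  S _ (chd v - if odd n then ahom T j v else 0).
Proof.
elim: n T S S' => [|n IH] T S S' H j v v'; first by rewrite subr0; exact: H.
rewrite chdS.
have := IH (Sh T) (sSh S) (sSh S')
  (fun c d f g x => @H (cp c) (cp d) (cpf f) (cpf g) x) (cp1 X (CE n)) v v'.
rewrite [odd n.+1]/=; case: (odd n) => /= IHn.
  rewrite subr0 -[X in S _ X](subrKA (ahom T (cpf (cp1 X (CE n))) v)).
  by rewrite -[X in _ + X]opprB; apply: sfB; first exact: H.
rewrite addrAC; apply: sfB; first exact: H.
by rewrite subr0 in IHn.
Qed.

Lemma racyc_const T (S S' : subfun T) n :
  (forall c x, S c x -> S' c x) ->
  (forall c d (f g : chom c d) x, S' c x -> S d (ahom T f x - ahom T g x)) ->
  racyc S S' n.+1.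
Proof.
move=> SS H v v' dv.
case: (boolP (odd n)) => on.
  (* The incoming differential is a single coface map modulo [S], and any map back to degree n
     inverts it. *)
  exists (ahom T (cpt _ _) v); first exact: sf_map.
  have := racyc_const_aux H (cp1 X (CE n)) (v := ahom T (cpt _ _) v).
  rewrite on => /(_ (sf_map _ v')) Hv.
  rewrite -[X in S _ X](subrKA (ahom T (cp1 X (CE n)) (ahom T (cpt n.+1 _) v))).
  rewrite -[X in _ + X]opprB; apply: sfB; last exact: Hv.
  rewrite -ahom_comp -{1}[v](ahom_id (a := T)); exact: H.
(* Here the outgoing differential is injective modulo [S], so v itself lies in [S]. *)
exists 0; first exact: sf0.
rewrite chd0 subr0.
have := racyc_const_aux H (cp1 X (CE n.+1)) v'.
rewrite [odd _]/= on => Hv.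
have Sv : S _ (ahom T (cp1 X (CE n.+1)) v).
  by rewrite -[X in S _ X](subKr (chd v)); apply: sfB.
have := sf_map (s := S) (cpt n.+2 (CE n.+1)) Sv.
rewrite -ahom_comp => Sv2.
rewrite -[v](subrK (ahom T (ccomp (cp1 X (CE n.+1)) (cpt n.+2 (CE n.+1))) v)).
apply: sfD => //; rewrite -{1}[v](ahom_id (a := T)); exact: H.
Qed.

(** [r] is a contracting homotopy: for a cocycle v, the image of v under [cp1] equals the
    differential of v in [Sh T], and applying [r] gives v = chd (r v). *)
Lemma racyc_retr T (S : subfun T) (r : abnat (Sh T) T) n :
  (forall c x, r c (ahom T (cp1 X c) x) = x) ->
  (forall c x, S (cp c) x -> S c (r c x)) ->
  racyc (szero T) S n.+1.
Proof.
move=> r1 rS v Sv /= /eqP; rewrite subr_eq0 => /eqP dv.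
exists (r _ v); first exact: rS.
by rewrite -(chd_abnat r) -dv r1 subrr.
Qed.

Lemma racyc_retr0 T (S : subfun T) (r : abnat (Sh T) T) :
  (forall c x, r c (ahom T (cp1 X c) x) = x) ->
  (forall x, S e x -> r e (ahom T (cp2 X e) x) = 0) ->
  racyc (szero T) S 0.
Proof.
move=> r1 r2 v Sv /= /eqP; rewrite subr_eq0 => /eqP dv.
by rewrite -[v]r1 dv r2.
Qed.

(** The unit [J -> Sh J] is split pointwise, by [cpair (idc c) (cp_pt X c)], but this splitting is
    not natural; injectivity of [J] replaces it by a natural one. *)
Lemma injective_acyc J n : injective_abfunctor J -> acyc J n.+1.
Proof.
move=> Ji.
have Hi c : injective (sh_unit J c).
  move=> x y /= /(congr1 (ahom J (cpair (idc c) (cp_pt X c)))).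
  by rewrite -!ahom_comp cpair1 !ahom_id.
have idP c d (f : chom c d) (x : J c) :
  (idfun : {additive J d -> J d}) (ahom J f x) = ahom J f (idfun x) by [].
have [r rP] := Ji J (Sh J) (sh_unit J)
  (@AbNat _ J J (fun=> idfun) idP) Hi.
exact: (@racyc_retr _ (sall J) r n rP).
Qed.

Lemma lim_chd T (y : lim T) : @chd T 0 (y (CE 0)) = 0.
Proof. by rewrite /= !limP subrr. Qed.

Lemma lim_cech T (x : T (CE 0)) : chd x = 0 -> exists y : lim T, y (CE 0) = x.
Proof.
move=> /= /eqP; rewrite subr_eq0 => /eqP dx.
(* Both maps factor through the coproduct of two copies of e, where the two images of x agree. *)
have ind c (f g : chom e c) : ahom T f x = ahom T g x.
  by rewrite -[f](cpair1 f g) -{2}[g](cpair2 f g) !ahom_comp dx.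
unshelve eexists.
  exists (fun c => ahom T (cp_pt X c) x) => c d f.
  by rewrite -ahom_comp; exact: ind.
by rewrite /= (ind _ _ (idc e)) ahom_id.
Qed.

Lemma lim_ext T (y z : lim T) : y (CE 0) = z (CE 0) -> y = z.
Proof.
by move=> yz; apply: lim_eq => c; rewrite -(limP y (cp_pt X c))
  -(limP z (cp_pt X c)) yz.
Qed.
End Cech.

(** * Comparison with injective resolutions *)

Definition mkadd (U V : zmodType) (f : U -> V) (fB : zmod_morphism f) :
  {additive U -> V} := HB.pack f (GRing.isZmodMorphism.Build U V f fB).

Lemma ideal_quot_eq (V : zmodType) (S : zmodClosed V) (x y : V) :
  (\pi_{ideal_quot S} x = \pi_{ideal_quot S} y) <-> x - y \in S.
Proof.
by rewrite Quotient.idealrBE; split=> [->|/eqP].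
Qed.

Lemma subquot_eq (V : zmodType) (A B : zmodClosed V) (x y : subz A) :
  subquot_pi B x = subquot_pi B y <-> val x - val y \in B.
Proof. exact: (@ideal_quot_eq (subz A) (preimz val B) x y). Qed.

Lemma subquot_piB (V : zmodType) (A B : zmodClosed V) (x y : subz A) :
  subquot_pi B (x - y) = subquot_pi B x - subquot_pi B y.
Proof. by rewrite /subquot_pi raddfB. Qed.

(** Turns a relation made of successive choices into a homomorphism: an arbitrary value is picked
    for each class, and additivity together with the last hypothesis makes it independent of the
    choice. *)
Lemma subquot_rel_map (V W : zmodType) (A B : zmodClosed V)
    (Rel : V -> W -> Prop) :
  (forall x x' t t', Rel x t -> Rel x' t' -> Rel (x - x') (t - t')) ->
  (forall x, x \in A -> exists t, Rel x t) ->
  (forall x t, x \in B -> Rel x t -> t = 0) ->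
  exists phi : {additive subquot A B -> W},
    forall (x : subz A) t, Rel (val x) t -> phi (subquot_pi B x) = t.
Proof.
move=> RB Rtot Rf.
pose g (u : subquot A B) := projT1 (cid (Rtot _ (subz_valP (repr u)))).
have gP x t : Rel (val x) t -> g (subquot_pi B x) = t.
  move=> xt; rewrite /g; case: cid => t' /= xt'; apply/eqP.
  rewrite -subr_eq0; apply/eqP; apply: Rf (RB _ _ _ _ xt' xt).
  by apply/subquot_eq; exact: reprK.
have gB : zmod_morphism g.
  move=> u v; elim/subquot_ind: u => x; elim/subquot_ind: v => y.
  have [t xt] := Rtot _ (subz_valP x); have [t' yt] := Rtot _ (subz_valP y).
  rewrite -subquot_piB (gP _ _ xt) (gP _ _ yt).
  by apply: gP; exact: RB.
by exists (mkadd gB).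
Qed.

(* [Rel] induces an isomorphism from [ZA / BA] onto [ZB / BB]. *)
Record corr (A B : zmodType) (ZA BA : A -> Prop) (ZB BB : B -> Prop)
    (Rel : A -> B -> Prop) : Prop := Corr {
  corrB : forall a a' b b', Rel a b -> Rel a' b' -> Rel (a - a') (b - b');
  corr_tot : forall a, ZA a -> exists2 b, ZB b & Rel a b;
  corr_surj : forall b, ZB b -> exists2 a, ZA a & Rel a b;
  corr_bound : forall a b, Rel a b -> BA a <-> BB b }.

Lemma corr_comp (A B D : zmodType) (ZA BA : A -> Prop) (ZB BB : B -> Prop)
  (ZD BD : D -> Prop) R1 R2 : corr ZA BA ZB BB R1 -> corr ZB BB ZD BD R2 ->
  corr ZA BA ZD BD (fun a d => exists2 b, R1 a b & R2 b d).
Proof.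
move=> [B1 T1 S1 b1] [B2 T2 S2 b2]; split.
- move=> a a' d d' [b ab bd] [b' ab' bd'].
  by exists (b - b'); [exact: B1 | exact: B2].
- move=> a /T1[b /T2[d Zd bd] ab]; by exists d => //; exists b.
- move=> d /S2[b /S1[a Za ab] bd]; by exists a => //; exists b.
- by move=> a d [b ab bd]; exact: iff_trans (b1 _ _ ab) (b2 _ _ bd).
Qed.

Lemma corr_ext (A B : zmodType) (ZA BA : A -> Prop) (ZB BB BB' : B -> Prop) R1 :
  (forall b, BB b <-> BB' b) -> corr ZA BA ZB BB R1 -> corr ZA BA ZB BB' R1.
Proof.
move=> E [B1 T1 S1 b1]; split=> // a b ab.
exact: iff_trans (b1 _ _ ab) (E b).
Qed.

Section Staircase.
Variables (C : category) (X : copr C) (T : abfunctor C) (R : injres T).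
Local Notation CE := (CE X).

(** Bicocycles of the double complex [R k (CE m)]. Its two differentials commute and no sign is
    inserted in a staircase step; the convention is the same for every functor, so naturality is not
    affected. *)
Definition stZ k m (z : R k (CE m)) := res_d R k _ z = 0 /\ chd z = 0.
Definition stBR k m (z : R k.+1 (CE m)) :=
  exists2 w : R k (CE m), chd w = 0 & res_d R k _ w = z.
Definition stBC k m (z : R k (CE m.+1)) :=
  exists2 y : R k (CE m), res_d R k _ y = 0 & chd y = z.
Definition step_rel k m (z : R k.+1 (CE m)) (z' : R k (CE m.+1)) :=
  exists2 w : R k (CE m), res_d R k _ w = z & chd w = z'.

Lemma res_acyc k m (v : R k (CE m.+1)) : chd v = 0 -> exists w, chd w = v.
Proof.
move=> dv; have [w _ /eqP] := @injective_acyc _ X _ m (@res_inj _ _ R k) v I dv.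
by rewrite subr_eq0 => /eqP ->; exists w.
Qed.

Lemma res_dd k c (x : R k c) : res_d R k.+1 _ (res_d R k _ x) = 0.
Proof. by apply/res_exact; exists x. Qed.

Lemma step_corr k m :
  corr (@stZ k.+1 m) (@stBR k m) (@stZ k m.+1) (@stBC k m) (@step_rel k m).
Proof.
split.
- by move=> a a' b b' [w <- <-] [w' <- <-]; exists (w - w');
    rewrite ?raddfB ?chdB.
- move=> a [/res_exact[w wa] da]; exists (chd w); last by exists w.
  by split; [rewrite chd_abnat wa | rewrite chdd].
- move=> b [rb /res_acyc[w wb]]; exists (res_d R k _ w); last by exists w.
  by split; [rewrite res_dd | rewrite -chd_abnat wb].
- move=> a b [w wa wb]; split=> [[w' dw' w'a]|[y ry yb]].
    exists (w - w'); first by rewrite raddfB wa w'a subrr.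
    by rewrite chdB dw' subr0.
  exists (w - y); first by rewrite chdB wb yb subrr.
  by rewrite raddfB ry subr0.
Qed.

(** With both indices positive, either kind of boundary is the image of the composite of the two
    differentials. This makes consecutive steps composable. *)
Lemma stBR_BC k m (z : R k.+1 (CE m.+1)) : stBC z <-> stBR z.
Proof.
split=> [[y /res_exact[w wy] yz]|[w /res_acyc[y yw] wz]].
  by exists (chd w); rewrite ?chdd // chd_abnat wy.
by exists (res_d R k _ y); rewrite ?res_dd // -chd_abnat yw.
Qed.

Definition limZ k (x : lim_complex R k) := cd (lim_complex R) k x = 0.
Definition limB k (x : lim_complex R k.+1) :=
  exists y, cd (lim_complex R) k y = x.

Lemma start_corr k : corr (@limZ k.+1) (@limB k) (@stZ k.+1 0) (@stBR k 0)
  (fun x z => lim_val x (CE 0) = z).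
Proof.
split.
- by move=> a a' b b' <- <-.
- move=> x Zx; exists (lim_val x (CE 0)) => //; split; last exact: lim_chd.
  by rewrite -[LHS]/(lim_val (cd (lim_complex R) k.+1 x) (CE 0)) Zx.
- move=> b [rb /lim_cech[x xb]]; exists x => //.
  apply: (lim_ext (X := X)) => /=; rewrite xb; exact: rb.
- move=> x b xb; split=> [[y yx]|[w /lim_cech[y yw] wb]].
    exists (lim_val y (CE 0)); first exact: lim_chd.
    by rewrite -xb -yx.
  exists y; apply: (lim_ext (X := X)) => /=.
  by rewrite yw wb.
Qed.

Definition cechZ n (x : T (CE n)) := chd x = 0.
Definition cechB n (x : T (CE n.+1)) := exists y : T (CE n), chd y = x.

Lemma end_corr m : corr (@stZ 0 m.+1) (@stBC 0 m) (@cechZ m.+1) (@cechB m)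
  (fun z x => res_aug R _ x = z).
Proof.
split.
- by move=> a a' b b' <- <-; rewrite raddfB.
- move=> a [/res_exact0[x xa] da]; exists x => //.
  apply: (@res_aug_inj _ _ R); by rewrite chd_abnat xa da raddf0.
- move=> b db; exists (res_aug R _ b) => //; split.
    by apply/res_exact0; exists b.
  by rewrite -chd_abnat db raddf0.
- move=> a b ba; split=> [[y /res_exact0[x xy] ya]|[y yb]].
    exists x; apply: (@res_aug_inj _ _ R).
    by rewrite chd_abnat xy ya ba.
  exists (res_aug R _ y); first by apply/res_exact0; exists y.
  by rewrite -chd_abnat yb.
Qed.

Definition stair1 (x : lim_complex R 1) (xi : T (CE 1)) :=
  exists2 z1, lim_val x (CE 0) = z1 &
  exists2 z0, @step_rel 0 0 z1 z0 & res_aug R _ xi = z0.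
Definition stair2 (x : lim_complex R 2) (xi : T (CE 2)) :=
  exists2 z2, lim_val x (CE 0) = z2 & exists2 z1, @step_rel 1 0 z2 z1 &
  exists2 z0, @step_rel 0 1 z1 z0 & res_aug R _ xi = z0.
Definition stair3 (x : lim_complex R 3) (xi : T (CE 3)) :=
  exists2 z3, lim_val x (CE 0) = z3 & exists2 z2, @step_rel 2 0 z3 z2 &
  exists2 z1, @step_rel 1 1 z2 z1 & exists2 z0, @step_rel 0 2 z1 z0 &
  res_aug R _ xi = z0.

Lemma stair1_corr : corr (@limZ 1) (@limB 0) (@cechZ 1) (@cechB 0) stair1.
Proof.
exact: (corr_comp (start_corr 0) (corr_comp (step_corr 0 0) (end_corr 0))).
Qed.
Lemma stair2_corr : corr (@limZ 2) (@limB 1) (@cechZ 2) (@cechB 1) stair2.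
Proof.
apply: (corr_comp (start_corr 1) (corr_comp _
  (corr_comp (step_corr 0 1) (end_corr 1)))).
exact: (corr_ext (@stBR_BC 0 0) (step_corr 1 0)).
Qed.
Lemma stair3_corr : corr (@limZ 3) (@limB 2) (@cechZ 3) (@cechB 2) stair3.
Proof.
apply: (corr_comp (start_corr 2) (corr_comp _ (corr_comp _
  (corr_comp (step_corr 0 2) (end_corr 2))))).
  exact: (corr_ext (@stBR_BC 1 0) (step_corr 2 0)).
exact: (corr_ext (@stBR_BC 0 1) (step_corr 1 1)).
Qed.
End Staircase.

(** * Base change of Cech complexes *)

Section BaseChange.
Variables (C D : category) (X : copr C) (Y : copr D) (K : functor D C).
Variable h : chom (cpe X) (K (cpe Y)).

(** [K] is not assumed to preserve coproducts; these are the canonical comparison maps. *)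
Fixpoint hCE n : chom (CE X n) (K (CE Y n)) :=
  if n is m.+1 then
    cpair (ccomp (hCE m) (fhom K (cp1 Y (CE Y m))))
      (ccomp h (fhom K (cp2 Y (CE Y m))))
  else h.

Definition kcp d : chom (cp X (K d)) (K (cp Y d)) :=
  cpair (fhom K (cp1 Y d)) (ccomp h (fhom K (cp2 Y d))).

(** The form of the recursion that matches the shift [Sh]: it exhibits [psi] in degree n + 1 as
    [psi] in degree n for the shifted functors. *)
Lemma hCES n : hCE n.+1 = ccomp (cpf X (hCE n)) (kcp (CE Y n)).
Proof. by rewrite /kcp cpf_pair. Qed.

Lemma kcp_nat d d' (f : chom d d') :
  ccomp (cpf X (fhom K f)) (kcp d') = ccomp (kcp d) (fhom K (cpf Y f)).
Proof.
apply: cp_ext; rewrite !comp_assoc ?cpf1 ?cpf2 ?cpair1 ?cpair2.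
  by rewrite -comp_assoc cpair1 -!fhom_comp cpf1.
by rewrite -comp_assoc -fhom_comp cpf2.
Qed.

Variables (T : abfunctor C) (T' : abfunctor D).
Definition psi (t : abnat (abpull K T) T') n (x : T (CE X n)) : T' (CE Y n) :=
  t (CE Y n) (ahom T (hCE n) x).
End BaseChange.

Section BaseChangeCech.
Variables (C D : category) (X : copr C) (Y : copr D) (K : functor D C).
Variable h : chom (cpe X) (K (cpe Y)).

Definition sh_bc (T : abfunctor C) (T' : abfunctor D)
    (t : abnat (abpull K T) T') : abnat (abpull K (Sh X T)) (Sh Y T').
Proof.
pose g d : {additive Sh X T (K d) -> Sh Y T' d} :=
  (t (cp Y d) \o ahom T (kcp h d))%FUN.
apply: (@AbNat _ (abpull K (Sh X T)) (Sh Y T') g) => d d' f x.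
have /= E := abcompP t (cpf Y f) (ahom T (kcp h d) x).
rewrite /= -E -!ahom_comp.
by congr (t _ (ahom T _ x)); exact: kcp_nat.
Defined.

Lemma psi_chd (T : abfunctor C) (T' : abfunctor D)
    (t : abnat (abpull K T) T') n (x : T (CE X n)) :
  psi h t (chd x) = chd (psi h t x).
Proof.
elim: n T T' t x => [|n IH] T T' t x.
  have /= E1 := abcompP t (cp1 Y (cpe Y)) (ahom T h x).
  have /= E2 := abcompP t (cp2 Y (cpe Y)) (ahom T h x).
  rewrite /psi /= -E1 -E2 -!ahom_comp raddfB (raddfB (t _)) -!ahom_comp.
  by rewrite cpair1 cpair2.
have E m (y : T (CE X m.+1)) : psi h t y = psi h (sh_bc t) (n := m) y.
  rewrite /psi /= -ahom_comp; congr (t _ (ahom T _ y)).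
  exact: (hCES h m).
have E1 := abcompP t (cp1 Y (CE Y n.+1)) (ahom T (hCE h n.+1) x).
have E2 : @chd _ Y (Sh Y T') n (psi h t x) =
    psi h t (n := n.+2) (@chd _ X (Sh X T) n x).
  by rewrite (E n x) (E n.+1 _) (IH _ _ (sh_bc t)).
rewrite (chdS (psi h t x)) (chdS x) E2 /psi raddfB (raddfB (t _)).
congr (_ - _); rewrite -E1 [in RHS]/= -!ahom_comp.
by congr (t _ (ahom T _ x)); rewrite cpair1.
Qed.

Lemma psi_nat (T U : abfunctor C) (T' U' : abfunctor D)
    (t : abnat (abpull K T) T') (u : abnat (abpull K U) U')
    (P : forall c, T c -> U c) (P' : forall d, T' d -> U' d)
    (S : subfun T) n x :
  (forall c d (f : chom c d) x, S c x -> P d (ahom T f x) = ahom U f (P c x)) ->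
  (forall d x, S (K d) x -> P' d (t d x) = u d (P (K d) x)) ->
  S (CE X n) x -> P' (CE Y n) (psi h t x) = psi h u (P (CE X n) x).
Proof.
by move=> Pn Pt Sx; rewrite /psi Pt ?Pn //; exact: sf_map.
Qed.
End BaseChangeCech.

Section StairNat.
Variables (C D : category) (X : copr C) (Y : copr D) (K : functor D C).
Variable h : chom (cpe X) (K (cpe Y)).
Variables (T : abfunctor C) (T' : abfunctor D) (t : abnat (abpull K T) T').
Variables (R : injres T) (R' : injres T') (l : res_lift t R R').

Lemma psi_res k n (x : R k (CE X n)) :
  psi h (l k.+1) (res_d R k _ x) = res_d R' k _ (psi h (l k) x).
Proof. by rewrite /psi -abcompP lift_d. Qed.

Lemma step_push k m z z' : @step_rel _ X _ R k m z z' ->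
  @step_rel _ Y _ R' k m (psi h (l k.+1) z) (psi h (l k) z').
Proof.
by move=> [w <- <-]; exists (psi h (l k) w); rewrite ?psi_chd ?psi_res.
Qed.

Lemma stair2_push x xi : stair2 (X := X) (R := R) x xi ->
  stair2 (X := Y) (R := R') (rlim_cmap l 2 x) (psi h t xi).
Proof.
move=> [z2 xz2 [z1 /step_push z21 [z0 /step_push z10 xiz0]]].
eexists; first reflexivity.
exists (psi h (l 1) z1).
  (* The value of a compatible family at [K (cpe Y)] is the image under [h] of its value at
     [cpe X]. *)
  suff -> : lim_val (rlim_cmap l 2 x) (CE Y 0) = psi h (l 2) (lim_val x (CE X 0)).
    by rewrite xz2.
  by rewrite /psi limP.
exists (psi h (l 0) z0) => //.
by rewrite -xiz0 /psi -abcompP lift_aug.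
Qed.
End StairNat.

(** * Free groups and coproducts of presentations *)

Section FreeGroup.
Variable X : Type.
Implicit Type H : groupType.

Definition evalw H (h : X -> H) (w : seq (X * bool)) : H :=
  foldr (fun p acc => ((if p.2 then h p.1 else (h p.1)^-1) * acc)%g) 1%g w.

Lemma evalw_cat H (h : X -> H) v w :
  evalw h (v ++ w) = (evalw h v * evalw h w)%g.
Proof. by elim: v => [|p v IH] /=; rewrite ?mul1g // IH mulgA. Qed.

Definition invw (w : seq (X * bool)) := rev [seq (p.1, ~~ p.2) | p <- w].

Lemma evalw_inv H (h : X -> H) w : evalw h (invw w) = (evalw h w)^-1%g.
Proof.
elim: w => [|p w IH]; first by rewrite /= invg1.
rewrite /invw /= rev_cons -cats1 evalw_cat IH /= mulg1 invgM.
by case: p.2 => //=; rewrite invgK.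
Qed.

(* Two words are identified when no map to any group separates them: the
   relations of the free group are those that hold in every group. *)
Definition eqw (v w : seq (X * bool)) : Prop :=
  forall H (h : X -> H), evalw h v = evalw h w.

Lemma eqw_ex w : exists v, eqw w v. Proof. by exists w. Qed.
Definition canonw w := sval (cid (eqw_ex w)).

Lemma canonwP w : eqw w (canonw w).
Proof. by rewrite /canonw; case: cid. Qed.

Lemma canonw_eq v w : eqw v w -> canonw v = canonw w.
Proof.
move=> vw; rewrite /canonw; have E : eqw v = eqw w.
  apply/funext => u; apply/propext.
  by split=> uP H h; rewrite -uP vw.
move: (eqw_ex v) (eqw_ex w); rewrite E => p q.
by rewrite (Prop_irrelevance p q).
Qed.

(** The carrier consists of chosen words, hence stays in the universe of [X] as [fg_grp] requires,
    although [eqw] ranges over all groups. *)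
Record fgrp := MkFgrp { fgw : seq (X * bool); fgwP : canonw fgw = fgw }.

Lemma fgrp_ext (x y : fgrp) : eqw (fgw x) (fgw y) -> x = y.
Proof.
case: x y => [x xP] [y yP] /= /canonw_eq; rewrite xP yP => E.
by case: _ / E in yP *; rewrite (Prop_irrelevance xP yP).
Qed.

Lemma mkfg_subproof w : canonw (canonw w) = canonw w.
Proof. by apply: canonw_eq => H h; rewrite -canonwP. Qed.
Definition mkfg w := MkFgrp (mkfg_subproof w).

Lemma evalw_mkfg H (h : X -> H) w : evalw h (fgw (mkfg w)) = evalw h w.
Proof. by rewrite -canonwP. Qed.

Definition fg_mul x y := mkfg (fgw x ++ fgw y).
Definition fg_inv x := mkfg (invw (fgw x)).
Definition fg_one := mkfg [::].

Lemma fg_mulA : associative fg_mul.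
Proof.
move=> x y z; apply: fgrp_ext => H h.
by rewrite !(evalw_mkfg, evalw_cat) mulgA.
Qed.
Lemma fg_mul1 : left_id fg_one fg_mul.
Proof.
by move=> x; apply: fgrp_ext => H h; rewrite !(evalw_mkfg, evalw_cat) mul1g.
Qed.
Lemma fg_mulr1 : right_id fg_one fg_mul.
Proof.
by move=> x; apply: fgrp_ext => H h; rewrite !(evalw_mkfg, evalw_cat) mulg1.
Qed.
Lemma fg_mulV : left_inverse fg_one fg_inv fg_mul.
Proof.
move=> x; apply: fgrp_ext => H h.
by rewrite !(evalw_mkfg, evalw_cat, evalw_inv) mulVg.
Qed.
Lemma fg_mulrV : right_inverse fg_one fg_inv fg_mul.
Proof.
move=> x; apply: fgrp_ext => H h.
by rewrite !(evalw_mkfg, evalw_cat, evalw_inv) mulgV.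
Qed.

HB.instance Definition _ := gen_eqMixin fgrp.
HB.instance Definition _ := gen_choiceMixin fgrp.
HB.instance Definition _ :=
  isGroup.Build fgrp fg_mulA fg_mul1 fg_mulr1 fg_mulV fg_mulrV.

Definition fgi (x : X) : fgrp := mkfg [:: (x, true)].
End FreeGroup.

Definition mkghom (G H : groupType) (f : G -> H)
  (f1 : f 1%g = 1%g) (fM : {morph f : x y / (x * y)%g}) : {ghom G -> H} :=
  HB.pack f (isUMagmaMorphism.Build G H f (f1, fM)).

Definition gcomp (G H K : groupType) (u : {ghom G -> H}) (v : {ghom H -> K}) :
  {ghom G -> K}.
Proof.
apply: (@mkghom G K (v \o u)); first by rewrite /= !gmulf1.
by move=> x y; rewrite /= !gmulfM.
Defined.

Lemma gcompE (G H K : groupType) (u : {ghom G -> H}) (v : {ghom H -> K}) x :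
  gcomp u v x = v (u x).
Proof. by []. Qed.

Section FreeGroupLift.
Variables (X : Type) (H : groupType).

Lemma fglift_1 (h : X -> H) : evalw h (fgw (1%g : fgrp X)) = 1%g.
Proof. exact: evalw_mkfg. Qed.
Lemma fglift_M (h : X -> H) :
  {morph (fun x : fgrp X => evalw h (fgw x)) : x y / (x * y)%g}.
Proof. by move=> x y; rewrite /= [LHS]evalw_mkfg evalw_cat. Qed.
Definition fglift (h : X -> H) : {ghom fgrp X -> H} :=
  mkghom (fglift_1 h) (@fglift_M h).

Lemma fgliftE (h : X -> H) x : fglift h (fgi x) = h x.
Proof. by rewrite [LHS]evalw_mkfg /= mulg1. Qed.

Lemma fg_ext (u v : {ghom fgrp X -> H}) :
  (forall x, u (fgi x) = v (fgi x)) -> u =1 v.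
Proof.
move=> uv x; have xE : x = mkfg (fgw x).
  by apply: fgrp_ext => K k; rewrite evalw_mkfg.
rewrite {}xE; elim: (fgw x) => [|[y b] w IH].
  by rewrite -[mkfg [::]]/(1%g : fgrp X) !gmulf1.
have -> : mkfg ((y, b) :: w) = ((if b then fgi y else (fgi y)^-1) * mkfg w)%g.
  apply: fgrp_ext => K k; rewrite !(evalw_mkfg, evalw_cat) /=.
  case: b; rewrite !evalw_mkfg /= ?mulg1 //.
  by rewrite evalw_inv evalw_mkfg /= mulg1.
by rewrite !gmulfM IH; case: b; rewrite ?gmulfV uv.
Qed.
End FreeGroupLift.


Lemma fg_is_free (X : Type) : is_free (fgrp X).
Proof.
exists (range (@fgi X)) => H h; exists (fglift (h \o @fgi X)).
  by move=> _ [x _ <-]; rewrite fgliftE.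
by move=> v vP; apply: fg_ext => x; rewrite fgliftE vP //; exists x.
Qed.

Definition fg_grp (X : Type) : grp := @Grp (fgrp X) (Group.class (fgrp X)).

Section Cop.
Variable G : grp.

Definition basis (c : pres G) : set c := projT1 (cid (pgrp_free c)).

Lemma basisP (c : pres G) (H : groupType) (h : c -> H) :
  exists2 u : {ghom c -> H}, (forall b, basis b -> u b = h b) &
    forall v : {ghom c -> H}, (forall b, basis b -> v b = h b) -> v =1 u.
Proof. by rewrite /basis; case: cid => B /= BP; exact: BP. Qed.

Lemma basis_ext (c : pres G) (H : groupType) (u v : {ghom c -> H}) :
  (forall b, basis b -> u b = v b) -> u =1 v.
Proof.
by move=> uv x; have [w _ wP] := basisP u; rewrite (wP v) ?(wP u) // => b /uv.
Qed.

(** Being free on the underlying set of G, it maps to any presentation by choosing a preimage of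
    each group element; see [base_lift]. *)
Definition base_pres : pres G.
Proof.
refine (@Pres G (fg_grp (grp_sort G))
  (fglift (fun g : grp_sort G => (g : G))) _ (fg_is_free _)).
by move=> g; exists (fgi (g : grp_sort G)); rewrite fgliftE.
Defined.

Definition bset (c : pres G) : Type :=
  @sig (grp_sort c) (fun x : grp_sort c => basis x).
Definition bval (c : pres G) (b : bset c) : c := projT1 b.
Definition bmk (c : pres G) (x : c) (bx : basis x) : bset c :=
  @exist (grp_sort c) (fun x : grp_sort c => basis x) x bx.
Definition cop_gens (c : pres G) : Type := (bset c + grp_sort G)%type.
Definition genl (c : pres G) (b : bset c) : cop_gens c :=
  @inl (bset c) (grp_sort G) b.
Definition genr (c : pres G) (g : G) : cop_gens c :=
  @inr (bset c) (grp_sort G) g.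

Definition cop_proj (c : pres G) (s : cop_gens c) : G :=
  match s with inl b => pproj c (bval b) | inr g => g end.

Definition cop (c : pres G) : pres G.
Proof.
apply: (@Pres G (fg_grp (cop_gens c)) (fglift (@cop_proj c))).
  by move=> g; exists (fgi (genr c g)); rewrite fgliftE.
exact: fg_is_free.
Defined.


Lemma base_projE (g : grp_sort G) : pproj base_pres (fgi g) = g.
Proof. exact: (@fgliftE (grp_sort G) G). Qed.
Lemma cop_projE (c : pres G) (s : cop_gens c) : pproj (cop c) (fgi s) = cop_proj s.
Proof. exact: (fgliftE (@cop_proj c) s). Qed.

Definition cop1_fun (c : pres G) (x : c) : cop c :=
  if pselect (basis x) is left bx then fgi (genl (bmk bx)) else 1%g.

Definition cop1_hom (c : pres G) : {ghom c -> cop c} :=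
  projT1 (cid2 (basisP (@cop1_fun c))).

Lemma cop1_homE (c : pres G) (b : bset c) :
  cop1_hom c (bval b) = fgi (genl b).
Proof.
case: b => b Bb; rewrite /cop1_hom; case: cid2 => u /= /(_ _ Bb) -> _.
rewrite /cop1_fun; case: pselect => // Bb'.
by rewrite (Prop_irrelevance Bb' Bb).
Qed.

Definition cop2_hom (c : pres G) : {ghom base_pres -> cop c} :=
  @fglift (grp_sort G) (cop c) (fun g : grp_sort G => fgi (genr c g)).

Lemma cop2_homE (c : pres G) (g : grp_sort G) :
  cop2_hom c (fgi g) = fgi (genr c g).
Proof. exact: fgliftE. Qed.

Lemma cop_ext (c : pres G) (H : groupType) (u v : {ghom cop c -> H}) :
  (forall x, u (cop1_hom c x) = v (cop1_hom c x)) ->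
  (forall x, u (cop2_hom c x) = v (cop2_hom c x)) -> u =1 v.
Proof.
move=> uv1 uv2; apply: (fg_ext (u := u) (v := v)) => -[b|g].
  by rewrite -[inl b]/(genl b) -cop1_homE uv1.
by have := uv2 (fgi (g : grp_sort G)); rewrite (cop2_homE c g).
Qed.

Definition cop_lift (c : pres G) (H : groupType)
    (u : {ghom c -> H}) (v : {ghom base_pres -> H}) : {ghom cop c -> H} :=
  @fglift (cop_gens c) H (fun s => match s with
    | inl b => u (bval b) | inr g => v (fgi (g : grp_sort G)) end).


Lemma cop_lift1 (c : pres G) (H : groupType) (u : {ghom c -> H}) v x :
  cop_lift u v (cop1_hom c x) = u x.
Proof.
apply: (basis_ext (u := gcomp (cop1_hom c) (cop_lift u v))) => b Bb.
rewrite !gcompE.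
by rewrite (cop1_homE (bmk Bb)); exact: fgliftE.
Qed.
Lemma cop_lift2 (c : pres G) (H : groupType) (u : {ghom c -> H}) v x :
  cop_lift u v (cop2_hom c x) = v x.
Proof.
apply: (fg_ext (u := gcomp (cop2_hom c) (cop_lift u v))) => g; rewrite !gcompE.
by rewrite cop2_homE; exact: fgliftE.
Qed.

Lemma cop1_proj (c : pres G) x : pproj (cop c) (cop1_hom c x) = pproj c x.
Proof.
apply: (basis_ext (u := gcomp (cop1_hom c) (pproj (cop c)))) => b Bb.
rewrite !gcompE.
by rewrite (cop1_homE (bmk Bb)); exact: cop_projE.
Qed.
Lemma cop2_proj (c : pres G) x : pproj (cop c) (cop2_hom c x) = pproj base_pres x.
Proof.
apply: (fg_ext (u := gcomp (cop2_hom c) (pproj (cop c)))) => g; rewrite !gcompE.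
by rewrite cop2_homE cop_projE base_projE.
Qed.

Definition cop1 (c : pres G) : pmor idfun c (cop c) := PMor (@cop1_proj c).
Definition cop2 (c : pres G) : pmor idfun base_pres (cop c) :=
  PMor (@cop2_proj c).

Lemma cop_pair_proj (c d : pres G) (f : pmor idfun c d)
  (g : pmor idfun base_pres d) x :
  pproj d (cop_lift f g x) = idfun (pproj (cop c) x).
Proof.
apply: (cop_ext (u := gcomp (cop_lift f g) (pproj d))) => y; rewrite !gcompE.
  by rewrite cop_lift1 cop1_proj pmorP.
by rewrite cop_lift2 cop2_proj pmorP.
Qed.
Definition cop_pair (c d : pres G) (f : pmor idfun c d)
  (g : pmor idfun base_pres d) : pmor idfun (cop c) d :=
  PMor (cop_pair_proj f g).

Definition base_lift (H : grp) (phi : {ghom G -> H}) (d : pres H) :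
    {ghom base_pres -> d} :=
  @fglift (grp_sort G) d
    (fun g : grp_sort G => projT1 (cid (pproj_surj d (phi g)))).

Lemma base_lift_proj (H : grp) (phi : {ghom G -> H}) (d : pres H) x :
  pproj d (base_lift phi d x) = phi (pproj base_pres x).
Proof.
apply: (fg_ext (u := gcomp (base_lift phi d) (pproj d))
  (v := gcomp (pproj base_pres) phi)) => g; rewrite !gcompE base_projE.
have -> : base_lift phi d (fgi g) = projT1 (cid (pproj_surj d (phi g))).
  exact: fgliftE.
by case: cid.
Qed.
Definition base_mor (H : grp) (phi : {ghom G -> H}) (d : pres H) :
  pmor phi base_pres d := @PMor G H phi base_pres d _ (base_lift_proj phi d).

Definition idhom : {ghom G -> G} := mkghom (f := idfun) erefl (fun _ _ => erefl).

Definition pres_copr : copr (pres_cat G).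
Proof.
apply: (@Copr (pres_cat G) base_pres cop cop1 cop2 cop_pair).
- by move=> c d f g; apply: pmor_eq => x; exact: cop_lift1.
- by move=> c d f g; apply: pmor_eq => x; exact: cop_lift2.
- move=> c d f g E1 E2; apply: pmor_eq; apply: cop_ext => x.
    exact: (f_equal (fun k : pmor idfun c d => k x) E1).
  exact: (f_equal (fun k : pmor idfun base_pres d => k x) E2).
- by move=> c; exact: (base_mor idhom c).
Defined.

Definition cop_kill (c : pres G) : {ghom cop c -> c} :=
  cop_lift (mkghom (f := id) erefl (fun _ _ => erefl))
    (mkghom (f := fun=> 1%g) erefl (fun _ _ => esym (mulg1 _))).

Lemma cop_kill1 (c : pres G) x : cop_kill c (cop1_hom c x) = x.
Proof. by rewrite /cop_kill cop_lift1. Qed.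
Lemma cop_kill2 (c : pres G) x : cop_kill c (cop2_hom c x) = 1%g.
Proof. by rewrite /cop_kill cop_lift2. Qed.

Lemma cop_kill_nat (c d : pres_cat G) (f : chom c d) x :
  cop_kill d (cpf pres_copr f x) = f (cop_kill c x).
Proof.
pose cf : {ghom cop c -> cop d} := pmor_val (cpf pres_copr f).
pose f' : {ghom c -> d} := pmor_val f.
apply: (cop_ext (u := gcomp cf (cop_kill d)) (v := gcomp (cop_kill c) f')) => y.
  have E : cf (cop1_hom c y) = cop1_hom d (f' y) by exact: cop_lift1.
  by rewrite !gcompE E !cop_kill1.
have E : cf (cop2_hom c y) = cop2_hom d y by exact: cop_lift2.
by rewrite !gcompE E !cop_kill2 gmulf1.
Qed.
End Cop.

(** * Tensor products *)

Section PropClosed.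
Variables (V : zmodType) (P : V -> Prop).
Hypotheses (P0 : P 0) (PB : forall x y, P x -> P y -> P (x - y)).

Definition prop_pred : {pred V} := fun x => `[< P x >].
Fact prop_zmod_closed : zmod_closed prop_pred.
Proof.
by split=> [|x y /asboolP Px /asboolP Py]; apply/asboolP => //; apply: PB.
Qed.
HB.instance Definition _ := GRing.isZmodClosed.Build V prop_pred prop_zmod_closed.
Definition propz : zmodClosed V := prop_pred.
Lemma propzP x : x \in propz <-> P x.
Proof. by split=> [/asboolP|?] //; apply/asboolP. Qed.
End PropClosed.

Lemma propz_intro (V : zmodType) (S : set V) (P : V -> Prop) :
  P 0 -> (forall x y, P x -> P y -> P (x - y)) -> (forall x, S x -> P x) ->
  forall x, x \in spanz S -> P x.
Proof.
move=> P0 PB PS x xS; apply/(propzP P0 PB).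
by apply: (spanP (S := S)) xS => s /PS Ps; apply/propzP.
Qed.

Lemma quot_ind (V : zmodType) (S : zmodClosed V) (P : {ideal_quot S} -> Prop) :
  (forall x, P (\pi_{ideal_quot S} x)) -> forall u, P u.
Proof. by move=> Ppi u; rewrite -[u]reprK; exact: Ppi. Qed.

Lemma quot_lift (V W : zmodType) (S : zmodClosed V) (f : {additive V -> W}) :
  (forall x, x \in S -> f x = 0) ->
  exists g : {additive {ideal_quot S} -> W},
    forall x, g (\pi_{ideal_quot S} x) = f x.
Proof.
move=> fS; pose g (u : {ideal_quot S}) := f (repr u).
have gP x : g (\pi_{ideal_quot S} x) = f x.
  apply/eqP; rewrite -subr_eq0 /g -raddfB; apply/eqP; apply: fS.
  by apply/ideal_quot_eq; rewrite reprK.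
have gB : zmod_morphism g.
  move=> u v; elim/quot_ind: u => x; elim/quot_ind: v => y.
  by rewrite -raddfB !gP raddfB.
by exists (mkadd gB).
Qed.

Section TensorTheory.
Variables M N : zmodType.
Implicit Types (m : M) (n : N).

Lemma pureDl m m' n : pure (m + m') n = pure m n + pure m' n.
Proof.
apply/eqP; rewrite -subr_eq0 opprD addrA -!raddfB.
rewrite -(raddf0 (\pi_(tens M N))); apply/eqP/ideal_quot_eq; rewrite subr0.
by apply: mem_span; left; repeat eexists.
Qed.
Lemma pureDr m n n' : pure m (n + n') = pure m n + pure m n'.
Proof.
apply/eqP; rewrite -subr_eq0 opprD addrA -!raddfB.
rewrite -(raddf0 (\pi_(tens M N))); apply/eqP/ideal_quot_eq; rewrite subr0.
by apply: mem_span; right; repeat eexists.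
Qed.
Lemma pureBl m m' n : pure (m - m') n = pure m n - pure m' n.
Proof. by apply: (addIr (pure m' n)); rewrite -pureDl !subrK. Qed.
Lemma pureBr m n n' : pure m (n - n') = pure m n - pure m n'.
Proof. by apply: (addIr (pure m n')); rewrite -pureDr !subrK. Qed.
Lemma pure0l n : pure (0 : M) n = 0.
Proof. by rewrite -(subrr 0) pureBl subrr. Qed.
Lemma pure0r m : pure m (0 : N) = 0.
Proof. by rewrite -(subrr 0) pureBr subrr. Qed.
Definition purel n : {additive M -> tens M N} :=
  mkadd (f := fun m => pure m n) (fun m m' => pureBl m m' n).
Definition purer m : {additive N -> tens M N} :=
  mkadd (f := fun n => pure m n) (fun n n' => pureBr m n n').
Lemma pureMzl m n k : pure (m *~ k) n = pure m n *~ k.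
Proof. by rewrite -[LHS]/(purel n _) raddfMz. Qed.
Lemma pureMzr m n k : pure m (n *~ k) = pure m n *~ k.
Proof. by rewrite -[LHS]/(purer m _) raddfMz. Qed.

Lemma tens_ind (P : tens M N -> Prop) : P 0 ->
  (forall x y, P x -> P y -> P (x - y)) -> (forall m n, P (pure m n)) ->
  forall x, P x.
Proof.
move=> P0 PB Pp; elim/quot_ind => x.
have Q0 : P (\pi_(tens M N) (0 : {malg int[(M * N)%type]})) by rewrite raddf0.
have QB (y z : {malg int[(M * N)%type]}) : P (\pi_(tens M N) y) ->
    P (\pi_(tens M N) z) -> P (\pi_(tens M N) (y - z)).
  by move=> Py Pz; rewrite raddfB; exact: PB.
apply/(propzP (P := fun y => P (\pi_(tens M N) y)) Q0 QB).
by apply: malg_int_ind => -[m n]; apply/propzP; exact: Pp.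
Qed.

Lemma tens_lift (V : zmodType) (b : M -> N -> V) :
  (forall m m' n, b (m + m') n = b m n + b m' n) ->
  (forall m n n', b m (n + n') = b m n + b m n') ->
  exists g : {additive tens M N -> V}, forall m n, g (pure m n) = b m n.
Proof.
move=> bl br.
pose phi : {additive {malg int[(M * N)%type]} -> V} :=
  flift (fun p : (M * N)%type => b p.1 p.2).
have phiU m n : phi << (m, n) >> = b m n by exact: fliftU.
have [x xS|g gP] := @quot_lift _ _ (spanz (@tens_rel M N)) phi.
  move: x xS; apply: propz_intro => [|x y /= xP yP|].
  - by rewrite raddf0.
  - by rewrite (raddfB phi) /= xP yP subrr.
  move=> _ [[m [m' [n ->]]]|[m [n [n' ->]]]];
    by rewrite !(raddfB phi) !phiU ?bl ?br addrAC addrK subrr.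
by exists g => m n; rewrite gP phiU.
Qed.

Lemma tens_ext (V : zmodType) (g g' : {additive tens M N -> V}) :
  (forall m n, g (pure m n) = g' (pure m n)) -> g =1 g'.
Proof.
move=> gg'; apply: tens_ind => [|x y|//]; first by rewrite !raddf0.
by rewrite !raddfB => -> ->.
Qed.
End TensorTheory.

(** Source of the inverses of symbol maps: a product u w read modulo an ideal becomes a map out of
    [tens A B] once [A] and [B] are seen as quotients of subgroups of the ring. The kernel
    computations with tensor products below rest on it. *)
Lemma tens_descent (U W A B V : zmodType) (P : U -> Prop) (Q : W -> Prop)
    (al : U -> A) (be : W -> B) (m : U -> W -> V) :
  (forall u u', P u -> P u' -> P (u - u')) ->
  (forall w w', Q w -> Q w' -> Q (w - w')) ->
  (forall u u', P u -> P u' -> al (u - u') = al u - al u') ->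
  (forall w w', Q w -> Q w' -> be (w - w') = be w - be w') ->
  (forall a, exists2 u, P u & al u = a) ->
  (forall b, exists2 w, Q w & be w = b) ->
  (forall u u' w, P u -> P u' -> Q w -> m (u - u') w = m u w - m u' w) ->
  (forall u w w', P u -> Q w -> Q w' -> m u (w - w') = m u w - m u w') ->
  (forall u w, P u -> Q w -> al u = 0 -> m u w = 0) ->
  (forall u w, P u -> Q w -> be w = 0 -> m u w = 0) ->
  exists g : {additive tens A B -> V},
    forall u w, P u -> Q w -> g (pure (al u) (be w)) = m u w.
Proof.
move=> PB QB alB beB als bes mBl mBr m0l m0r.
pose s a := s2val (cid2 (als a)); pose t b := s2val (cid2 (bes b)).
have sP a : P (s a) by rewrite /s; case: cid2.
have sK a : al (s a) = a by rewrite /s; case: cid2.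
have tP b : Q (t b) by rewrite /t; case: cid2.
have tK b : be (t b) = b by rewrite /t; case: cid2.
have mE u u' w w' : P u -> P u' -> Q w -> Q w' -> al u = al u' ->
    be w = be w' -> m u w = m u' w'.
  move=> Pu Pu' Qw Qw' uu' ww'; transitivity (m u w').
    by apply/eqP; rewrite -subr_eq0 -mBr // m0r ?beB ?ww' ?subrr //; exact: QB.
  by apply/eqP; rewrite -subr_eq0 -mBl // m0l ?alB ?uu' ?subrr //; exact: PB.
have [|a b b'|g gP] := @tens_lift A B V (fun a b => m (s a) (t b)).
- move=> a a' b; apply: (addIr (- m (s a') (t b))).
  rewrite addrK -mBl //; apply: mE => //; first exact: PB.
  by rewrite alB // !sK addrK.
- apply: (addIr (- m (s a) (t b'))).
  rewrite addrK -mBr //; apply: mE => //; first exact: QB.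
  by rewrite beB // !tK addrK.
exists g => u w Pu Qw; rewrite gP; exact: mE.
Qed.

Section AbLift.
Variables (G : groupType) (V : zmodType) (h : G -> V).
Hypothesis hM : forall x y, h (x * y)%g = h x + h y.

Lemma ab_hom1 : h 1%g = 0.
Proof. by apply: (addIr (h 1%g)); rewrite -hM mulg1 add0r. Qed.
Lemma ab_homV x : h x^-1%g = - h x.
Proof. by apply: (addIr (h x)); rewrite -hM mulVg ab_hom1 addNr. Qed.

Definition hker_pred : {pred G} := fun x => h x == 0.
Fact hker1 : 1%g \in hker_pred.
Proof. by rewrite -topredE /= /hker_pred ab_hom1. Qed.
Fact hkerM : mulg_closed hker_pred.
Proof.
move=> x y; rewrite -!topredE /= /hker_pred hM => /eqP -> /eqP ->.
by rewrite addr0.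
Qed.
Fact hkerV : invg_closed hker_pred.
Proof.
by move=> x; rewrite -!topredE /= /hker_pred ab_homV => /eqP ->; rewrite oppr0.
Qed.
HB.instance Definition _ := isMulClosed.Build G hker_pred hkerM.
HB.instance Definition _ := isMul1Closed.Build G hker_pred hker1.
HB.instance Definition _ := isInvClosed.Build G hker_pred hkerV.

Lemma ab_hom_derived x : x \in @derived_pred G -> h x = 0.
Proof.
move=> /asboolP /(_ hker_pred) xD; apply/eqP; apply: xD => a b.
by rewrite -topredE /= /hker_pred /commg /conjg !hM !ab_homV addrCA addKr addNr.
Qed.

Lemma ab_lift : exists g : {additive ab G -> V}, forall x, g (ab_pi x) = h x.
Proof.
pose g (u : ab G) := h (repr u).
have gP x : g (ab_pi x) = h x.
  have := ab_hom_derived (repr_ab x); rewrite hM ab_homV => /eqP.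
  by rewrite addrC subr_eq0 => /eqP.
have gB : zmod_morphism g.
  move=> u v; elim/ab_ind: u => x; elim/ab_ind: v => y.
  have -> : ab_pi x - ab_pi y = ab_pi (x * y^-1)%g.
    by rewrite -[- _]/(ab_opp _) ab_piV -[_ + _]/(ab_add _ _) ab_piM.
  by rewrite !gP hM ab_homV.
by exists (mkadd gB).
Qed.
End AbLift.

Lemma ab_piD (G : groupType) (x y : G) : ab_pi (x * y)%g = ab_pi x + ab_pi y.
Proof. by rewrite -ab_piM. Qed.

(** * Group rings and Fox calculus *)

Definition gel (G : groupType) (x : G) : gring G := << x >>.

Lemma gelM (G : groupType) (x y : G) : gel (x * y)%g = gel x * gel y.
Proof. by rewrite -[RHS]/(gring_mul _ _) gring_mulUU. Qed.
Lemma gel1 (G : groupType) : gel 1%g = 1 :> gring G. Proof. by []. Qed.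

Lemma gring_indP (G : groupType) (P : gring G -> Prop) : P 0 ->
  (forall x y, P x -> P y -> P (x - y)) -> (forall g, P (gel g)) ->
  forall x, P x.
Proof.
move=> P0 PB Pg x; apply/(propzP P0 PB).
by apply: malg_int_ind => g; apply/propzP; exact: Pg.
Qed.

Lemma gring_mapU (G H : groupType) (u : {ghom G -> H}) x :
  gring_map u (gel x) = gel (u x).
Proof. by rewrite /gring_map fliftU. Qed.

Lemma augU (G : groupType) (x : G) : gring_aug (gel x) = 1.
Proof. by rewrite /gring_aug fliftU. Qed.

Lemma augM (G : groupType) (x y : gring G) :
  gring_aug (x * y) = gring_aug x * gring_aug y.
Proof. exact: gring_augM. Qed.

(** Restricted to the augmentation ideal f, this induces the isomorphism of f / ff with the
    abelianization. *)
Definition gab (G : groupType) : gring G -> ab G := flift (@ab_pi G).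
HB.instance Definition _ G :=
  GRing.Additive.copy (@gab G) (flift (@ab_pi G)).

Section Gab.
Variable G : groupType.
Implicit Types x y u v : gring G.

Lemma gabB x y : gab (x - y) = gab x - gab y.
Proof. exact: (raddfB (@gab G)). Qed.
Lemma gab0 : gab (0 : gring G) = 0. Proof. exact: (raddf0 (@gab G)). Qed.
Lemma augB x y : gring_aug (x - y) = gring_aug x - gring_aug y.
Proof. exact: (raddfB (@gring_aug G)). Qed.
Lemma aug0 : gring_aug (0 : gring G) = 0.
Proof. exact: (raddf0 (@gring_aug G)). Qed.

Lemma augMz x n : gring_aug (x *~ n) = gring_aug x *~ n.
Proof. exact: (raddfMz (@gring_aug G)). Qed.

Lemma gabU g : gab (gel g : gring G) = ab_pi g.
Proof. by rewrite /gab fliftU. Qed.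

Lemma gabM u v : gab (u * v) = gab u *~ gring_aug v + gab v *~ gring_aug u.
Proof.
elim/gring_indP: u => [|x y xP yP|g].
- by rewrite mul0r gab0 aug0 mul0rz addr0.
- by rewrite mulrBl !gabB augB xP yP mulrzBl mulrzBr opprD addrACA.
elim/gring_indP: v => [|x y xP yP|h].
- by rewrite mulr0 gab0 aug0 mul0rz addr0.
- rewrite (mulrBr (gel g)) (gabB (gel g * x)).
  rewrite [X in X - _ = _]xP [X in _ - X = _]yP.
  by rewrite gabB augB mulrzBl mulrzBr opprD addrACA.
by rewrite -gelM !gabU !augU !mulr1z ab_piD.
Qed.

Lemma mem_augI u : (u \in augI G) = (gring_aug u == 0). Proof. by []. Qed.
Lemma augI_E u : u \in augI G -> gring_aug u = 0.
Proof. by rewrite mem_augI => /eqP. Qed.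
Lemma gel_augI g : gel g - 1 \in augI G.
Proof. by rewrite mem_augI augB -gel1 !augU subrr. Qed.
Lemma gab_sub1 g : gab (gel g - 1 : gring G) = ab_pi g.
Proof.
by rewrite gabB -gel1 !gabU -[ab_pi 1%g]/(0 : ab G) subr0.
Qed.
Lemma augI_decomp u : u - 1 *~ gring_aug u \in augI G.
Proof. by rewrite mem_augI augB augMz -gel1 augU intz subrr. Qed.
End Gab.

Lemma gring_mapB (G H : groupType) (phi : {ghom G -> H}) x y :
  gring_map phi (x - y) = gring_map phi x - gring_map phi y.
Proof. exact: (raddfB (gring_map phi)). Qed.
Lemma gring_map0 (G H : groupType) (phi : {ghom G -> H}) : gring_map phi 0 = 0.
Proof. exact: (raddf0 (gring_map phi)). Qed.

Lemma gab_map (G H : groupType) (phi : {ghom G -> H}) x :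
  gab (gring_map phi x) = ab_map phi (gab x).
Proof.
elim/gring_indP: x => [|x y xP yP|g].
- by rewrite gring_map0 ?gab0 ?aug0 ?raddf0.
- by rewrite gring_mapB ?gabB ?augB xP yP ?raddfB.
by rewrite gring_mapU !gabU ab_map_pi.
Qed.

Lemma aug_map (G H : groupType) (phi : {ghom G -> H}) x :
  gring_aug (gring_map phi x) = gring_aug x.
Proof.
elim/gring_indP: x => [|x y xP yP|g].
- by rewrite gring_map0 ?gab0 ?aug0 ?raddf0.
- by rewrite gring_mapB ?gabB ?augB xP yP ?raddfB.
by rewrite gring_mapU !augU.
Qed.

Section Idmul.
Variable R : nzRingType.
Implicit Types I J : zmodClosed R.

Lemma mem_idmul I J x y : x \in I -> y \in J -> x * y \in (I * J)%I.
Proof. by move=> xI yJ; apply: mem_span; exists x, y. Qed.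

Lemma idmul_ind I J (P : R -> Prop) : P 0 ->
  (forall x y, x \in (I * J)%I -> y \in (I * J)%I -> P x -> P y -> P (x - y)) ->
  (forall x y, x \in I -> y \in J -> P (x * y)) ->
  forall z, z \in (I * J)%I -> P z.
Proof.
move=> P0 PB PM z zI; suff [] : z \in (I * J)%I /\ P z by [].
move: z zI; apply: propz_intro.
- by split=> //; exact: rpred0.
- by move=> x y [xI xP] [yI yP]; split; [exact: rpredB | exact: PB].
by move=> _ [x [y [xI yJ ->]]]; split; [exact: mem_idmul | exact: PM].
Qed.

Lemma mem_idaddl I J x : x \in I -> x \in (I + J)%I.
Proof. by move=> xI; apply: mem_span; left. Qed.
Lemma mem_idaddr I J x : x \in J -> x \in (I + J)%I.
Proof. by move=> xI; apply: mem_span; right. Qed.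

Lemma idadd_ind I J (P : R -> Prop) :
  (forall x y, P x -> P y -> P (x - y)) ->
  (forall x, x \in I -> P x) -> (forall x, x \in J -> P x) ->
  forall z, z \in (I + J)%I -> P z.
Proof.
move=> PB PI PJ; apply: propz_intro => //; first by apply: PI; exact: rpred0.
by move=> x [/PI|/PJ].
Qed.

Lemma idmulS I J I' J' : {subset I <= I'} -> {subset J <= J'} ->
  {subset (I * J)%I <= (I' * J')%I}.
Proof.
move=> II JJ; apply: idmul_ind; first exact: rpred0.
- by move=> x y _ _; exact: rpredB.
by move=> x y /II xI /JJ yJ; exact: mem_idmul.
Qed.

Lemma idmul_r I J : (forall x s, x \in J -> x * s \in J) ->
  forall x s, x \in (I * J)%I -> x * s \in (I * J)%I.
Proof.
move=> JR x s; move: x; apply: idmul_ind => [|x y _ _ xP yP|x y xI yJ].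
- by rewrite mul0r rpred0.
- by rewrite mulrBl rpredB.
by rewrite -mulrA mem_idmul ?JR.
Qed.
Lemma idmul_l I J : (forall x s, x \in I -> s * x \in I) ->
  forall x s, x \in (I * J)%I -> s * x \in (I * J)%I.
Proof.
move=> IR x s; move: x; apply: idmul_ind => [|x y _ _ xP yP|x y xI yJ].
- by rewrite mulr0 rpred0.
- by rewrite mulrBr rpredB.
by rewrite mulrA mem_idmul ?IR.
Qed.
Lemma idadd_r I J : (forall x s, x \in I -> x * s \in I) ->
  (forall x s, x \in J -> x * s \in J) ->
  forall x s, x \in (I + J)%I -> x * s \in (I + J)%I.
Proof.
move=> IR JR x s; move: x; apply: idadd_ind => [x y xP yP|x xI|x xJ].
- by rewrite mulrBl rpredB.
- by rewrite mem_idaddl ?IR.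
by rewrite mem_idaddr ?JR.
Qed.
Lemma idadd_l I J : (forall x s, x \in I -> s * x \in I) ->
  (forall x s, x \in J -> s * x \in J) ->
  forall x s, x \in (I + J)%I -> s * x \in (I + J)%I.
Proof.
move=> IR JR x s; move: x; apply: idadd_ind => [x y xP yP|x xI|x xJ].
- by rewrite mulrBr rpredB.
- by rewrite mem_idaddl ?IR.
by rewrite mem_idaddr ?JR.
Qed.
End Idmul.

(* Homomorphisms [G -> M ><| G] over [G] are the derivations of [G] in [M]; this
   turns the universal property of a free group into Fox calculus. *)
Record sdprod (G : groupType) (M : lmodType (gring G)) :=
  SdProd { sdm : M; sdg : G }.

Section SdGroup.
Variables (G : groupType) (M : lmodType (gring G)).
Notation sd := (sdprod M).
Definition sd_mul (p q : sd) : sd :=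
  SdProd (sdm p + gel (sdg p) *: sdm q) (sdg p * sdg q)%g.
Definition sd_one : sd := SdProd 0 1%g.
Definition sd_inv (p : sd) : sd :=
  SdProd (- (gel (sdg p)^-1%g *: sdm p)) (sdg p)^-1%g.
Lemma sd_mulA : associative sd_mul.
Proof.
move=> p q r; rewrite /sd_mul /= mulgA; congr SdProd.
by rewrite scalerDr scalerA gelM addrA.
Qed.
Lemma sd_mul1 : left_id sd_one sd_mul.
Proof.
by move=> [m g]; rewrite /sd_mul /= mul1g gel1 scale1r add0r.
Qed.
Lemma sd_mulr1 : right_id sd_one sd_mul.
Proof.
by move=> [m g]; rewrite /sd_mul /= mulg1 scaler0 addr0.
Qed.
Lemma sd_mulV : left_inverse sd_one sd_inv sd_mul.
Proof.
by move=> [m g]; rewrite /sd_mul /= mulVg addNr.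
Qed.
Lemma sd_mulrV : right_inverse sd_one sd_inv sd_mul.
Proof.
move=> [m g]; rewrite /sd_mul /= mulgV scalerN scalerA -gelM mulgV gel1.
by rewrite scale1r subrr.
Qed.
HB.instance Definition _ := gen_eqMixin sd.
HB.instance Definition _ := gen_choiceMixin sd.
HB.instance Definition _ :=
  isGroup.Build sd sd_mulA sd_mul1 sd_mulr1 sd_mulV sd_mulrV.
End SdGroup.

(** An additive group in multiplicative dress, so that the universal property of a free group
    applies to additive targets. *)
Record mulz (V : zmodType) := MulZ { mulz_val : V }.
Section MulzGroup.
Variable V : zmodType.
Definition mz_mul (p q : mulz V) := MulZ (mulz_val p + mulz_val q).
Lemma mz_mulA : associative mz_mul.
Proof. by move=> p q r; rewrite /mz_mul /= addrA. Qed.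
Lemma mz_mul1 : left_id (MulZ 0) mz_mul.
Proof. by move=> [p]; rewrite /mz_mul /= add0r. Qed.
Lemma mz_mulr1 : right_id (MulZ 0) mz_mul.
Proof. by move=> [p]; rewrite /mz_mul /= addr0. Qed.
Lemma mz_mulV : left_inverse (MulZ 0) (fun p => MulZ (- mulz_val p)) mz_mul.
Proof. by move=> [p]; rewrite /mz_mul /= addNr. Qed.
Lemma mz_mulrV : right_inverse (MulZ 0) (fun p => MulZ (- mulz_val p)) mz_mul.
Proof. by move=> [p]; rewrite /mz_mul /= subrr. Qed.
HB.instance Definition _ := gen_eqMixin (mulz V).
HB.instance Definition _ := gen_choiceMixin (mulz V).
HB.instance Definition _ :=
  isGroup.Build (mulz V) mz_mulA mz_mul1 mz_mulr1 mz_mulV mz_mulrV.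
End MulzGroup.

Lemma basis_add_ext (G : grp) (c : pres G) (V : zmodType) (h h' : c -> V) :
  (forall x y, h (x * y)%g = h x + h y) ->
  (forall x y, h' (x * y)%g = h' x + h' y) ->
  (forall b, basis b -> h b = h' b) -> h =1 h'.
Proof.
move=> hM h'M hh' x.
have mk (k : c -> V) : (forall x y, k (x * y)%g = k x + k y) ->
    exists u : {ghom c -> mulz V}, forall y, u y = MulZ (k y).
  move=> kM; have k1 : MulZ (k 1%g) = 1%g.
    by rewrite ab_hom1.
  have kM' : {morph (fun y => MulZ (k y)) : y z / (y * z)%g}.
    by move=> y z; rewrite kM.
  by exists (mkghom k1 kM').
have [u uE] := mk _ hM; have [u' u'E] := mk _ h'M.
have uu' b : basis b -> u b = u' b by move=> Bb; rewrite uE u'E hh'.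
by have := basis_ext uu' x; rewrite uE u'E => -[].
Qed.

Section Fox.
Variables (G : grp) (c : pres G).
Notation M := {malg (gring c)[c]}.

(** The basis element b is sent to (b, b) in the semidirect product; the second coordinate of the
    resulting homomorphism is the identity by uniqueness, so the first is a derivation. The free
    module is indexed by all of [c], which avoids a subtype for the basis. *)
Lemma fox_derivation : exists D : c -> M,
  (forall x y, D (x * y)%g = D x + gel x *: D y) /\
  (forall b, basis b -> D b = << b >>).
Proof.
have [u uB _] := basisP (fun b : c => SdProd (<< b >> : M) b).
have u2 x : sdg (u x) = x.
  have k1 : sdg (u 1%g) = 1%g by rewrite gmulf1.
  have kM : {morph (fun x => sdg (u x)) : x y / (x * y)%g}.
    by move=> y z; rewrite gmulfM.
  pose i1 : {ghom c -> c} := mkghom (f := id) erefl (fun _ _ => erefl).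
  apply: (basis_ext (u := mkghom k1 kM) (v := i1)) => b Bb.
  by rewrite -[LHS]/(sdg (u b)) uB.
exists (fun x => sdm (u x)); split=> [x y|b Bb]; last by rewrite uB.
by rewrite gmulfM /= u2.
Qed.

Definition msum (V : zmodType) (h : c -> gring c -> V) (m : M) : V :=
  \sum_(k <- msupp m) h k m@_k.

Lemma msumEw (V : zmodType) (h : c -> gring c -> V) (d : {fset c}) m :
  (forall k, h k 0 = 0) -> {subset msupp m <= d} ->
  msum h m = \sum_(k <- d) h k m@_k.
Proof.
move=> h0 /fsubsetP le.
rewrite [LHS](big_fset_incl _ le) => //= k _ /mcoeff_outdom ->.
by rewrite h0.
Qed.

Lemma msumB (V : zmodType) (h : c -> gring c -> V) (I : zmodClosed (gring c)) :
  (forall k x y, x \in I -> y \in I -> h k (x - y) = h k x - h k y) ->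
  forall m n, (forall k, m@_k \in I) -> (forall k, n@_k \in I) ->
  msum h (m - n) = msum h m - msum h n.
Proof.
move=> hB m n mI nI; pose d := (msupp m `|` msupp n)%fset.
have h0 k : h k 0 = 0.
  by have := hB k 0 0 (rpred0 _) (rpred0 _); rewrite !subrr.
rewrite !(@msumEw _ _ d) -?sumrB // => [|k kn|k km|]; first last.
- by apply/fsubsetP; exact: msuppB_le.
- by rewrite in_fsetU km.
- by rewrite in_fsetU kn orbT.
by apply: eq_bigr => k _; rewrite mcoeffB hB.
Qed.

Lemma msumU (V : zmodType) (h : c -> gring c -> V) k z :
  (forall k, h k 0 = 0) -> msum h << z *g k >> = h k z.
Proof.
move=> h0; rewrite (@msumEw _ _ [fset k]%fset) //; last first.
  by apply/fsubsetP; exact: msuppU_le.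
by rewrite big_seq_fset1 mcoeffUU.
Qed.

(** The whole group ring, as a right ideal to which [fox_tens] can be applied. *)
Definition trivz : zmodClosed (gring c) := kerz (\0 : {additive gring c -> int}).
Lemma in_trivz x : x \in trivz. Proof. by rewrite kerE. Qed.

(** The first clause is the product rule D (u w) = D u * aug w + u D w on elements w of augmentation
    0. The second is the fundamental formula, w = the sum of the D_b w * (b - 1), read modulo ff. *)
Lemma fox_calculus : exists D : {additive gring c -> M},
  (forall u w, w \in augI c -> D (u * w) = u *: D w) /\
  (forall w, w \in augI c ->
    gab w = msum (fun y z => ab_pi y *~ gring_aug z) (D w)).
Proof.
have [D0 [D0M D0B]] := fox_derivation.
pose D : {additive gring c -> M} := flift D0.
have DU x : D (gel x) = D0 x by exact: fliftU.
have DM u w : D (u * w) = D u *~ gring_aug w + u *: D w.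
  elim/gring_indP: u => [|x y xP yP|g].
  - by rewrite mul0r !(raddf0 D) mul0rz scale0r addr0.
  - rewrite mulrBl !(raddfB D) xP yP mulrzBl scalerBl.
    by rewrite opprD addrACA.
  elim/gring_indP: w => [|x y xP yP|h].
  - by rewrite mulr0 !(raddf0 D) aug0 scaler0 addr0.
  - rewrite (mulrBr (gel g)) (raddfB D (gel g * x)) [X in X - _ = _]xP.
    by rewrite [X in _ - X = _]yP (raddfB D) scalerBr augB mulrzBr opprD addrACA.
  by rewrite -gelM !DU D0M augU mulr1z.
exists D; split=> [u w /augI_E wI|w wI]; first by rewrite DM wI add0r.
pose h (y : c) (z : gring c) : ab c := ab_pi y *~ gring_aug z.
have hB k x y : x \in trivz -> y \in trivz -> h k (x - y) = h k x - h k y.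
  by move=> _ _; rewrite /h augB mulrzBr.
have h0 k : h k 0 = 0 by rewrite /h aug0.
have EB m n : msum h (m - n) = msum h m - msum h n.
  by apply: (msumB hB) => k; exact: in_trivz.
have EZ g m : msum h (gel g *: m) = msum h m.
  rewrite !(@msumEw _ _ (msupp m)) //; last first.
    by apply/fsubsetP; exact: msuppZ_le.
  by apply: eq_bigr => k _; rewrite mcoeffZ /h augM augU mul1r.
have E0 : msum h 0 = 0 by have := EB 0 0; rewrite !subrr.
have ED m n : msum h (m + n) = msum h m + msum h n.
  by have := EB (m + n) n; rewrite addrK => ->; rewrite subrK.
(* After augmentation a derivation becomes a homomorphism, so it suffices to compare on the
   basis. *)
have key x : ab_pi x = msum h (D0 x).
  apply: (basis_add_ext (h := @ab_pi c) (h' := fun x => msum h (D0 x)))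
    => [y z|y z|b Bb]; first exact: ab_piD.
    by rewrite D0M ED EZ.
  by rewrite D0B // msumU // /h -gel1 augU.
rewrite -/h {wI}; elim/gring_indP: w => [|x y xP yP|g].
- by rewrite gab0 (raddf0 D) E0.
- by rewrite gabB (raddfB D) EB xP yP.
by rewrite gabU DU.
Qed.

(* For a right ideal [I], the group [I * f] is the direct sum of the
   [I (b - 1)], [b] in the basis; hence [I * f = I (x)_F f] receives a map
   from any biadditive map that is balanced. *)
Lemma fox_tens (I : zmodClosed (gring c)) (A : zmodType) (th : gring c -> A) :
  (forall x s, x \in I -> x * s \in I) ->
  (forall x y, x \in I -> y \in I -> th (x - y) = th x - th y) ->
  exists Phi : gring c -> tens A (ab c),
    (forall x y, x \in (I * augI c)%I -> y \in (I * augI c)%I ->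
      Phi (x - y) = Phi x - Phi y) /\
    (forall u, u \in I -> (forall w, w \in augI c -> th (u * w) = 0) ->
      forall w, w \in augI c -> Phi (u * w) = pure (th u) (gab w)).
Proof.
move=> IR thB; have [D [DM DE]] := fox_calculus.
pose h (y : c) (z : gring c) := pure (th z) (ab_pi y).
have th0 : th 0 = 0.
  by have := thB 0 0 (rpred0 _) (rpred0 _); rewrite !subrr.
have h0 k : h k 0 = 0 by rewrite /h th0 pure0l.
have hB k x y : x \in I -> y \in I -> h k (x - y) = h k x - h k y.
  by move=> xI yI; rewrite /h thB // pureBl.
have DI x : x \in (I * augI c)%I -> forall k, (D x)@_k \in I.
  move: x; apply: idmul_ind => [k|x y _ _ xP yP k|x y xI yf k].
  - by rewrite (raddf0 D) mcoeff0 rpred0.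
  - by rewrite (raddfB D) mcoeffB rpredB.
  by rewrite DM // mcoeffZ IR.
exists (fun x => msum h (D x)); split=> [x y xI yI|u uI ut w wf].
  by rewrite (raddfB D); apply: (msumB hB) => k; exact: DI.
(* z differs from its augmentation by an element of f, and [th] kills u f. As [th] is additive on
   [I] only, integer multiples are handled by an induction for each sign. *)
have thE z : th (u * z) = th u *~ gring_aug z.
  have uz : u * z = u * (z - 1 *~ gring_aug z) - (- (u *~ gring_aug z)).
    by rewrite mulrBr mulrzAr mulr1 opprK subrK.
  rewrite {}uz thB ?ut ?augI_decomp ?IR ?rpredN ?rpredMz // sub0r.
  have thN z' : z' \in I -> th (- z') = - th z'.
    by move=> z'I; rewrite -sub0r thB ?rpred0 // th0 sub0r.
  rewrite thN ?rpredMz // opprK; case: (gring_aug z) => n.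
    elim: n => [|n IH]; first by rewrite !mulr0z.
    rewrite -!pmulrn !mulrSr !pmulrn -[u in _ + u]opprK thB ?rpredN ?rpredMz //.
    by rewrite IH thN ?opprK.
  rewrite !NegzE !mulrNz thN ?rpredMz //; congr (- _).
  elim: n.+1 => [|k IH]; first by rewrite !mulr0z.
  rewrite -!pmulrn !mulrSr !pmulrn -[u in _ + u]opprK thB ?rpredN ?rpredMz //.
  by rewrite IH thN ?opprK.
rewrite DM // DE // (@msumEw _ _ (msupp (D w))) //; last first.
  by apply/fsubsetP; exact: msuppZ_le.
rewrite -[pure (th u) _]/(purer (ab c) (th u) _) raddf_sum /=.
apply: eq_bigr => k _; rewrite mcoeffZ /h thE.
by rewrite pureMzl pureMzr.
Qed.
End Fox.

(** * Products of the ideals f and r *)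

Section PresIdeals.
Variables (G : grp) (c : pres G).
Notation f := (augI c).
Notation r := (relI c).
Notation ff := (f * f)%I.
Notation a := (relI c + augI c * augI c)%I.
Implicit Types u v w x y : gring c.

Definition gabG u : ab G := gab (gring_map (pproj c) u).

Lemma gabGB x y : gabG (x - y) = gabG x - gabG y.
Proof. by rewrite /gabG gring_mapB gabB. Qed.
Lemma gabG0 : gabG 0 = 0. Proof. by rewrite /gabG gring_map0 gab0. Qed.
Lemma gabGE u : gabG u = ab_map (pproj c) (gab u).
Proof. by rewrite /gabG gab_map. Qed.
Lemma gabGU (x : c) : gabG (gel x) = ab_pi (pproj c x).
Proof. by rewrite /gabG gring_mapU gabU. Qed.

Lemma mem_relI u : (u \in r) = (gring_map (pproj c) u == 0). Proof. by []. Qed.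

Lemma augIM_l u w : w \in f -> u * w \in f. Proof. exact: augI_mull. Qed.
Lemma augIM_r u w : u \in f -> u * w \in f. Proof. exact: augI_mulr. Qed.
Lemma relIM_l u w : w \in r -> u * w \in r.
Proof. by rewrite !mem_relI gring_mapM => /eqP ->; rewrite mulr0. Qed.
Lemma relIM_r u w : u \in r -> u * w \in r.
Proof. by rewrite !mem_relI gring_mapM => /eqP ->; rewrite mul0r. Qed.

Lemma relI_augI : {subset r <= f}.
Proof. by move=> u; rewrite mem_relI mem_augI -(aug_map (pproj c)) => /eqP ->;
  rewrite aug0. Qed.
Lemma ff_f : {subset ff <= f}.
Proof.
apply: idmul_ind; [exact: rpred0 | by move=> x y _ _; exact: rpredB |].
by move=> x y _; exact: augIM_l.
Qed.
Lemma a_f : {subset a <= f}.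
Proof. by apply: idadd_ind; [exact: rpredB | exact: relI_augI | exact: ff_f]. Qed.
Lemma ff_a : {subset ff <= a}. Proof. by move=> x; exact: mem_idaddr. Qed.
Lemma r_a : {subset r <= a}. Proof. by move=> x; exact: mem_idaddl. Qed.
Lemma aM_l u w : w \in a -> u * w \in a.
Proof.
apply: idadd_l => x s; first exact: relIM_l.
by apply: idmul_l => y z; exact: augIM_l.
Qed.
Lemma aM_r u w : u \in a -> u * w \in a.
Proof.
apply: idadd_r => x s; first exact: relIM_r.
by apply: idmul_r => y z; exact: augIM_r.
Qed.

Lemma gabG_ff u : u \in ff -> gabG u = 0.
Proof.
move: u; apply: idmul_ind; first exact: gabG0.
  by move=> x y _ _ xP yP; rewrite gabGB xP yP subrr.
move=> x y xf yf; rewrite gabGE gabM (augI_E xf) (augI_E yf) !mulr0z addr0.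
exact: raddf0.
Qed.
Lemma gab_ff u : u \in ff -> gab u = 0.
Proof.
move: u; apply: idmul_ind; first exact: gab0.
  by move=> x y _ _ xP yP; rewrite gabB xP yP subrr.
by move=> x y xf yf; rewrite gabM (augI_E xf) (augI_E yf) !mulr0z addr0.
Qed.
Lemma gabG_a u : u \in a -> gabG u = 0.
Proof.
move: u; apply: idadd_ind; last exact: gabG_ff.
  by move=> x y xP yP; rewrite gabGB xP yP subrr.
by move=> x; rewrite mem_relI /gabG => /eqP ->; exact: gab0.
Qed.

Lemma gelM_sub1 (x y : c) :
  gel (x * y)%g - 1 =
  (gel x - 1) + (gel y - 1) + (gel x - 1) * (gel y - 1) :> gring c.
Proof.
rewrite gelM mulrBl mulrBr mulr1 mul1r.
by rewrite [RHS]addrACA subrr addr0 [RHS]addrC subrKA.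
Qed.

(** The inverse F_ab -> f / ff sends x to x - 1, and is a homomorphism by [gelM_sub1]. *)
Lemma gab_eq0 u : u \in f -> gab u = 0 -> u \in ff.
Proof.
move=> uf gu; pose h (x : c) := \pi_{ideal_quot ff} (gel x - 1).
have [x y|g gP] := @ab_lift c _ h.
  rewrite /h gelM_sub1 -raddfD; apply/ideal_quot_eq.
  by rewrite addrAC subrr add0r; apply: mem_idmul; exact: gel_augI.
suff E v : g (gab v) = \pi_{ideal_quot ff} (v - 1 *~ gring_aug v).
  have := E u; rewrite gu raddf0 (augI_E uf) mulr0z subr0.
  rewrite -(raddf0 \pi_{ideal_quot ff}) => /esym/ideal_quot_eq.
  by rewrite subr0.
elim/gring_indP: v => [|x y xP yP|x].
- by rewrite gab0 aug0 mulr0z subr0 !raddf0.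
- by rewrite gabB raddfB xP yP augB mulrzBr -raddfB subrACA.
by rewrite gabU gP augU.
Qed.

(** The inverse G_ab -> f / a sends g to s g - 1 for a lift s g of g; another lift changes this by
    an element of r. *)
Lemma gabG_eq0 u : u \in f -> gabG u = 0 -> u \in a.
Proof.
move=> uf gu.
pose s (g : G) : c := projT1 (cid (pproj_surj c g)).
have sK g : pproj c (s g) = g by rewrite /s; case: cid.
pose h (g : G) := \pi_{ideal_quot a} (gel (s g) - 1).
have hE (x : c) : h (pproj c x) = \pi_{ideal_quot a} (gel x - 1).
  apply/ideal_quot_eq; rewrite subrACA subrr subr0; apply: r_a.
  by rewrite mem_relI gring_mapB !gring_mapU sK subrr.
have [x y|g gP] := @ab_lift G _ h.
  rewrite -[x]sK -[y]sK -gmulfM !hE gelM_sub1 -raddfD; apply/ideal_quot_eq.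
  by rewrite addrAC subrr add0r; apply/ff_a/mem_idmul; exact: gel_augI.
suff E v : g (gabG v) = \pi_{ideal_quot a} (v - 1 *~ gring_aug v).
  have := E u; rewrite gu raddf0 (augI_E uf) mulr0z subr0.
  rewrite -(raddf0 \pi_{ideal_quot a}) => /esym/ideal_quot_eq.
  by rewrite subr0.
elim/gring_indP: v => [|x y xP yP|x].
- by rewrite gabG0 aug0 mulr0z subr0 !raddf0.
- by rewrite gabGB raddfB xP yP augB mulrzBr -raddfB subrACA.
by rewrite gabGU gP hE augU.
Qed.

Lemma gab_surj (s : ab c) : exists2 u, u \in f & gab u = s.
Proof.
elim/ab_ind: s => x; exists (gel x - 1); first exact: gel_augI.
exact: gab_sub1.
Qed.
Lemma gabG_surj (s : ab G) : exists2 u, u \in f & gabG u = s.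
Proof.
elim/ab_ind: s => g; have [x <-] := pproj_surj c g.
exists (gel x - 1); first exact: gel_augI.
by rewrite gabGE gab_sub1 ab_map_pi.
Qed.

Lemma fox_f : {subset f <= (trivz c * f)%I}.
Proof. by move=> w wf; rewrite -[w]mul1r mem_idmul ?in_trivz. Qed.

Lemma symGF_ex : exists Phi : gring c -> tens (ab G) (ab c),
  (forall x y, x \in f -> y \in f -> Phi (x - y) = Phi x - Phi y) /\
  (forall u w, u \in f -> w \in f -> Phi (u * w) = pure (gabG u) (gab w)).
Proof.
have [||Phi [PB PE]] := @fox_tens G c (trivz c) _ gabG.
- by move=> x s _; exact: in_trivz.
- by move=> x y _ _; exact: gabGB.
exists Phi; split=> [x y /fox_f xf /fox_f yf|u w uf wf]; first exact: PB.
apply: PE; rewrite ?in_trivz // => w' w'f.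
by apply/gabG_ff/mem_idmul.
Qed.

(* The maps [symXY] send [u * w] to [u] (x) [w], the letters telling in which of
   [ab G], [ab c] (F) or ker (tor_P0 -> ab G) (K) the factors are read. They are
   additive on suitable ideals only; elsewhere their values are junk. *)
Definition symGF := projT1 (cid symGF_ex).
Lemma symGFB x y : x \in f -> y \in f -> symGF (x - y) = symGF x - symGF y.
Proof. by rewrite /symGF; case: cid => P [/= PB _]; exact: PB. Qed.
Lemma symGFM u w : u \in f -> w \in f -> symGF (u * w) = pure (gabG u) (gab w).
Proof. by rewrite /symGF; case: cid => P [/= _]; exact. Qed.
Lemma symGF0 : symGF 0 = 0.
Proof. by have := symGFB (rpred0 f) (rpred0 f); rewrite !subrr. Qed.

Lemma symFG_ex : exists Phi : gring c -> tens (ab c) (ab G),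
  (forall x y, x \in f -> y \in f -> Phi (x - y) = Phi x - Phi y) /\
  (forall u w, u \in f -> w \in f -> Phi (u * w) = pure (gab u) (gabG w)).
Proof.
have [||Phi [PB PE]] := @fox_tens G c (trivz c) _ (@gab c).
- by move=> x s _; exact: in_trivz.
- by move=> x y _ _; exact: gabB.
exists (fun x => tens_map idfun (ab_map (pproj c)) (Phi x)).
split=> [x y /fox_f xf /fox_f yf|u w uf wf]; first by rewrite PB // raddfB.
rewrite PE ?in_trivz // => [|w' w'f]; first by rewrite tens_map_pure /= gabGE.
by apply/gab_ff/mem_idmul.
Qed.

Definition symFG := projT1 (cid symFG_ex).
Lemma symFGB x y : x \in f -> y \in f -> symFG (x - y) = symFG x - symFG y.
Proof. by rewrite /symFG; case: cid => P [/= PB _]; exact: PB. Qed.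
Lemma symFGM u w : u \in f -> w \in f -> symFG (u * w) = pure (gab u) (gabG w).
Proof. by rewrite /symFG; case: cid => P [/= _]; exact. Qed.
Lemma symFG0 : symFG 0 = 0.
Proof. by have := symFGB (rpred0 f) (rpred0 f); rewrite !subrr. Qed.

Notation af := (a * f)%I.
Notation aa := (a * a)%I.
Notation fff := (ff * f)%I.
Definition wI : zmodClosed (gring c) := (aa + fff)%I.

Lemma af_ff : {subset af <= ff}.
Proof. exact: idmulS a_f (fun=> id). Qed.
Lemma aa_af : {subset aa <= af}.
Proof. exact: idmulS (fun=> id) a_f. Qed.
Lemma fff_af : {subset fff <= af}.
Proof. exact: idmulS ff_a (fun=> id). Qed.
Lemma w_af : {subset wI <= af}.
Proof. by apply: idadd_ind; [exact: rpredB | exact: aa_af | exact: fff_af]. Qed.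
Lemma af_f : {subset af <= f}. Proof. by move=> x /af_ff/ff_f. Qed.

Lemma symGF_a u w : u \in a -> w \in f -> symGF (u * w) = 0.
Proof. by move=> ua wf; rewrite symGFM ?(a_f ua) // gabG_a ?pure0l. Qed.

(** [symGF] is additive on all of f and can be fed to [fox_tens]. The formula asks for u in a
    because only then does [symGF] kill u f. *)
Lemma symGFG_ex : exists Phi : gring c -> tens (tens (ab G) (ab c)) (ab G),
  (forall x y, x \in ff -> y \in ff -> Phi (x - y) = Phi x - Phi y) /\
  (forall u w, u \in a -> w \in f -> Phi (u * w) = pure (symGF u) (gabG w)).
Proof.
have [||Phi [PB PE]] := @fox_tens G c f _ symGF.
- by move=> x s; exact: augIM_r.
- by move=> x y; exact: symGFB.
exists (fun x => tens_map idfun (ab_map (pproj c)) (Phi x)).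
split=> [x y xf yf|u w ua wf]; first by rewrite PB // raddfB.
rewrite PE ?(a_f ua) // => [|w' w'f]; first by rewrite tens_map_pure /= gabGE.
exact: symGF_a.
Qed.

Definition symGFG := projT1 (cid symGFG_ex).
Lemma symGFGB x y : x \in ff -> y \in ff ->
  symGFG (x - y) = symGFG x - symGFG y.
Proof. by rewrite /symGFG; case: cid => P [/= PB _]; exact: PB. Qed.
Lemma symGFGM u w : u \in a -> w \in f ->
  symGFG (u * w) = pure (symGF u) (gabG w).
Proof. by rewrite /symGFG; case: cid => P [/= _]; exact. Qed.
Lemma symGFG0 : symGFG 0 = 0.
Proof. by have := symGFGB (rpred0 ff) (rpred0 ff); rewrite !subrr. Qed.

(** The inverse sends [u] (x) [w] to u w modulo af; it is well defined because f * ff lies in af. *)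
Lemma symGF_ker v : v \in ff -> v \in af <-> symGF v = 0.
Proof.
move=> vff; split.
  move: v {vff}; apply: idmul_ind; first exact: symGF0.
    by move=> x y /af_f xf /af_f yf xP yP; rewrite symGFB // xP yP subrr.
  by move=> u w ua wf; exact: symGF_a.
have [||||||||||g gP] := @tens_descent (gring c) (gring c) _ _ {ideal_quot af}
  (fun u => u \in f) (fun w => w \in f) gabG (@gab c)
  (fun u w => \pi_{ideal_quot af} (u * w)).
- by move=> x y; exact: rpredB.
- by move=> x y; exact: rpredB.
- by move=> x y _ _; exact: gabGB.
- by move=> x y _ _; exact: gabB.
- exact: gabG_surj.
- exact: gab_surj.
- by move=> u u' w _ _ _; rewrite mulrBl raddfB.
- by move=> u w w' _ _ _; rewrite mulrBr raddfB.
- move=> u w uf wf /(gabG_eq0 uf) ua; rewrite -(raddf0 \pi_{ideal_quot af}).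
  by apply/ideal_quot_eq; rewrite subr0 mem_idmul.
- move=> u w uf wf /(gab_eq0 wf) wff; rewrite -(raddf0 \pi_{ideal_quot af}).
  apply/ideal_quot_eq; rewrite subr0; apply: fff_af.
  move: w wff {wf}; apply: idmul_ind => [|x y _ _|x y xf yf].
  + by rewrite mulr0 rpred0.
  + by rewrite mulrBr; exact: rpredB.
  by rewrite mulrA !mem_idmul.
move=> Pv; suff E : g (symGF v) = \pi_{ideal_quot af} v.
  move: E; rewrite Pv raddf0 -(raddf0 \pi_{ideal_quot af}).
  by move=> /esym/ideal_quot_eq; rewrite subr0.
move: v vff {Pv}; apply: idmul_ind => [|x y /ff_f xf /ff_f yf xP yP|u w uf wf].
- by rewrite symGF0 !raddf0.
- by rewrite symGFB // !raddfB xP yP.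
by rewrite symGFM // gP.
Qed.

Lemma symGF_surj s : exists2 u, u \in ff & symGF u = s.
Proof.
elim/tens_ind: s => [|x y [u uf <-] [v vf <-]|s t].
- by exists 0; rewrite ?rpred0 ?symGF0.
- by exists (u - v); rewrite ?rpredB // symGFB ?(ff_f uf) ?(ff_f vf).
have [u uf <-] := gabG_surj s; have [w wf <-] := gab_surj t.
by exists (u * w); rewrite ?mem_idmul ?symGFM.
Qed.

Lemma symGFG_aa v : v \in aa -> symGFG v = 0.
Proof.
move: v.
apply: idmul_ind => [|x y /aa_af/af_ff xf /aa_af/af_ff yf xP yP|u w ua wa].
- exact: symGFG0.
- by rewrite symGFGB // xP yP subrr.
by rewrite symGFGM ?(a_f wa) // (gabG_a wa) pure0r.
Qed.

Lemma aff_aa u w : u \in af -> w \in f -> u * w \in aa.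
Proof.
move=> uaf wf; move: u uaf.
apply: idmul_ind => [|x y _ _ xP yP|u v ua vf].
- by rewrite mul0r rpred0.
- by rewrite mulrBl rpredB.
by rewrite -mulrA; apply: mem_idmul => //; apply: ff_a; exact: mem_idmul.
Qed.

(** The inverse sends symGF u (x) [w] to u w modulo aa, for u in ff. It is well defined because af *
    f = a * ff and ff * a both lie in aa. *)
Lemma symGFG_ker v : v \in wI -> v \in aa <-> symGFG v = 0.
Proof.
move=> vw; split=> [|Pv]; first exact: symGFG_aa.
have [||||||||||g gP] := @tens_descent (gring c) (gring c) _ _ {ideal_quot aa}
  (fun u => u \in ff) (fun w => w \in f) symGF gabG
  (fun u w => \pi_{ideal_quot aa} (u * w)).
- by move=> x y; exact: rpredB.
- by move=> x y; exact: rpredB.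
- by move=> x y /ff_f xf /ff_f yf; exact: symGFB.
- by move=> x y _ _; exact: gabGB.
- exact: symGF_surj.
- exact: gabG_surj.
- by move=> u u' w _ _ _; rewrite mulrBl raddfB.
- by move=> u w w' _ _ _; rewrite mulrBr raddfB.
- move=> u w uf wf /(symGF_ker uf) ua; rewrite -(raddf0 \pi_{ideal_quot aa}).
  by apply/ideal_quot_eq; rewrite subr0 aff_aa.
- move=> u w uf wf /(gabG_eq0 wf) wa; rewrite -(raddf0 \pi_{ideal_quot aa}).
  by apply/ideal_quot_eq; rewrite subr0 mem_idmul ?(ff_a uf).
suff [_ E] : v \in ff /\ g (symGFG v) = \pi_{ideal_quot aa} v.
  move: E; rewrite Pv raddf0 -(raddf0 \pi_{ideal_quot aa}).
  by move=> /esym/ideal_quot_eq; rewrite subr0.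
move: v vw {Pv}; apply: idadd_ind => [x y [xf xP] [yf yP]|v vaa|v vf].
- by split; [exact: rpredB | rewrite symGFGB // !raddfB xP yP].
- split; first exact/af_ff/aa_af.
  rewrite symGFG_aa // raddf0 -(raddf0 \pi_{ideal_quot aa}).
  by apply/esym/ideal_quot_eq; rewrite subr0.
split; first exact/af_ff/fff_af.
move: v vf.
apply: idmul_ind => [|x y /fff_af/af_ff xf /fff_af/af_ff yf xP yP|u w uf wf].
- by rewrite symGFG0 !raddf0.
- by rewrite symGFGB // !raddfB xP yP.
by rewrite symGFGM ?gP ?(ff_a uf).
Qed.

Lemma symGFG_surj s : exists2 u, u \in wI & symGFG u = s.
Proof.
elim/tens_ind: s => [|x y [u uf <-] [v vf <-]|s t].
- by exists 0; rewrite ?rpred0 ?symGFG0.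
- by exists (u - v); rewrite ?rpredB // symGFGB ?af_ff ?w_af.
have [u uf <-] := symGF_surj s; have [w wf <-] := gabG_surj t.
exists (u * w); last by rewrite symGFGM ?(ff_a uf).
by apply/mem_idaddr/mem_idmul.
Qed.

Lemma symFG_w v : v \in wI -> symFG v = 0.
Proof.
move=> vw; suff [] : v \in f /\ symFG v = 0 by [].
move: v vw; apply: idadd_ind => [x y [xf xP] [yf yP]|v vaa|v vfff].
- by split; [exact: rpredB | rewrite symFGB // xP yP subrr].
- split; first exact/af_f/aa_af.
  move: v vaa.
  apply: idmul_ind => [|x y /aa_af/af_f xf /aa_af/af_f yf xP yP|x y xa ya].
  + exact: symFG0.
  + by rewrite symFGB // xP yP subrr.
  by rewrite symFGM ?(a_f xa) ?(a_f ya) // (gabG_a ya) pure0r.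
split; first exact/af_f/fff_af.
move: v vfff.
apply: idmul_ind => [|x y /fff_af/af_f xf /fff_af/af_f yf xP yP|x y xa ya].
+ exact: symFG0.
+ by rewrite symFGB // xP yP subrr.
by rewrite symFGM ?(ff_f xa) // (gab_ff xa) pure0l.
Qed.

Definition projGG : {additive tens (ab c) (ab G) -> tens (ab G) (ab G)} :=
  tens_map (ab_map (pproj c)) idfun.

Lemma projGG_symFG v : v \in af -> projGG (symFG v) = 0.
Proof.
move: v; apply: idmul_ind => [|x y /af_f xf /af_f yf xP yP|x y xa ya].
- by rewrite symFG0 raddf0.
- by rewrite symFGB // raddfB xP yP subrr.
by rewrite symFGM ?(a_f xa) // tens_map_pure /= -gabGE gabG_a // pure0l.
Qed.

(** Right exactness of the tensor product: modulo the image [P] of af, a pure tensor depends only on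
    its image in G_ab (x) G_ab. *)
Lemma projGG_ker (y : tens (ab c) (ab G)) :
  projGG y = 0 -> exists2 v, v \in af & symFG v = y.
Proof.
move=> py.
pose P (z : tens (ab c) (ab G)) := exists2 v, v \in af & symFG v = z.
have P0 : P 0 by exists 0; rewrite ?rpred0 ?symFG0.
have PB (x z : tens (ab c) (ab G)) : P x -> P z -> P (x - z).
  move=> [u uf <-] [v vf <-]; exists (u - v); first exact: rpredB.
  by rewrite symFGB // ?(af_f uf) ?(af_f vf).
have [||||||||||g gP] := @tens_descent (ab c) (ab G) (ab G) (ab G)
  {ideal_quot (propz P0 PB)} (fun=> True) (fun=> True) (ab_map (pproj c)) id
  (fun s t => \pi_{ideal_quot (propz P0 PB)} (pure s t)) => //.
- by move=> x z _ _; rewrite raddfB.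
- move=> s; have [u _ <-] := gabG_surj s.
  by exists (gab u); rewrite -?gabGE.
- by move=> t; exists t.
- by move=> s s' t _ _ _; rewrite pureBl raddfB.
- by move=> s t t' _ _ _; rewrite pureBr raddfB.
- move=> s t _ _ s0; rewrite -(raddf0 \pi_{ideal_quot (propz P0 PB)}).
  apply/ideal_quot_eq; rewrite subr0; apply/propzP.
  have [u uf us] := gab_surj s; have [w wf <-] := gabG_surj t.
  have ua : u \in a by apply: gabG_eq0 => //; rewrite gabGE us.
  by exists (u * w); rewrite ?mem_idmul // symFGM ?us.
- by move=> s t _ _ ->; rewrite pure0r raddf0.
have E : g (projGG y) = \pi_{ideal_quot (propz P0 PB)} y.
  elim/tens_ind: y {py} => [|x z xP zP|s t]; first by rewrite !raddf0.
    by rewrite !raddfB xP zP.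
  by rewrite tens_map_pure gP.
move: E; rewrite py raddf0 -(raddf0 \pi_{ideal_quot (propz P0 PB)}).
by move=> /esym/ideal_quot_eq; rewrite subr0 => /propzP.
Qed.

Lemma projGG_surj t : exists y : tens (ab c) (ab G), projGG y = t.
Proof.
elim/tens_ind: t => [|x z [u <-] [v <-]|s t].
- by exists 0; rewrite raddf0.
- by exists (u - v); rewrite raddfB.
have [u _ <-] := gabG_surj s; exists (pure (gab u) t).
by rewrite tens_map_pure /= gabGE.
Qed.

Lemma fr_aa : {subset frI c <= aa}.
Proof.
apply: idadd_ind; first exact: rpredB.
  apply: idadd_ind; first exact: rpredB.
    exact: idmulS r_a r_a.
  exact: idmulS ff_a r_a.
apply: idmul_ind; [exact: rpred0 | by move=> x y _ _; exact: rpredB |].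
move=> x y xrf yf; move: x xrf.
apply: idmul_ind => [|x z _ _ xP zP|x z xr zf].
- by rewrite mul0r rpred0.
- by rewrite mulrBl rpredB.
rewrite -mulrA; apply: mem_idmul; first exact: r_a.
by apply: ff_a; exact: mem_idmul.
Qed.
(** The ideal fr is ra + ar. This inclusion and [ar_fr] account both for the constancy of aa / fr
    and for its description as a quotient of a tensor square. *)
Lemma ra_fr x y : x \in r -> y \in a -> x * y \in frI c.
Proof.
move=> xr; move: y; apply: idadd_ind => [y z yP zP|y yr|].
- by rewrite (mulrBr x); exact: (rpredB yP zP).
- by apply/mem_idaddl/mem_idaddl/mem_idmul.
apply: idmul_ind => [|y z _ _ yP zP|y z yf zf].
- by rewrite mulr0 rpred0.
- by rewrite (mulrBr x); exact: (rpredB yP zP).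
by rewrite mulrA; apply/mem_idaddr/mem_idmul => //; exact: mem_idmul.
Qed.
Lemma ar_fr x y : x \in a -> y \in r -> x * y \in frI c.
Proof.
move=> xa yr; move: x xa; apply: idadd_ind => [x z yP zP|x xr|x xff].
- by rewrite mulrBl rpredB.
- by apply/mem_idaddl/mem_idaddl/mem_idmul.
by apply/mem_idaddl/mem_idaddr/mem_idmul.
Qed.
End PresIdeals.

(** * Naturality of the symbol maps *)

Section Naturality.
Variables (G H : grp) (phi : {ghom G -> H}) (c : pres G) (d : pres H).
Variable f : pmor phi c d.
(** A parameter in place of [ab_map phi], so that inside Pres(G) the plain identity of G_ab can be
    used. *)
Variable al : {additive ab G -> ab H}.
Hypothesis gabG_f : forall u, gabG (gring_map f u) = al (gabG u).

Lemma gab_f u : gab (gring_map f u) = ab_map f (gab u).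
Proof. exact: gab_map. Qed.

Let fI := @augI_map _ _ (pmor_val f).
Let rI := @relI_map _ _ _ _ _ f.

Lemma ffI_map x : x \in (augI c * augI c)%I ->
  gring_map f x \in (augI d * augI d)%I.
Proof. exact: (idmul_map fI fI). Qed.
Lemma aI_map x : x \in (relI c + augI c * augI c)%I ->
  gring_map f x \in (relI d + augI d * augI d)%I.
Proof. exact: (idadd_map rI ffI_map). Qed.
Lemma afI_map x : x \in ((relI c + augI c * augI c) * augI c)%I ->
  gring_map f x \in ((relI d + augI d * augI d) * augI d)%I.
Proof. exact: (idmul_map aI_map fI). Qed.
Lemma wI_map x : x \in wI c -> gring_map f x \in wI d.
Proof. exact: (idadd_map (idmul_map aI_map aI_map) (idmul_map ffI_map fI)). Qed.

Lemma symGF_map v : v \in (augI c * augI c)%I ->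
  symGF (gring_map f v) = tens_map al (ab_map f) (symGF v).
Proof.
move: v; apply: idmul_ind => [|x y xff yff xP yP|u w uf wf].
- by rewrite gring_map0 !symGF0 raddf0.
- have [xf yf] := (ff_f xff, ff_f yff).
  rewrite gring_mapB [LHS]symGFB ?fI // xP yP (symGFB xf yf).
  by rewrite raddfB.
rewrite gring_mapM [LHS]symGFM ?fI // (symGFM uf wf) tens_map_pure.
by rewrite gabG_f gab_f.
Qed.

Lemma symFG_map v : v \in (augI c * augI c)%I ->
  symFG (gring_map f v) = tens_map (ab_map f) al (symFG v).
Proof.
move: v; apply: idmul_ind => [|x y xff yff xP yP|u w uf wf].
- by rewrite gring_map0 !symFG0 raddf0.
- have [xf yf] := (ff_f xff, ff_f yff).
  rewrite gring_mapB [LHS]symFGB ?fI // xP yP (symFGB xf yf).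
  by rewrite raddfB.
rewrite gring_mapM [LHS]symFGM ?fI // (symFGM uf wf) tens_map_pure.
by rewrite gabG_f gab_f.
Qed.

Lemma symGFG_map v : v \in wI c ->
  symGFG (gring_map f v) = tens_map (tens_map al (ab_map f)) al (symGFG v).
Proof.
move=> vw; suff [_ ->] : v \in (augI c * augI c)%I /\
    symGFG (gring_map f v) = tens_map (tens_map al (ab_map f)) al (symGFG v) by [].
move: v vw; apply: idadd_ind => [x y [xf xP] [yf yP]|v vaa|v vf].
- split; first exact: rpredB.
  rewrite gring_mapB [LHS]symGFGB ?ffI_map // xP yP (symGFGB xf yf).
  by rewrite raddfB.
- split; first exact/af_ff/aa_af.
  by rewrite !symGFG_aa ?raddf0 //; exact: (idmul_map aI_map aI_map).
split; first exact/af_ff/fff_af.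
move: v vf.
apply: idmul_ind => [|x y /fff_af/af_ff xf /fff_af/af_ff yf xP yP|u w uf wf].
- by rewrite gring_map0 !symGFG0 raddf0.
- rewrite gring_mapB [LHS]symGFGB ?ffI_map // xP yP (symGFGB xf yf).
  by rewrite raddfB.
have [ua fua] := (ff_a uf, ff_a (ffI_map uf)).
rewrite gring_mapM [LHS]symGFGM ?fI // (symGFGM ua wf) tens_map_pure.
by rewrite gabG_f (symGF_map uf).
Qed.
End Naturality.

(** * Acyclicity of the successive quotients *)

Lemma gabG_map (G H : grp) (phi : {ghom G -> H}) (c : pres G) (d : pres H)
  (f : pmor phi c d) u : gabG (gring_map f u) = ab_map phi (gabG u).
Proof.
elim/gring_indP: u => [|x y xP yP|g].
- by rewrite gring_map0 !gabG0 raddf0.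
- by rewrite gring_mapB !gabGB xP yP raddfB.
by rewrite gring_mapU !gabGU ab_map_pi pmorP.
Qed.

Lemma ab_map_id (G : groupType) (u : {ghom G -> G}) x :
  u =1 id -> ab_map u x = x.
Proof. by elim/ab_ind: x => x uE; rewrite ab_map_pi uE. Qed.
Lemma ab_map_comp (G H K : groupType) (u : {ghom G -> H}) (v : {ghom H -> K})
    (w : {ghom G -> K}) x : (forall y, w y = v (u y)) ->
  ab_map w x = ab_map v (ab_map u x).
Proof. by elim/ab_ind: x => x wE; rewrite !ab_map_pi wE. Qed.

Lemma gabG_mapid (G : grp) (c d : pres G) (f : pmor idfun c d) u :
  gabG (gring_map f u) = idfun (gabG u).
Proof.
by rewrite (@gabG_map _ _ idfun c d f) /= ab_map_id.
Qed.

Lemma tens_map_id (M N : zmodType) (f : {additive M -> M}) (g : {additive N -> N})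
  x : f =1 id -> g =1 id -> tens_map f g x = x.
Proof.
move=> fE gE; apply: (tens_ext (g := tens_map f g) (g' := idfun)) => m n.
by rewrite tens_map_pure fE gE.
Qed.
Lemma tens_map_comp (M N M' N' M2 N2 : zmodType)
  (f : {additive M -> M'}) (g : {additive N -> N'})
  (f' : {additive M' -> M2}) (g' : {additive N' -> N2})
  (f2 : {additive M -> M2}) (g2 : {additive N -> N2}) x :
  (forall y, f2 y = f' (f y)) -> (forall y, g2 y = g' (g y)) ->
  tens_map f2 g2 x = tens_map f' g' (tens_map f g x).
Proof.
move=> fE gE.
apply: (tens_ext (g := tens_map f2 g2)
  (g' := tens_map f' g' \o tens_map f g)) => m n /=.
by rewrite !tens_map_pure fE gE.
Qed.

Section Functors.
Variable G : grp.
Notation C := (pres_cat G).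
Notation X := (pres_copr G).
Implicit Types T : abfunctor C.

Definition gringF : abfunctor C.
Proof.
apply: (@AbFunctor C (fun c : pres G => gring c)
  (fun c d (f : pmor idfun c d) => gring_map f)).
- by move=> c x; exact: gring_map_id.
- by move=> c d e f g x; exact: gring_map_comp.
Defined.

Definition abF : abfunctor C.
Proof.
apply: (@AbFunctor C (fun c : pres G => ab c)
  (fun c d (f : pmor idfun c d) => ab_map f)).
- by move=> c x; exact: ab_map_id.
- by move=> c d e f g x; exact: ab_map_comp.
Defined.

Definition tensLF (A : zmodType) T : abfunctor C.
Proof.
apply: (@AbFunctor C (fun c => tens A (T c))
  (fun c d f => tens_map idfun (ahom T f))).
- by move=> c x; apply: tens_map_id => y //; exact: ahom_id.
- by move=> c d e f g x; apply: tens_map_comp => y //; exact: ahom_comp.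
Defined.
Definition tensRF T (B : zmodType) : abfunctor C.
Proof.
apply: (@AbFunctor C (fun c => tens (T c) B)
  (fun c d f => tens_map (ahom T f) idfun)).
- by move=> c x; apply: tens_map_id => y //; exact: ahom_id.
- by move=> c d e f g x; apply: tens_map_comp => y //; exact: ahom_comp.
Defined.

(* Functors of the free group alone satisfy this: killing the second factor of
   a coproduct is a natural retraction, although it does not lie over [G]. *)
Definition nullretr T : Prop := exists r : abnat (Sh X T) T,
  (forall c x, r c (ahom T (cp1 X c) x) = x) /\
  (forall x, r _ (ahom T (cp2 X (cpe X)) x) = 0).

Lemma nullretr_acyc T n : nullretr T -> acyc X T n.
Proof.
move=> [r [r1 r2]]; case: n => [|n].
  by apply: (racyc_retr0 (r := r)) => // x _; exact: r2.
exact: (racyc_retr (r := r)).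
Qed.

Lemma nullretr_ab : nullretr abF.
Proof.
pose g (c : C) : {additive Sh X abF c -> abF c} := ab_map (cop_kill c).
have key (c d : pres_cat G) (f : chom c d) (x : ab (cop c)) :
    ab_map (cop_kill d) (ab_map (pmor_val (cpf X f : pmor _ (cop c) (cop d))) x)
    = ab_map (pmor_val f) (ab_map (cop_kill c) x).
  elim/ab_ind: x => x; rewrite !ab_map_pi; congr ab_pi; exact: cop_kill_nat.
have gP (c d : C) (f : chom c d) x :
    g d (ahom (Sh X abF) f x) = ahom abF f (g c x) by exact: key.
exists (AbNat gP); split.
  move=> c x; elim/ab_ind: x => x.
  rewrite -[LHS]/(ab_map (cop_kill c) (ab_map (cop1_hom c) (ab_pi x))).
  by rewrite !ab_map_pi cop_kill1.
move=> x; elim/ab_ind: x => x.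
rewrite -[LHS]/(ab_map (cop_kill _) (ab_map (cop2_hom _) (ab_pi x))).
by rewrite !ab_map_pi cop_kill2.
Qed.

Lemma nullretr_tensL A T : nullretr T -> nullretr (tensLF A T).
Proof.
move=> [r [r1 r2]].
pose g (c : C) : {additive Sh X (tensLF A T) c -> tensLF A T c} :=
  tens_map idfun (r c).
have gP (c d : C) (f : chom c d) x :
    g d (ahom (Sh X (tensLF A T)) f x) = ahom (tensLF A T) f (g c x).
  apply: (tens_ext (g := g d \o ahom (Sh X (tensLF A T)) f)
    (g' := ahom (tensLF A T) f \o g c)) => m n.
  rewrite /g /= !tens_map_pure /=.
  congr pure; exact: (abcompP r f n).
exists (AbNat gP); split=> [c x|x].
  apply: (tens_ext (g := g c \o ahom (tensLF A T) (cp1 X c)) (g' := idfun))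
    => m n.
  by rewrite /g /= !tens_map_pure /= r1.
apply: (tens_ext (g := g _ \o ahom (tensLF A T) (cp2 X (cpe X))) (g' := \0))
  => m n.
by rewrite /g /= !tens_map_pure /= r2 pure0r.
Qed.

Lemma nullretr_tensR T B : nullretr T -> nullretr (tensRF T B).
Proof.
move=> [r [r1 r2]].
pose g (c : C) : {additive Sh X (tensRF T B) c -> tensRF T B c} :=
  tens_map (r c) idfun.
have gP (c d : C) (f : chom c d) x :
    g d (ahom (Sh X (tensRF T B)) f x) = ahom (tensRF T B) f (g c x).
  apply: (tens_ext (g := g d \o ahom (Sh X (tensRF T B)) f)
    (g' := ahom (tensRF T B) f \o g c)) => m n.
  rewrite /g /= !tens_map_pure /=.
  congr pure; exact: (abcompP r f m).
exists (AbNat gP); split=> [c x|x].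
  apply: (tens_ext (g := g c \o ahom (tensRF T B) (cp1 X c)) (g' := idfun))
    => m n.
  by rewrite /g /= !tens_map_pure /= r1.
apply: (tens_ext (g := g _ \o ahom (tensRF T B) (cp2 X (cpe X))) (g' := \0))
  => m n.
by rewrite /g /= !tens_map_pure /= r2 pure0l.
Qed.

Definition gsub (I : forall c : pres G, zmodClosed (gring c))
    (If : forall (c d : pres G) (f : pmor idfun c d) x,
       x \in I c -> gring_map f x \in I d) : subfun gringF.
Proof.
apply: (@SubFun C gringF (fun c x => x \in I c)).
- by move=> c; exact: rpred0.
- by move=> c x y; exact: rpredB.
- by move=> c d f x; exact: If.
Defined.

Definition sub_ff : subfun gringF :=
  gsub (fun c d f => @ffI_map G G idfun c d f).
Definition sub_af : subfun gringF :=
  gsub (fun c d f => @afI_map G G idfun c d f).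
Definition sub_w : subfun gringF := gsub (fun c d f => @wI_map G G idfun c d f).
Definition sub_sq : subfun gringF := gsub (fun c d f => @sqI_map G G idfun c d f).
Definition sub_fr : subfun gringF := gsub (fun c d f => @frI_map G G idfun c d f).

Definition sub_q : subfun gringF.
Proof.
apply: (@SubFun C gringF (fun c x => sub_af c x /\ symFG (c := c) x = 0)).
- by move=> c; split; [exact: sf0 | exact: symFG0].
- move=> c x y [xA xq] [yA yq]; split; first exact: sfB.
  by rewrite symFGB ?(af_f xA) ?(af_f yA) // xq yq subrr.
- move=> c d f x [xA xq]; split; first exact: sf_map.
  rewrite (@symFG_map G G idfun c d f idfun (gabG_mapid f)) ?xq ?raddf0 //.
  exact: af_ff.
Defined.

Lemma gring_triv (H K : groupType) (u : {ghom H -> K}) x :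
  (forall y, u y = 1%g) -> gring_map u x = 1 *~ gring_aug x.
Proof.
move=> u1; elim/gring_indP: x => [|x y xP yP|g].
- by rewrite gring_map0 aug0 mulr0z.
- by rewrite gring_mapB xP yP augB mulrzBr.
by rewrite gring_mapU augU u1.
Qed.

Lemma gring_kill_nat (c d : pres_cat G) (f : chom c d) (x : gring (cop c)) :
  gring_map (cop_kill d)
    (gring_map (pmor_val (cpf X f : pmor _ (cop c) (cop d))) x)
  = gring_map (pmor_val f) (gring_map (cop_kill c) x).
Proof.
elim/gring_indP: x => [|x y xP yP|y].
- by rewrite !gring_map0.
- by rewrite !gring_mapB xP yP.
by rewrite !gring_mapU; congr gel; exact: cop_kill_nat.
Qed.

Definition kill_nat : abnat (Sh X gringF) gringF.
Proof.
pose g (c : C) : {additive Sh X gringF c -> gringF c} :=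
  gring_map (cop_kill c).
apply: (@AbNat C _ _ g) => c d f x; exact: gring_kill_nat.
Defined.

(** [kill_nat] retracts the whole group ring and preserves ff. In degree 0 the second inclusion
    becomes a trivial homomorphism, which sends x to its augmentation; this is 0 on ff. *)
Lemma racyc_ff n : racyc X (szero gringF) sub_ff n.
Proof.
have r1 (c : C) x : kill_nat c (ahom gringF (cp1 X c) x) = x.
  rewrite -[LHS]/(gring_map (cop_kill c) (gring_map (cop1_hom c) x)).
  rewrite -(@gring_map_comp _ _ _ _ _ (gcomp (cop1_hom c) (cop_kill c))) //.
  by apply: gring_map_id => y; exact: cop_kill1.
case: n => [|n].
  apply: (racyc_retr0 (r := kill_nat)) => // x xff.
  rewrite -[LHS]/(gring_map (cop_kill _) (gring_map (cop2_hom _) x)).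
  rewrite -(@gring_map_comp _ _ _ _ _ (gcomp (cop2_hom _) (cop_kill _))) //.
  rewrite gring_triv; first by rewrite (augI_E (ff_f xff)) mulr0z.
  by move=> y; exact: cop_kill2.
apply: (racyc_retr (r := kill_nat)) => // c x.
by apply: idmul_map; exact: augI_map.
Qed.

Definition tensGF : abfunctor C := tensLF (ab G) abF.
Definition tensFG : abfunctor C := tensRF abF (ab G).
Definition tensGFG : abfunctor C := tensRF tensGF (ab G).

Lemma acyc_tensGF n : acyc X tensGF n.
Proof. exact/nullretr_acyc/nullretr_tensL/nullretr_ab. Qed.
Lemma acyc_tensFG n : acyc X tensFG n.
Proof. exact/nullretr_acyc/nullretr_tensR/nullretr_ab. Qed.
Lemma acyc_tensGFG n : acyc X tensGFG n.
Proof. exact/nullretr_acyc/nullretr_tensR/nullretr_tensL/nullretr_ab. Qed.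

Lemma racyc_af_ff n : racyc X sub_af sub_ff n.
Proof.
apply: (@racyc_quot _ _ gringF tensGF sub_af sub_ff (fun c : pres G => @symGF G c)).
- by move=> c x y /ff_f xf /ff_f yf; exact: symGFB.
- move=> c d f x xff.
  exact: (@symGF_map G G idfun c d f idfun (gabG_mapid f)).
- by move=> c x; exact: af_ff.
- by move=> c x; exact: symGF_ker.
- by move=> c y; exact: symGF_surj.
exact: acyc_tensGF.
Qed.

Lemma racyc_af n : racyc X (szero gringF) sub_af n.
Proof.
apply: (racyc_sub (S2 := sub_ff)).
- by move=> c x ->; exact: sf0.
- by move=> c x; exact: af_ff.
- exact: racyc_ff.
by case: n => // n; exact: racyc_af_ff.
Qed.

Lemma racyc_sq_w n : racyc X sub_sq sub_w n.
Proof.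
apply: (@racyc_quot _ _ gringF tensGFG sub_sq sub_w
  (fun c : pres G => @symGFG G c)).
- by move=> c x y /w_af/af_ff xf /w_af/af_ff yf; exact: symGFGB.
- move=> c d f x xff.
  exact: (@symGFG_map G G idfun c d f idfun (gabG_mapid f)).
- by move=> c x; exact: mem_idaddl.
- by move=> c x; exact: symGFG_ker.
- by move=> c y; exact: symGFG_surj.
exact: acyc_tensGFG.
Qed.

Lemma gring_map_rel (c d : pres G) (f g : pmor idfun c d) x :
  gring_map f x - gring_map g x \in relI d.
Proof.
rewrite mem_relI gring_mapB; elim/gring_indP: x => [|x y xP yP|y].
- by rewrite !gring_map0 subrr.
- rewrite !gring_mapB subrACA; move/eqP: xP => ->; move/eqP: yP => ->.
  by rewrite subrr.
by rewrite !gring_mapU !pmorP subrr.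
Qed.

Lemma subrMM (R : nzRingType) (a b a' b' : R) :
  a * b - a' * b' = (a - a') * b + a' * (b - b').
Proof. by rewrite mulrBl mulrBr subrKA. Qed.

(** On a product, f(u) f(w) - g(u) g(w) = (f(u) - g(u)) f(w) + g(u) (f(w) - g(w)), which lies in ra
    + ar since f and g agree modulo r. *)
Lemma sq_const (c d : pres G) (f g : pmor idfun c d) x :
  x \in sqI c -> gring_map f x - gring_map g x \in frI d.
Proof.
move: x; apply: idmul_ind => [|x y _ _ xP yP|u w ua wa].
- by rewrite !gring_map0 subrr rpred0.
- by rewrite !gring_mapB subrACA; exact: (rpredB xP yP).
rewrite !gring_mapM subrMM.
have E1 := ra_fr (gring_map_rel f g u) (@aI_map G G idfun c d f w wa).
have E2 := ar_fr (@aI_map G G idfun c d g u ua) (gring_map_rel f g w).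
exact: (rpredD E1 E2).
Qed.

Lemma racyc_fr_sq n : racyc X sub_fr sub_sq n.+1.
Proof.
apply: racyc_const; first by move=> c x; exact: fr_aa.
by move=> c d f g x; exact: sq_const.
Qed.

(** Write dm = f - g. On a product u w of af, dm (u w) is dm u * f(w) modulo ar, and modulo w the
    latter depends only on [u] (x) [w] in F_ab (x) G_ab: u in ff gives an element of fff, and w in a
    gives one of ra. So dm x is a function of [symFG x], which is 0 on q. *)
Lemma q_const (c d : pres G) (f g : pmor idfun c d) x :
  sub_q c x -> gring_map f x - gring_map g x \in wI d.
Proof.
move=> [xA xq].
pose dm (y : gring c) := gring_map f y - gring_map g y.
have dmB y z : dm (y - z) = dm y - dm z.
  by rewrite /dm (gring_mapB f) (gring_mapB g); exact: subrACA.
have [||||||||||h hP] := @tens_descent (gring c) (gring c) _ _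
  {ideal_quot wI d} (fun u => u \in augI c) (fun w => w \in augI c)
  (@gab c) (@gabG G c)
  (fun u w => \pi_{ideal_quot wI d} (dm u * gring_map f w)).
- by move=> y z; exact: rpredB.
- by move=> y z; exact: rpredB.
- by move=> y z _ _; exact: gabB.
- by move=> y z _ _; exact: gabGB.
- exact: gab_surj.
- exact: gabG_surj.
- by move=> u u' w _ _ _; rewrite dmB mulrBl raddfB.
- by move=> u w w' _ _ _; rewrite gring_mapB mulrBr raddfB.
- move=> u w uf wf /(gab_eq0 uf) uff; rewrite -(raddf0 \pi_{ideal_quot wI d}).
  apply/ideal_quot_eq; rewrite subr0; apply/mem_idaddr/mem_idmul.
    by apply: rpredB; apply: (@ffI_map G G idfun).
  exact: augI_map.
- move=> u w uf wf /(gabG_eq0 wf) wa; rewrite -(raddf0 \pi_{ideal_quot wI d}).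
  apply/ideal_quot_eq; rewrite subr0; apply/mem_idaddl/mem_idmul.
    by apply: r_a; exact: gring_map_rel.
  exact: (@aI_map G G idfun).
suff E : h (symFG x) = \pi_{ideal_quot wI d} (dm x).
  move: E; rewrite xq raddf0 -(raddf0 \pi_{ideal_quot wI d}).
  by move=> /esym/ideal_quot_eq; rewrite subr0.
move: x xA {xq}; apply: idmul_ind => [|x y /af_f xf /af_f yf xP yP|u w ua wf].
- by rewrite symFG0 /dm !gring_map0 subrr !raddf0.
- rewrite symFGB // dmB (raddfB h) xP yP; exact/esym/raddfB.
rewrite symFGM ?(a_f ua) // hP ?(a_f ua) //; apply/ideal_quot_eq.
rewrite /dm !gring_mapM subrMM opprD addrA subrr add0r rpredN.
have E := r_a (gring_map_rel f g w).
exact: (mem_idaddl _ (mem_idmul (@aI_map G G idfun c d g u ua) E)).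
Qed.

Lemma racyc_w_q n : racyc X sub_w sub_q n.+1.
Proof.
apply: racyc_const; first by move=> c x xw; split; [exact: w_af|exact: symFG_w].
by move=> c d f g x; exact: q_const.
Qed.

(** Along fr < aa < w < q the quotients are constant, acyclic, constant. *)
Lemma racyc_fr_q n : racyc X sub_fr sub_q n.+1.
Proof.
apply: (racyc_trans (S' := sub_w)); last exact: racyc_w_q.
- by move=> c x xf; apply: mem_idaddl; exact: fr_aa.
- by move=> c x xw; split; [exact: w_af|exact: symFG_w].
apply: (racyc_trans (S' := sub_sq)); last exact: racyc_sq_w.
- by move=> c x; exact: fr_aa.
- by move=> c x; exact: mem_idaddl.
exact: racyc_fr_sq.
Qed.
End Functors.

(** * Low degrees *)

Section LowDegrees.
Variable G : grp.
Notation C := (pres_cat G).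
Notation X := (pres_copr G).
Notation gF := (gringF G).
Notation "'gr' n" := (gF (CE X n)) (at level 10, n at level 9).

Lemma val_chd n (x : frF G (CE X n)) : (val (chd x) : gr n.+1) = chd (val x : gr n).
Proof.
exact: (@chd_nat C X (frF G) gF (sall (frF G)) (fun c x => val x)).
Qed.

Lemma symFG_chd n (v : gr n) : sub_af G _ v ->
  symFG (chd v : gr n.+1) = @chd C X (tensFG G) n (symFG (v : gr n)).
Proof.
move=> /af_ff vA.
apply: (@chd_nat C X gF (tensFG G) (sub_ff G) (fun c : pres G => @symFG G c)) => //.
- by move=> c x y /ff_f xf /ff_f yf; exact: symFGB.
- move=> c d f x xff.
  exact: (@symFG_map G G idfun c d f idfun (gabG_mapid f)).
Qed.

Definition tensGG : abfunctor C := abconst C (tens (ab G) (ab G)).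

Lemma projGG_chd n (y : tensFG G (CE X n)) :
  projGG _ (chd y) = @chd C X tensGG n (projGG _ y).
Proof.
apply: (@chd_nat C X (tensFG G) tensGG (sall (tensFG G))
  (fun c : pres G => @projGG G c)) => //.
  by move=> c x z _ _; rewrite raddfB.
move=> c d f x _.
apply: (tens_ext (g := @projGG G d \o ahom (tensFG G) f) (g' := @projGG G c)) => m n'.
rewrite /= /projGG !tens_map_pure /=; congr pure.
by rewrite -(@ab_map_comp _ _ _ _ _ (pproj c)) // => z; rewrite pmorP.
Qed.

Lemma af_ex n (v : gr n.+1) : sub_af G _ v -> chd v = 0 ->
  exists2 w, sub_af G _ w & chd w = v.
Proof.
move=> vA dv; have [w wA /eqP] := @racyc_af G n.+1 v vA dv.
by rewrite subr_eq0 => /eqP ->; exists w.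
Qed.
Lemma af_zero (v : gr 0) : sub_af G _ v -> chd v = 0 -> v = 0.
Proof. exact: (@racyc_af G 0). Qed.
Lemma tensFG_ex n (v : tensFG G (CE X n.+1)) : chd v = 0 -> exists w, chd w = v.
Proof.
move=> dv; have [w _ /eqP] := @acyc_tensFG G n.+1 v I dv.
by rewrite subr_eq0 => /eqP ->; exists w.
Qed.
Lemma tensFG_zero (v : tensFG G (CE X 0)) : chd v = 0 -> v = 0.
Proof. exact: (@acyc_tensFG G 0 v I). Qed.
Lemma tensGG_chd (x : tensGG (CE X 0)) : chd x = 0. Proof. exact: subrr. Qed.
Lemma tensGG_zero (x : tensGG (CE X 1)) : chd x = 0 -> x = 0.
Proof.
move=> dx; have [||w _ /eqP] :=
  @racyc_const C X tensGG (szero tensGG) (sall tensGG) 0 _ _ x I dx.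
- by [].
- by move=> c d f g y _; exact: subrr.
by rewrite subr_eq0 tensGG_chd => /eqP.
Qed.

Lemma fr_lift n (v : gr n) :
  sub_fr G _ v -> exists xi : frF G (CE X n), val xi = v.
Proof. by move=> vF; exists (Subz vF). Qed.

Lemma fr_AF c x : sub_fr G c x -> sub_af G c x.
Proof. by move=> xf; exact/aa_af/fr_aa. Qed.
Lemma fr_q (c : pres G) (x : gring c) : x \in frI c -> symFG x = 0.
Proof. by move=> xf; apply: symFG_w; apply: mem_idaddl; exact: fr_aa. Qed.

Lemma symFGBA (c : pres G) (x y : gring c) : sub_af G c x -> sub_af G c y ->
  symFG (x - y) = symFG x - symFG y.
Proof. by move=> /af_f xf /af_f yf; exact: symFGB. Qed.

Lemma chd_subl (T : abfunctor C) n (v : T (CE X n.+1)) (v' w : T (CE X n)) :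
  chd (v - chd v' - chd w) = chd v.
Proof. by rewrite !chdB !chdd !subr0. Qed.

(** The chain H^2(fr) = H^1(af / fr) = H^1(af / q) = H^0(G_ab (x) G_ab): the outer equalities are
    connecting maps, with af and F_ab (x) G_ab acyclic, and the middle one holds because q / fr has
    no cohomology in positive degrees. *)
Definition cech2_rel (xi : frF G (CE X 2)) (t : tens (ab G) (ab G)) :=
  exists v : gr 1, [/\ sub_af G _ v, chd v = val xi &
    exists2 y : tensFG G (CE X 0), chd y = symFG v & projGG _ y = t].

Lemma frQ_ex n (v : gr n.+1) : sub_q G _ v -> sub_fr G _ (chd v) ->
  exists2 w, sub_q G _ w & sub_fr G _ (v - chd w).
Proof. exact: racyc_fr_q. Qed.

Lemma cech2_corr : corr (@cechZ C X (frF G) 2) (@cechB C X (frF G) 1)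
  (fun=> True) (fun t => t = 0) cech2_rel.
Proof.
split.
- move=> xi xi' t t' [v [vA dv [y yv <-]]] [v' [vA' dv' [y' yv' <-]]].
  exists (v - v'); split; first exact: sfB.
    by rewrite chdB dv dv'.
  exists (y - y'); first by rewrite chdB yv yv' symFGBA.
  exact: raddfB.
- move=> xi Zxi.
  have dxi : chd (val xi : gr 2) = 0 by rewrite -val_chd Zxi.
  have [v vA dv] := af_ex (fr_AF (valP xi)) dxi.
  have [y yv] : exists y, @chd C X (tensFG G) 0 y = symFG v.
    by apply: tensFG_ex; rewrite -symFG_chd // dv fr_q ?(valP xi).
  by exists (projGG _ y) => //; exists v; split=> //; exists y.
- move=> t _; have [y yt] := @projGG_surj G (CE X 0) t.
  (* The differential of y dies in the constant functor, hence comes from af. The lift v1 has its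
     differential in q only; an element of q corrects it so that the differential lies in fr. *)
  have [v1 v1A v1y] : exists2 v, v \in ((relI _ + augI _ * augI _) * augI _)%I &
      symFG v = @chd C X (tensFG G) 0 y.
    by apply: projGG_ker; rewrite projGG_chd tensGG_chd.
  have [||w [wA wq] vw] := @frQ_ex 1 (chd (v1 : gr 1)).
  + split; first exact: chd_mem.
    by rewrite (@symFG_chd 1) // v1y chdd.
  + by rewrite chdd; exact: sf0.
  have [xi xiE] := fr_lift vw.
  have vwE : chd (v1 - w : gr 1) = val xi by rewrite xiE chdB.
  exists xi.
    by apply: val_inj; rewrite val_chd -vwE chdd.
  exists (v1 - w); split=> //; first exact: sfB.
  by exists y; rewrite // symFGBA // wq subr0.
move=> xi t [v [vA dv [y yv <-]]]; split=> [[eta etaE]|y0].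
  have etaF : sub_fr G _ (val eta : gr 1) by exact: valP.
  have [||v' vA' dv'] := @af_ex 0 (v - val eta).
  - by apply: sfB => //; exact: fr_AF.
  - by rewrite chdB dv -val_chd etaE subrr.
  (* F_ab (x) G_ab has no cocycle in degree 0, so y comes from af and dies in G_ab (x) G_ab. *)
  have : y - symFG v' = 0.
    apply: tensFG_zero; rewrite chdB yv -(@symFG_chd 0) // dv'.
    rewrite (symFGBA vA (fr_AF etaF)) (fr_q etaF) subr0; exact: subrr.
  by move/eqP; rewrite subr_eq0 => /eqP ->; exact: projGG_symFG.
have [v' vA' v'y] := projGG_ker y0.
have dv'A : sub_af G _ (chd (v' : gr 0)) by exact: chd_mem.
have [||w [wA wq] vw] := @frQ_ex 0 (v - chd (v' : gr 0)).
- split; first exact: sfB.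
  by rewrite symFGBA // (@symFG_chd 0) // v'y yv subrr.
- by rewrite chdB chdd subr0 dv; exact: valP.
have [eta etaE] := fr_lift vw.
by exists eta; apply: val_inj; rewrite val_chd etaE chd_subl.
Qed.

(** The ladder of [cech2_corr] one degree higher: it ends in degree 1 of the constant functor, where
    there is no nonzero cocycle. *)
Lemma frF_cech3 (xi : frF G (CE X 3)) :
  chd xi = 0 -> exists eta, chd eta = xi.
Proof.
move=> Zxi; have dxi : chd (val xi : gr 3) = 0 by rewrite -val_chd Zxi.
have [v vA dv] := af_ex (fr_AF (valP xi)) dxi.
have [y yv] : exists y, @chd C X (tensFG G) 1 y = symFG v.
  by apply: tensFG_ex; rewrite -symFG_chd // dv fr_q ?(valP xi).
have y0 : projGG _ y = 0.
  by apply: tensGG_zero; rewrite -projGG_chd yv; exact: projGG_symFG.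
have [v' vA' v'y] := projGG_ker y0.
have dv'A : sub_af G _ (chd (v' : gr 1)) by exact: chd_mem.
have [||w [wA wq] vw] := @frQ_ex 1 (v - chd (v' : gr 1)).
- split; first exact: sfB.
  by rewrite symFGBA // (@symFG_chd 1) // v'y yv subrr.
- by rewrite chdB chdd subr0 dv; exact: valP.
have [eta etaE] := fr_lift vw.
by exists eta; apply: val_inj; rewrite val_chd etaE chd_subl.
Qed.

(* Degree one: the cocycles are computed by the elements of [a f] whose two
   images in the coproduct differ by an element of [fr]. *)
Definition cech1_cocycle (v : gr 0) := sub_af G _ v /\ sub_fr G _ (chd v).
Definition cech1_rel (xi : frF G (CE X 1)) (v : gr 0) :=
  sub_af G _ v /\ chd v = val xi.

Lemma cech1_corr : corr (@cechZ C X (frF G) 1) (@cechB C X (frF G) 0)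
  cech1_cocycle (fun v => sub_fr G _ v) cech1_rel.
Proof.
split.
- move=> xi xi' v v' [vA dv] [vA' dv']; split; first exact: sfB.
  by rewrite chdB dv dv'.
- move=> xi Zxi.
  have dxi : chd (val xi : gr 1) = 0 by rewrite -val_chd Zxi.
  have [v vA dv] := af_ex (fr_AF (valP xi)) dxi.
  by exists v => //; split=> //; rewrite dv; exact: valP.
- move=> v [vA dv]; have [xi xiE] := fr_lift dv.
  exists xi; last by split.
  by apply: val_inj; rewrite val_chd xiE chdd.
move=> xi v [vA dv]; split=> [[eta etaE]|vF].
  suff -> : v = val eta by exact: valP.
  apply/eqP; rewrite -subr_eq0; apply/eqP; apply: af_zero.
    by apply: sfB => //; exact: fr_AF (valP eta).
  by rewrite chdB dv -val_chd etaE subrr.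
have [eta etaE] := fr_lift vF.
by exists eta; apply: val_inj; rewrite val_chd etaE dv.
Qed.

(** [symFG v] is a degree 0 cocycle of F_ab (x) G_ab, hence 0. Thus the degree 1 cohomology of fr is
    the degree 0 cohomology of q / fr. *)
Lemma cech1_cocycle_Q v : cech1_cocycle v -> sub_q G _ v.
Proof.
move=> [vA dv]; split=> //; apply: tensFG_zero.
by rewrite -(@symFG_chd 0) // fr_q.
Qed.
End LowDegrees.

(** * The quotient q / w and the torsion product *)

Section TorCompute.
Variables (G : grp) (c : pres G).
Notation f := (augI c).
Notation ff := (f * f)%I.
Notation a := (relI c + augI c * augI c)%I.
Notation af := (a * f)%I.
Notation A := (ab G).
Notation P0 := (tor_P0 A).
Notation P1 := (tor_P1 A).
Notation d0 := (tor_d0 A).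
Notation d1 := (tor_d1 A).
Notation d2 := (tor_d2 A).
Notation K1 := (subz (kerz d0)).

(** F_ab is free abelian, so F_ab -> G_ab lifts through P0 -> G_ab; a basis element goes to the
    generator named by its class. *)
Lemma ab_P0_ex : exists ab_P0 : {additive ab c -> P0},
  forall u, d0 (ab_P0 (gab u)) = gabG u.
Proof.
have [u uB _] := basisP (fun b : c => MulZ (<< ab_pi (pproj c b) >> : P0)).
pose h x := mulz_val (u x).
have hM x y : h (x * y)%g = h x + h y by rewrite /h gmulfM.
have [ab_P0 ab_P0E] := ab_lift hM.
exists ab_P0 => v; rewrite gabGE.
elim/ab_ind: (gab v) => x; rewrite ab_P0E ab_map_pi.
apply: (basis_add_ext (h := fun x => d0 (h x))
  (h' := fun x => ab_pi (pproj c x))) => [y z|y z|b Bb].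
- by rewrite hM raddfD.
- by rewrite gmulfM ab_piD.
by rewrite /h uB //= fliftU.
Qed.

Definition ab_P0 := projT1 (cid ab_P0_ex).
Lemma ab_P0E u : d0 (ab_P0 (gab u)) = gabG u.
Proof. by rewrite /ab_P0; case: cid. Qed.

Definition glift (s : A) : gring c := s2val (cid2 (gabG_surj c s)).
Definition lift_P0 : {additive P0 -> gring c} := flift glift.

Lemma lift_P0U s : lift_P0 << s >> = glift s. Proof. exact: fliftU. Qed.

Lemma lift_P0_f p : lift_P0 p \in f.
Proof.
apply: (malg_int_ind (A := preimz lift_P0 f)) => s.
rewrite -[_ \in _]/(lift_P0 << s >> \in f) lift_P0U /glift.
by case: cid2.
Qed.
Lemma gabG_lift_P0 p : gabG (lift_P0 p) = d0 p.
Proof.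
pose g : {additive P0 -> A} := ab_map (pproj c) \o (@gab c \o lift_P0).
rewrite gabGE; apply: (malg_int_ext (f := g) (g := d0)) => s.
rewrite -[LHS]/(ab_map (pproj c) (gab (lift_P0 << s >>))) -gabGE lift_P0U.
by rewrite /glift; case: cid2 => u _ /= ->; exact/esym/fliftU.
Qed.

(** An element of a dies in G_ab, so its image in P0 lies in [K1]; the default 0 is never met on
    a. *)
Definition rel_K1 (u : gring c) : K1 := insubd (0 : K1) (ab_P0 (gab u)).

Lemma rel_K1E u : u \in a -> val (rel_K1 u) = ab_P0 (gab u).
Proof.
move=> ua; have p : ab_P0 (gab u) \in kerz d0 by rewrite kerE ab_P0E (gabG_a ua).
by rewrite /rel_K1 val_insubd p.
Qed.

Lemma rel_K1B x y : x \in a -> y \in a -> rel_K1 (x - y) = rel_K1 x - rel_K1 y.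
Proof.
move=> xa ya; apply: val_inj.
have -> : val (rel_K1 x - rel_K1 y) = val (rel_K1 x) - val (rel_K1 y).
  exact: raddfB.
by rewrite (rel_K1E xa) (rel_K1E ya) rel_K1E ?rpredB // gabB (raddfB ab_P0).
Qed.
Lemma rel_K1_ff u : u \in ff -> rel_K1 u = 0.
Proof.
by move=> uff; apply: val_inj; rewrite rel_K1E ?(ff_a uff) // gab_ff // raddf0.
Qed.

Lemma symKG_ex : exists Phi : gring c -> tens K1 A,
  (forall x y, x \in af -> y \in af -> Phi (x - y) = Phi x - Phi y) /\
  (forall u w, u \in a -> w \in f -> Phi (u * w) = pure (rel_K1 u) (gabG w)).
Proof.
have [||Phi [PB PE]] := @fox_tens G c a _ rel_K1.
- by move=> x s; exact: aM_r.
- exact: rel_K1B.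
exists (fun x => tens_map idfun (ab_map (pproj c)) (Phi x)).
split=> [x y xf yf|u w ua wf]; first by rewrite PB // raddfB.
rewrite PE // => [|w' w'f]; first by rewrite tens_map_pure gabGE.
by apply/rel_K1_ff/mem_idmul => //; exact: a_f.
Qed.

Definition symKG := projT1 (cid symKG_ex).
Lemma symKGB x y : x \in af -> y \in af -> symKG (x - y) = symKG x - symKG y.
Proof. by rewrite /symKG; case: cid => P [/= PB _]; exact: PB. Qed.
Lemma symKGM u w : u \in a -> w \in f ->
  symKG (u * w) = pure (rel_K1 u) (gabG w).
Proof. by rewrite /symKG; case: cid => P [/= _]; exact. Qed.
Lemma symKG0 : symKG 0 = 0.
Proof. by have := symKGB (rpred0 af) (rpred0 af); rewrite !subrr. Qed.

Definition K1val : {additive K1 -> P0} :=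
  mkadd (f := @subz_val _ (kerz d0)) (fun x y => raddfB val x y).
Definition d1K : {additive P1 -> K1} := flift (@id K1).

Lemma d1KE p : K1val (d1K p) = d1 p.
Proof.
apply: (malg_int_ext (f := K1val \o d1K) (g := d1)) => k.
by rewrite /= !fliftU.
Qed.

Definition P1_K1 : {additive tens P1 A -> tens K1 A} := tens_map d1K idfun.
Definition K1_P0 : {additive tens K1 A -> tens P0 A} := tens_map K1val idfun.

Lemma P1_K1_pure p b : P1_K1 (pure p b) = pure (d1K p) b.
Proof. exact: (tens_map_pure d1K idfun p b). Qed.
Lemma K1_P0_pure k b : K1_P0 (pure k b) = pure (K1val k) b.
Proof. exact: (tens_map_pure K1val idfun k b). Qed.

Lemma K1_P0_P1_K1 m : K1_P0 (P1_K1 m) = tens_map d1 idfun m.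
Proof.
apply: (tens_ext (g := K1_P0 \o P1_K1) (g' := tens_map d1 idfun)) => p b.
rewrite -[LHS]/(K1_P0 (P1_K1 (pure p b))) P1_K1_pure K1_P0_pure d1KE.
by rewrite (tens_map_pure d1 idfun).
Qed.

Lemma d1KU k : d1K << k >> = k. Proof. exact: fliftU. Qed.

Lemma P1_K1_surj n : exists m, P1_K1 m = n.
Proof.
elim/tens_ind: n => [|x y [u <-] [v <-]|k b].
- by exists 0; rewrite raddf0.
- by exists (u - v); rewrite raddfB.
exists (pure << k >> b).
by rewrite P1_K1_pure d1KU.
Qed.

Lemma d2U k : d2 << k >> = subz_val k. Proof. exact: fliftU. Qed.

(** Right exactness of P2 (x) A -> P1 (x) A -> K1 (x) A -> 0. It turns Tor into the kernel of K1 (x)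
    A -> P0 (x) A. *)
Lemma P1_K1_ker m : P1_K1 m = 0 <-> m \in imz (tens_map d2 (@idfun A)).
Proof.
split=> [m0|/imP[x <-]]; last first.
  elim/tens_ind: x => [|x y xP yP|p b]; first by rewrite !raddf0.
    by rewrite !raddfB xP yP subrr.
  rewrite (tens_map_pure d2 idfun) P1_K1_pure.
  suff -> : d1K (d2 p) = 0 by rewrite pure0l.
  apply: (malg_int_ext (f := d1K \o d2) (g := \0)) => k.
  rewrite -[LHS]/(d1K (d2 << k >>)) d2U; apply: val_inj.
  rewrite -[LHS]/(K1val (d1K _)) d1KE.
  by apply/eqP; rewrite -kerE; exact: subz_valP.
pose Q := {ideal_quot imz (tens_map d2 (@idfun A))}.
have [||||||||||g gP] := @tens_descent P1 A K1 A Q (fun=> True) (fun=> True)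
  d1K id (fun p b => \pi_Q (pure p b)) => //.
- by move=> x z _ _; rewrite raddfB.
- by move=> k; exists << k >>; rewrite ?d1KU.
- by move=> b; exists b.
- by move=> s s' t _ _ _; rewrite pureBl raddfB.
- by move=> s t t' _ _ _; rewrite pureBr raddfB.
- move=> p b _ _ p0; rewrite -(raddf0 \pi_Q).
  apply/ideal_quot_eq; rewrite subr0; apply/imP.
  have pk : p \in kerz d1 by rewrite kerE -d1KE p0 raddf0.
  exists (pure << Subz pk >> b).
  by rewrite (tens_map_pure d2 idfun << Subz pk >> b) d2U.
- by move=> p b _ _ ->; rewrite pure0r raddf0.
have E : g (P1_K1 m) = \pi_Q m.
  elim/tens_ind: m {m0} => [|x z xP zP|s t]; first by rewrite !raddf0.
    by rewrite (raddfB P1_K1) (raddfB g) xP zP; exact/esym/raddfB.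
  by rewrite P1_K1_pure gP.
move: E; rewrite m0 raddf0 -(raddf0 \pi_Q).
by move=> /esym/ideal_quot_eq; rewrite subr0.
Qed.

(** Consequently [symKG] maps q, where [symFG] vanishes, into the kernel of K1 (x) A -> P0 (x) A. *)
Lemma K1_P0_symKG v : v \in af ->
  K1_P0 (symKG v) = tens_map ab_P0 idfun (symFG v).
Proof.
move=> vaf.
suff [] : v \in f /\ K1_P0 (symKG v) = tens_map ab_P0 idfun (symFG v) by [].
move: v vaf; apply: idmul_ind => [|x y xA yA [xf xP] [yf yP]|u w ua wf].
- by split; rewrite ?rpred0 // symKG0 symFG0 !raddf0.
- split; first exact: rpredB.
  by rewrite symKGB // symFGB // !raddfB xP yP.
split; first exact/augIM_l.
rewrite symKGM // symFGM ?(a_f ua) // K1_P0_pure (tens_map_pure ab_P0 idfun).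
by rewrite -[K1val _]/(val (rel_K1 u)) rel_K1E.
Qed.

(** The homotopy between P0 -> F_ab -> P0 and the identity; its values lie in [K1] because both maps
    cover the identity of G_ab. *)
Definition rho_fun (p : P0) : P0 := ab_P0 (gab (lift_P0 p)) - p.
Lemma rho_mem p : rho_fun p \in kerz d0.
Proof. by rewrite kerE raddfB ab_P0E gabG_lift_P0 subrr. Qed.
Lemma rho_zmod : zmod_morphism (fun p => Subz (rho_mem p)).
Proof.
move=> p q; apply: val_inj; rewrite raddfB /= /rho_fun.
by rewrite (raddfB lift_P0) gabB (raddfB ab_P0) subrACA.
Qed.
Definition rho : {additive P0 -> K1} := mkadd rho_zmod.
Definition gab_lift_P0 : {additive P0 -> ab c} := @gab c \o lift_P0.

(** The error term and [symFG v] both factor through K1 (x) A -> P0 (x) A. They vanish on its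
    kernel, so every class of Tor comes from an element of q. *)
Lemma symKG_approx n : exists v, [/\ v \in af,
  symKG v = n + tens_map rho idfun (K1_P0 n) &
  symFG v = tens_map gab_lift_P0 idfun (K1_P0 n)].
Proof.
elim/tens_ind: n => [|x y [u [uA uP uq]] [v [vA vP vq]]|k b].
- by exists 0; rewrite rpred0 symKG0 symFG0 !raddf0 addr0.
- exists (u - v); split; first exact: rpredB.
    rewrite symKGB // uP vP (raddfB K1_P0) raddfB /=.
    by rewrite opprD addrACA.
  by rewrite symFGB ?(af_f uA) ?(af_f vA) // uq vq !raddfB.
have [w wf <-] := gabG_surj c b.
have sa : lift_P0 (K1val k) \in a.
  apply: gabG_eq0; first exact: lift_P0_f.
  by rewrite gabG_lift_P0; apply/eqP; rewrite -kerE; exact: subz_valP.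
exists (lift_P0 (K1val k) * w); split; first exact: mem_idmul.
  rewrite symKGM // K1_P0_pure (tens_map_pure rho idfun) -pureDl.
  suff -> : rel_K1 (lift_P0 (K1val k)) = k + rho (K1val k) by [].
  apply: val_inj; rewrite rel_K1E // (raddfD val) addrC; exact/esym/subrK.
by rewrite symFGM ?lift_P0_f // K1_P0_pure (tens_map_pure gab_lift_P0 idfun).
Qed.

Lemma symKG_w v : v \in wI c -> symKG v = 0.
Proof.
move=> vw; suff [] : v \in af /\ symKG v = 0 by [].
move: v vw; apply: idadd_ind => [x y [xf xP] [yf yP]|v vaa|v vfff].
- by split; [exact: rpredB | rewrite symKGB // xP yP subrr].
- split; first exact: aa_af.
  move: v vaa; apply: idmul_ind => [|x y /aa_af xf /aa_af yf xP yP|x y xa ya].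
  + exact: symKG0.
  + by rewrite symKGB // xP yP subrr.
  by rewrite symKGM ?(a_f ya) // (gabG_a ya) pure0r.
split; first exact: fff_af.
move: v vfff; apply: idmul_ind => [|x y /fff_af xf /fff_af yf xP yP|x y xa ya].
+ exact: symKG0.
+ by rewrite symKGB // xP yP subrr.
by rewrite symKGM ?(ff_a xa) // rel_K1_ff // pure0l.
Qed.

(** Modulo w, v is recovered as z (symKG v) - mu (symFG v), where z multiplies a lift of k in [K1]
    by w, and mu accounts for the difference between u and the lift of its image in P0. *)
Lemma symKG_ker v : v \in af -> symFG v = 0 -> symKG v = 0 -> v \in wI c.
Proof.
move=> vA vq vP.
pose Q := {ideal_quot wI c}.
have [||||||||||z zP] := @tens_descent K1 (gring c) K1 A Q (fun=> True)
  (fun w => w \in f) id (@gabG G c)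
  (fun k w => \pi_Q (lift_P0 (K1val k) * w)) => //.
- by move=> x y; exact: rpredB.
- by move=> x y _ _; exact: gabGB.
- by move=> k; exists k.
- exact: gabG_surj.
- by move=> k k' w _ _ _; rewrite !raddfB mulrBl raddfB.
- by move=> k w w' _ _ _; rewrite mulrBr raddfB.
- by move=> k w _ _ ->; rewrite !raddf0 mul0r raddf0.
- move=> k w _ wf /(gabG_eq0 wf) wa; rewrite -(raddf0 \pi_Q).
  apply/ideal_quot_eq; rewrite subr0; apply/mem_idaddl/mem_idmul => //.
  apply: gabG_eq0; first exact: lift_P0_f.
  by rewrite gabG_lift_P0; apply/eqP; rewrite -kerE; exact: subz_valP.
(* The homotopy on the side of F: it sends f into a, and ff into itself. *)
pose m u : gring c := lift_P0 (ab_P0 (gab u)) - u.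
have mB x y : m (x - y) = m x - m y.
  by rewrite /m gabB (raddfB ab_P0) (raddfB lift_P0) subrACA.
have mf u : u \in f -> m u \in a.
  move=> uf; apply: gabG_eq0; first by apply: rpredB => //; exact: lift_P0_f.
  by rewrite gabGB gabG_lift_P0 ab_P0E subrr.
have [||||||||||mu muP] := @tens_descent (gring c) (gring c) (ab c) A Q
  (fun u => u \in f) (fun w => w \in f) (@gab c) (@gabG G c)
  (fun u w => \pi_Q (m u * w)).
- by move=> x y; exact: rpredB.
- by move=> x y; exact: rpredB.
- by move=> x y _ _; exact: gabB.
- by move=> x y _ _; exact: gabGB.
- exact: gab_surj.
- exact: gabG_surj.
- by move=> u u' w _ _ _; rewrite mB mulrBl raddfB.
- by move=> u w w' _ _ _; rewrite mulrBr raddfB.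
- move=> u w uf wf u0; have uff := gab_eq0 uf u0.
  rewrite -(raddf0 \pi_Q).
  apply/ideal_quot_eq; rewrite subr0 /m u0 !raddf0 sub0r mulNr rpredN.
  exact/mem_idaddr/mem_idmul.
- move=> u w uf wf /(gabG_eq0 wf) wa; rewrite -(raddf0 \pi_Q).
  apply/ideal_quot_eq; rewrite subr0; apply/mem_idaddl/mem_idmul => //.
  exact: mf.
suff E : z (symKG v) - mu (symFG v) = \pi_Q v.
  move: E; rewrite vP vq (raddf0 z) (raddf0 mu) subr0 -(raddf0 \pi_Q).
  by move=> /esym/ideal_quot_eq; rewrite subr0.
suff [] : v \in f /\ z (symKG v) - mu (symFG v) = \pi_Q v by [].
move: v vA {vq vP}.
apply: idmul_ind => [|x y xA yA [xf xP] [yf yP]|u w ua wf].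
- by rewrite rpred0 symKG0 symFG0 (raddf0 z) (raddf0 mu) (raddf0 \pi_Q) subr0.
- split; first exact: rpredB.
  rewrite symKGB // symFGB // (raddfB z) (raddfB mu) subrACA xP yP.
  exact/esym/raddfB.
split; first exact/augIM_l.
rewrite symKGM // symFGM ?(a_f ua) // zP // muP ?(a_f ua) //.
rewrite -[K1val _]/(val (rel_K1 u)) rel_K1E // -raddfB /=.
by apply/ideal_quot_eq; rewrite /m mulrBl subKr subrr rpred0.
Qed.

Definition tor_rel (v : gring c) (m : tens P1 A) :=
  v \in af /\ symKG v = P1_K1 m.

Lemma tor_relB v v' m m' :
  tor_rel v m -> tor_rel v' m' -> tor_rel (v - v') (m - m').
Proof.
move=> [vA vm] [vA' vm']; split; first exact: rpredB.
by rewrite symKGB // vm vm' raddfB.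
Qed.

Lemma tor_rel_tot v : v \in af -> symFG v = 0 ->
  exists2 m, m \in kerz (tens_map d1 (@idfun A)) & tor_rel v m.
Proof.
move=> vA vq; have [m mv] := P1_K1_surj (symKG v); exists m; last by split.
by rewrite kerE -K1_P0_P1_K1 mv K1_P0_symKG // vq raddf0.
Qed.

Lemma tor_rel_surj m : m \in kerz (tens_map d1 (@idfun A)) ->
  exists v, [/\ v \in af, symFG v = 0 & tor_rel v m].
Proof.
rewrite kerE -K1_P0_P1_K1 => /eqP im.
have [v [vA vP vq]] := symKG_approx (P1_K1 m).
rewrite im !raddf0 addr0 in vP vq.
by exists v; split.
Qed.

Lemma tor_rel_bound v m : symFG v = 0 -> tor_rel v m ->
  v \in wI c <-> m \in imz (tens_map d2 (@idfun A)).
Proof.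
move=> vq [vA vm]; split=> [vw|/P1_K1_ker m0].
  by apply/P1_K1_ker; rewrite -vm symKG_w.
by apply: symKG_ker; rewrite ?vm.
Qed.
End TorCompute.

Lemma pres_mor (G : grp) (c d : pres G) : exists f : pmor idfun c d, True.
Proof.
have [u uB _] := basisP (fun x : c => projT1 (cid (pproj_surj d (pproj c x)))).
have uP x : pproj d (u x) = pproj c x.
  apply: (basis_ext (u := gcomp u (pproj d))) => b Bb.
  by rewrite gcompE uB //; case: cid.
by exists (PMor uP).
Qed.

(** * Constancy of aa / fr *)

Section SqFr.
Variable G : grp.
Notation C := (pres_cat G).

Lemma sqfr_const (c d : C) (f g : chom c d) (u : sqfrF G c) :
  ahom (sqfrF G) f u = ahom (sqfrF G) g u.
Proof.
elim/subquot_ind: u => x.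
rewrite -[LHS]/(sqfr_map (phi := idfun) f (subquot_pi _ x)).
rewrite -[RHS]/(sqfr_map (phi := idfun) g (subquot_pi _ x)).
rewrite !subquot_map_pi; apply/subquot_eq.
exact: sq_const (subz_valP x).
Qed.

Lemma sqfr_bij (c d : C) (f : chom c d) : bijective (ahom (sqfrF G) f).
Proof.
have [g _] := pres_mor d c.
exists (ahom (sqfrF G) (g : chom d c)) => u.
  by rewrite -ahom_comp (sqfr_const _ (idc c)) ahom_id.
by rewrite -ahom_comp (sqfr_const _ (idc d)) ahom_id.
Qed.

Definition to_base (c : C) : chom c (base_pres G) :=
  projT1 (cid (pres_mor c (base_pres G))).

Definition to_base_nat :
  abnat (sqfrF G) (abconst C (sqfrF G (base_pres G))).
Proof.
apply: (@AbNat C (sqfrF G) (abconst C (sqfrF G (base_pres G)))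
  (fun c => ahom (sqfrF G) (to_base c))) => c d f x.
by rewrite -ahom_comp; exact: sqfr_const.
Defined.

Lemma sqfr_is_constant : is_constant (sqfrF G).
Proof.
by exists (sqfrF G (base_pres G)), to_base_nat => c; exact: sqfr_bij.
Qed.
End SqFr.

(** * The derived limits of fr in degrees one to three *)

Section Lim.
Variables (G : grp) (R : injres (frF G)).
Notation C := (pres_cat G).
Notation X := (pres_copr G).
Notation L := (lim_complex R).

Lemma limZP k x : x \in kerz (cd L k) <-> @limZ C (frF G) R k x.
Proof. by rewrite kerE; split=> /eqP. Qed.
Lemma limBP k x : x \in bound L k.+1 <-> @limB C (frF G) R k x.
Proof. exact: imP. Qed.

Lemma rlim3_eq0 (x : rlim R 3) : x = 0.
Proof.
elim/subquot_ind: x => x; have /limZP Zx := subz_valP x.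
have [B1 T1 S1 b1] := @stair3_corr C X (frF G) R.
have [xi Zxi xxi] := T1 _ Zx.
rewrite -(raddf0 (@subquot_pi _ (kerz (cd L 3)) (bound L 3))).
apply/subquot_eq; rewrite [val 0]raddf0 subr0; apply/limBP/(b1 _ _ xxi).
exact: frF_cech3.
Qed.

Definition lim1_rel := fun (x : L 1) (v : gringF G (CE X 0)) =>
  exists2 xi, stair1 (X := X) x xi & cech1_rel xi v.
Lemma lim1_corr : corr (@limZ C (frF G) R 1) (@limB C (frF G) R 0)
  (@cech1_cocycle G) (fun v => sub_fr G (CE X 0) v) lim1_rel.
Proof. exact: corr_comp (@stair1_corr C X _ R) (@cech1_corr G). Qed.

Definition lim2_rel := fun (x : L 2) (t : tens (ab G) (ab G)) =>
  exists2 xi, stair2 (X := X) x xi & cech2_rel xi t.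
Lemma lim2_corr : corr (@limZ C (frF G) R 2) (@limB C (frF G) R 1)
  (fun=> True) (fun t => t = 0) lim2_rel.
Proof. exact: corr_comp (@stair2_corr C X _ R) (@cech2_corr G). Qed.

Lemma rlim2_iso : exists al : {additive rlim R 2 -> tens (ab G) (ab G)},
  bijective al /\ forall (x : subz (kerz (cd L 2))) t,
    lim2_rel (val x) t -> al (subquot_pi (bound L 2) x) = t.
Proof.
have [B1 T1 S1 b1] := lim2_corr.
have [| x /limZP/T1[t _ xt]|x t /limBP xB xt|al alP] :=
  @subquot_rel_map _ _ (kerz (cd L 2)) (bound L 2) lim2_rel.
- exact: B1.
- by exists t.
- exact/(b1 _ _ xt).
exists al; split=> //.
have al_inj : injective al.
  apply: raddf_inj; elim/subquot_ind => x.
  have [t _ xt] := T1 _ ((limZP _).1 (subz_valP x)).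
  rewrite (alP _ _ xt) => t0.
  rewrite -(raddf0 (@subquot_pi _ (kerz (cd L 2)) (bound L 2))).
  apply/subquot_eq; rewrite [val 0]raddf0 subr0; apply/limBP/(b1 _ _ xt).
  exact: t0.
have al_surj t : exists x, al x = t.
  have [x Zx xt] := S1 t I.
  exists (subquot_pi (bound L 2) (Subz ((limZP _).2 Zx))).
  exact: alP.
pose be t := projT1 (cid (al_surj t)).
have beK t : al (be t) = t by rewrite /be; case: cid.
by exists be => // x; apply: al_inj; rewrite beK.
Qed.

(** The connecting map of fr < aa: by [sq_const] the differential of any s in aa lies in fr, so s
    itself is a cocycle in the sense of [cech1_cocycle]. *)
Lemma iota_ex : exists ie : {additive sqfrF G (base_pres G) -> rlim R 1},
  forall (s : subz (sqI (base_pres G))) (x : subz (kerz (cd L 1))),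
    lim1_rel (val x) (val s) ->
    ie (subquot_pi _ s) = subquot_pi (bound L 1) x.
Proof.
have [B1 T1 S1 b1] := lim1_corr.
pose Rel (s : gring (base_pres G)) (y : rlim R 1) :=
  exists2 x : subz (kerz (cd L 1)), lim1_rel (val x) s & y = subquot_pi _ x.
have [|s sS|s y sF [x xs ->]|ie ieP] := @subquot_rel_map _ _
  (sqI (base_pres G)) (frI (base_pres G)) Rel.
- move=> s s' y y' [x xs ->] [x' xs' ->]; exists (x - x').
    by rewrite [val _]raddfB; exact: B1.
  by rewrite subquot_piB.
- have [|x Zx xs] := S1 s.
    by split; [exact: aa_af | exact: sq_const].
  exists (subquot_pi (bound L 1) (Subz ((limZP _).2 Zx))).
  by exists (Subz ((limZP _).2 Zx)).
- rewrite -(raddf0 (@subquot_pi _ (kerz (cd L 1)) (bound L 1))).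
  apply/subquot_eq; rewrite [val 0]raddf0 subr0; apply/limBP/(b1 _ _ xs).
  exact: sF.
by exists ie => s x xs; apply: ieP; exists x.
Qed.

(** A class of degree 1 is represented by some v in q, and is sent to the class of v in q / w. *)
Lemma tor_map_ex : exists p : {additive rlim R 1 -> Tor (ab G) (ab G)},
  forall (x : subz (kerz (cd L 1))) v m, lim1_rel (val x) v ->
    tor_rel (c := base_pres G) v (val m) ->
    p (subquot_pi _ x) = subquot_pi _ m.
Proof.
have [B1 T1 S1 b1] := lim1_corr.
pose KT := kerz (tens_map (tor_d1 (ab G)) (@idfun (ab G))).
pose BT := imz (tens_map (tor_d2 (ab G)) (@idfun (ab G))).
pose Rel (x : L 1) (t : Tor (ab G) (ab G)) :=
  exists2 v, lim1_rel x v & exists2 m : subz KT,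
    tor_rel (c := base_pres G) v (val m) & t = subquot_pi BT m.
have [|x /limZP/T1[v Zv xv]|x t xB [v xv [m vm ->]]|p pP] :=
  @subquot_rel_map _ _ (kerz (cd L 1)) (bound L 1) Rel.
- move=> x x' t t' [v xv [m vm ->]] [v' xv' [m' vm' ->]].
  exists (v - v'); first exact: B1.
  exists (m - m'); last by rewrite subquot_piB.
  by rewrite [val _]raddfB; exact: tor_relB.
- have [vA vq] := cech1_cocycle_Q Zv.
  have [m mK vm] := tor_rel_tot vA vq.
  exists (subquot_pi BT (Subz mK)); exists v => //.
  by exists (Subz mK).
- have vF : v \in frI (base_pres G) by apply/(b1 _ _ xv)/limBP.
  rewrite -(raddf0 (@subquot_pi _ KT BT)).
  apply/subquot_eq; rewrite [val 0]raddf0 subr0.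
  apply/(tor_rel_bound _ vm); first exact: fr_q.
  by apply: mem_idaddl; exact: fr_aa.
by exists p => x v m xv vm; apply: pP; exists v => //; exists m.
Qed.

Lemma racyc_fr_w n : racyc X (sub_fr G) (sub_w G) n.+1.
Proof.
apply: (racyc_trans (S' := sub_sq G)); last exact: racyc_sq_w.
- by move=> c x; exact: fr_aa.
- by move=> c x; exact: mem_idaddl.
exact: racyc_fr_sq.
Qed.

Lemma rlim1_exact : exists (ie : {additive sqfrF G (base_pres G) -> rlim R 1})
    (p : {additive rlim R 1 -> Tor (ab G) (ab G)}),
  [/\ injective ie, (forall u, exists x, p x = u) &
      forall x, p x = 0 <-> exists q, ie q = x].
Proof.
have [B1 T1 S1 b1] := lim1_corr.
have [ie ieP] := iota_ex; have [p pP] := tor_map_ex.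
pose KT := kerz (tens_map (tor_d1 (ab G)) (@idfun (ab G))).
have ieE (s : subz (sqI (base_pres G))) :
    exists2 x : subz (kerz (cd L 1)), lim1_rel (val x) (val s) &
      ie (subquot_pi _ s) = subquot_pi (bound L 1) x.
  have [|x Zx xs] := S1 (val s).
    by split; [exact: aa_af (subz_valP s) | exact: sq_const (subz_valP s)].
  exists (Subz ((limZP _).2 Zx)) => //; exact: ieP.
have pE (x : subz (kerz (cd L 1))) : exists v, exists2 m : subz KT,
    [/\ lim1_rel (val x) v, cech1_cocycle v &
        tor_rel (c := base_pres G) v (val m)] &
    p (subquot_pi _ x) = subquot_pi _ m.
  have [v Zv xv] := T1 _ ((limZP _).1 (subz_valP x)).
  have [vA vq] := cech1_cocycle_Q Zv.
  have [m mK vm] := tor_rel_tot vA vq.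
  by exists v; exists (Subz mK); [split | exact: (pP x v (Subz mK))].
exists ie, p; split.
- apply: raddf_inj; elim/subquot_ind => s; have [x xs ->] := ieE s.
  rewrite -(raddf0 (@subquot_pi _ (kerz (cd L 1)) (bound L 1))).
  move=> /subquot_eq; rewrite [val 0]raddf0 subr0 => /limBP/(b1 _ _ xs) sF.
  rewrite -(raddf0 (@subquot_pi _ (sqI (base_pres G)) (frI (base_pres G)))).
  by apply/subquot_eq; rewrite [val 0]raddf0 subr0.
- elim/subquot_ind => m.
  (* The differential of v0 lies in w, not yet in fr. As w / fr has no cohomology in degree 1,
     subtracting some element of w repairs this, and such an element has class 0 in Tor. *)
  have [v0 [v0A v0q v0m]] := tor_rel_surj (base_pres G) (subz_valP m).
  have dv0 : sub_w G _ (chd (X := X) (n := 0) (v0 : gringF G (CE X 0))).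
    exact: q_const.
  have [|w wW vw] := @racyc_fr_w 0 _ dv0; first by rewrite chdd; exact: sf0.
  have wq : symFG w = 0 by exact: symFG_w.
  have [m' m'K wm'] := tor_rel_tot (w_af wW) wq.
  have [|x Zx xv] := S1 (v0 - w).
    split; first by apply: sfB => //; exact: w_af.
    by rewrite chdB.
  exists (subquot_pi (bound L 1) (Subz ((limZP _).2 Zx))).
  rewrite (@pP _ (v0 - w) (m - Subz m'K)) //; last first.
    by rewrite [val _]raddfB; exact: tor_relB.
  apply/subquot_eq; rewrite [val _]raddfB addrAC subrr sub0r rpredN.
  exact/(tor_rel_bound wq wm').
elim/subquot_ind => x; have [v [m [xv Zv vm] ->]] := pE x.
have [vA vq] := cech1_cocycle_Q Zv.
rewrite -(raddf0 (@subquot_pi _ (kerz (tens_map (tor_d1 (ab G)) (@idfun (ab G))))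
  (imz (tens_map (tor_d2 (ab G)) (@idfun (ab G)))))).
split=> [/subquot_eq|[q]].
  rewrite [val 0]raddf0 subr0 => /(tor_rel_bound vq vm) vW.
  (* v lies in w and its differential in fr, hence in aa; w / aa has no cocycle in degree 0. *)
  have vaa : v \in sqI (base_pres G).
    apply: (@racyc_sq_w G 0 v vW).
    by case: Zv => _; exact: fr_aa.
  by exists (subquot_pi _ (Subz vaa)); exact: ieP.
elim/subquot_ind: q => s; have [x' x's ->] := ieE s => /subquot_eq xx'.
apply/subquot_eq; rewrite [val 0]raddf0 subr0.
apply/(tor_rel_bound vq vm).
have vs : v - val s \in frI (base_pres G).
  apply/(b1 _ _ (B1 _ _ _ _ xv x's)); apply/limBP.
  by rewrite -rpredN opprB.
rewrite -[v](subrK (val s)); apply: rpredD.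
  by apply: mem_idaddl; exact: fr_aa.
by apply: mem_idaddl; exact: (subz_valP s).
Qed.
End Lim.

(** * aa / fr as a quotient of the tensor square of g^2 *)

Section SquareQuotient.
Variables (G : grp) (c : pres G).
Notation a := (relI c + augI c * augI c)%I.

Lemma pproj_aug2 x : x \in a -> gring_map (pproj c) x \in aug2I G.
Proof.
move: x; apply: idadd_ind => [x y xP yP|x|x].
- by rewrite gring_mapB rpredB.
- by rewrite mem_relI => /eqP ->; exact: rpred0.
by apply: idmul_map; exact: augI_map.
Qed.

Definition pproj2 : {additive subz a -> subz (aug2I G)} := subz_map pproj_aug2.

Lemma gring_pproj_surj (x : gring G) : exists u, gring_map (pproj c) u = x.
Proof.
elim/gring_indP: x => [|x y [u <-] [v <-]|g].
- by exists 0; exact: gring_map0.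
- by exists (u - v); rewrite gring_mapB.
by have [x <-] := pproj_surj c g; exists (gel x); rewrite gring_mapU.
Qed.

Lemma pproj2_surj y : exists u, pproj2 u = y.
Proof.
suff E z : z \in aug2I G -> exists2 u, u \in a & gring_map (pproj c) u = z.
  have [u ua uy] := E _ (subz_valP y).
  by exists (Subz ua); apply: val_inj.
move: z; apply: idmul_ind => [|x z _ _ [u ua <-] [v va <-]|x z xf zf].
- by exists 0; rewrite ?rpred0 ?gring_map0.
- by exists (u - v); rewrite ?rpredB ?gring_mapB.
have [u ux] := gring_pproj_surj x; have [v vz] := gring_pproj_surj z.
exists (u * v); last by rewrite gring_mapM ux vz.
by apply/ff_a/mem_idmul; rewrite mem_augI -(aug_map (pproj c)) ?ux ?vz.
Qed.

Definition sqpi (u w : subz a) : subquot (sqI c) (frI c) :=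
  subquot_pi (frI c) (Subz (mem_idmul (subz_valP u) (subz_valP w))).

(** Multiplication a x a -> aa descends because a -> g^2 has kernel r and ra + ar lies in fr. It is
    balanced by associativity, scalars of Z[G] being lifted to Z[F]. *)
Lemma sq_quotient_ex :
  exists s : {additive aug2_tens G -> subquot (sqI c) (frI c)},
  forall u w, s (\pi_(aug2_tens G) (pure (pproj2 u) (pproj2 w))) = sqpi u w.
Proof.
have valB (I : zmodClosed (gring c)) (x y : subz I) :
  val (x - y) = val x - val y by exact: raddfB.
have [||||||||||g gP] := @tens_descent (subz a) (subz a) _ _
  (subquot (sqI c) (frI c)) (fun=> True) (fun=> True) pproj2 pproj2 sqpi => //.
- by move=> x y _ _; rewrite raddfB.
- by move=> x y _ _; rewrite raddfB.
- by move=> y; have [u] := pproj2_surj y; exists u.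
- by move=> y; have [u] := pproj2_surj y; exists u.
- move=> u u' w _ _ _; rewrite /sqpi -subquot_piB; congr subquot_pi.
  apply: val_inj; apply: etrans _ (esym (valB _ _ _)).
  transitivity ((val u - val u') * val w).
    by rewrite -valB.
  exact: mulrBl.
- move=> u w w' _ _ _; rewrite /sqpi -subquot_piB; congr subquot_pi.
  apply: val_inj; apply: etrans _ (esym (valB _ _ _)).
  transitivity (val u * (val w - val w')).
    by rewrite -valB.
  exact: mulrBr.
- move=> u w _ _ /(congr1 val) /= u0.
  rewrite -(raddf0 (@subquot_pi _ (sqI c) (frI c))); apply/subquot_eq.
  rewrite [val 0]raddf0 subr0; apply: ra_fr (subz_valP w).
  by rewrite mem_relI; apply/eqP.
- move=> u w _ _ /(congr1 val) /= w0.
  rewrite -(raddf0 (@subquot_pi _ (sqI c) (frI c))); apply/subquot_eq.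
  rewrite [val 0]raddf0 subr0; apply: (ar_fr (subz_valP u)).
  by rewrite mem_relI; apply/eqP.
have [x xS|s sP] :=
  @quot_lift _ _ (spanz (bal_rel (@aug2_mulr G) (@aug2_mull G))) g.
  move: x xS; apply: propz_intro => [|x y xP yP|].
  - exact: raddf0.
  - by rewrite (raddfB g) xP yP subrr.
  move=> _ [x [z [y ->]]].
  have [u <-] := pproj2_surj x; have [w <-] := pproj2_surj y.
  have [v vz] := gring_pproj_surj z.
  pose u' : subz a := Subz (aM_r v (subz_valP u)).
  pose w' : subz a := Subz (aM_l v (subz_valP w)).
  have -> : aug2_mulr (pproj2 u) z = pproj2 u'.
    by apply: val_inj; rewrite /= gring_mapM vz.
  have -> : aug2_mull z (pproj2 w) = pproj2 w'.
    by apply: val_inj; rewrite /= gring_mapM vz.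
  have E1 := gP u' w I I; have E2 := gP u w' I I.
  apply: etrans (raddfB g _ _) _.
  rewrite [X in X - _]E1 [X in _ - X]E2.
  suff -> : sqpi u' w = sqpi u w' by exact: subrr.
  by apply/subquot_eq; rewrite /= -mulrA subrr rpred0.
by exists s => u w; rewrite -gP // -sP.
Qed.

Definition sq_quotient := projT1 (cid sq_quotient_ex).
Lemma sq_quotientE u w :
  sq_quotient (\pi_(aug2_tens G) (pure (pproj2 u) (pproj2 w))) = sqpi u w.
Proof. by rewrite /sq_quotient; case: cid. Qed.

Lemma sq_quotient_surj q : exists t, sq_quotient t = q.
Proof.
elim/subquot_ind: q => -[x xS].
(* Elements of the subquotient carry their membership proof; quantifying over it makes the induction
   on products possible. *)
pose P (z : gring c) := forall zS : z \in sqI c, exists t, sq_quotient t =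
    subquot_pi (frI c) (Subz zS).
suff : P x by exact.
move: x xS; apply: (idmul_ind (P := P)) => [xS|x y xS yS xP yP zS|u w ua wa zS].
- exists 0; rewrite raddf0.
  rewrite -(raddf0 (@subquot_pi _ (sqI c) (frI c))); congr subquot_pi.
  by apply: val_inj; rewrite [LHS]raddf0.
- have [t tx] := xP xS; have [t' ty] := yP yS.
  exists (t - t'); rewrite raddfB tx ty -subquot_piB; congr subquot_pi.
  by apply: val_inj; rewrite [LHS]raddfB.
exists (\pi_(aug2_tens G) (pure (pproj2 (Subz ua)) (pproj2 (Subz wa)))).
by rewrite sq_quotientE; congr subquot_pi; apply: val_inj.
Qed.
End SquareQuotient.

Lemma gring_map_proj (G H : grp) (phi : {ghom G -> H}) (c : pres G)
    (d : pres H) (f : pmor phi c d) x :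
  gring_map (pproj d) (gring_map f x) = gring_map phi (gring_map (pproj c) x).
Proof.
elim/gring_indP: x => [|x y xP yP|g].
- by rewrite !gring_map0.
- by rewrite !gring_mapB xP yP.
by rewrite !gring_mapU pmorP.
Qed.

Lemma sq_quotient_nat (G H : grp) (phi : {ghom G -> H}) (c : pres G)
    (d : pres H) (f : pmor phi c d) (t : aug2_tens G) :
  sq_quotient d (aug2_tens_map phi t) = sqfr_map f (sq_quotient c t).
Proof.
elim/quot_ind: t => x; rewrite [aug2_tens_map phi _]quot_map_pi.
elim/tens_ind: x => [|x y xP yP|x y].
- by rewrite !raddf0.
- by rewrite !raddfB xP yP.
have [u <-] := pproj2_surj c x; have [w <-] := pproj2_surj c y.
rewrite sq_quotientE tens_map_pure.
have E (v : subz (relI c + augI c * augI c)%I) :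
    subz_map (@aug2I_map _ _ phi) (pproj2 c v) =
    pproj2 d (Subz (aI_map f (subz_valP v))).
  by apply: val_inj; rewrite /= gring_map_proj.
rewrite [X in pure X _](E u) [X in pure _ X](E w) [LHS]sq_quotientE.
rewrite /sqpi [RHS]subquot_map_pi.
by congr subquot_pi; apply: val_inj; exact/esym/gring_mapM.
Qed.

(** * Naturality of lim^2 in the group *)

Section Rel2Nat.
Variables (G H : grp) (phi : {ghom G -> H}) (K : base_change phi).
Notation XG := (pres_copr G).
Notation XH := (pres_copr H).
Let h : chom (cpe XG) (bc_fun K (cpe XH)) := cp_pt XG _.

Definition gring_bc : abnat (abpull K (gringF G)) (gringF H).
Proof.
apply: (@AbNat _ (abpull K (gringF G)) (gringF H)
  (fun d : pres H => gring_map (bc_mor K d))) => d e f x.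
rewrite -[LHS]/(gring_map (bc_mor K e) (gring_map (pmor_val (fhom K f)) x)).
rewrite -[RHS]/(gring_map (pmor_val f) (gring_map (bc_mor K d) x)).
elim/gring_indP: x => [|x y xP yP|g].
- by rewrite !gring_map0.
- by rewrite !gring_mapB xP yP.
by rewrite !gring_mapU bc_nat.
Defined.

Definition tensFG_bc : abnat (abpull K (tensFG G)) (tensFG H).
Proof.
pose t (d : pres H) : {additive abpull K (tensFG G) d -> tensFG H d} :=
  tens_map (ab_map (bc_mor K d)) (ab_map phi).
apply: (@AbNat _ (abpull K (tensFG G)) (tensFG H) t) => d e f x.
apply: (tens_ext (g := t e \o ahom (abpull K (tensFG G)) f)
  (g' := ahom (tensFG H) f \o t d)) => m n.
rewrite -[LHS]/(t e (tens_map (ab_map (pmor_val (fhom K f))) idfun (pure m n))).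
rewrite -[RHS]/(tens_map (ab_map (pmor_val f)) idfun (t d (pure m n))).
rewrite /t !tens_map_pure; congr pure.
elim/ab_ind: m => y.
rewrite -[LHS]/(ab_map (bc_mor K e) (ab_map (pmor_val (fhom K f)) (ab_pi y))).
rewrite -[RHS]/(ab_map (pmor_val f) (ab_map (bc_mor K d) (ab_pi y))).
rewrite (ab_map_pi (fhom K f : pmor _ _ _) y) (ab_map_pi (bc_mor K d) y).
by rewrite !ab_map_pi bc_nat.
Defined.

(** Both witnesses are transported, v through the group rings and y through F_ab (x) G_ab; [psi_nat]
    for the symbol map keeps them related. *)
Lemma cech2_rel_push xi t : @cech2_rel G xi t ->
  @cech2_rel H (psi h (frF_bc K) xi) (tens_map (ab_map phi) (ab_map phi) t).
Proof.
move=> [v [vA dv [y yv <-]]].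
exists (psi h gring_bc (n := 1) v); split.
- apply: (afI_map (bc_mor K _)).
  exact: (@afI_map G G idfun _ _ (hCE h 1)).
- by rewrite -(psi_chd h gring_bc) dv.
exists (psi h tensFG_bc (n := 0) y).
  rewrite -(psi_chd h tensFG_bc) yv.
  apply: esym; apply: (psi_nat h (T := gringF G) (U := tensFG G)
    (T' := gringF H) (U' := tensFG H) (t := gring_bc) (u := tensFG_bc)
    (P := fun c : pres G => @symFG G c)
    (P' := fun d : pres H => @symFG H d) (S := sub_ff G)).
  - move=> c d f x xff.
    exact: (@symFG_map G G idfun c d f idfun (gabG_mapid f)).
  - move=> d x xff.
    exact: (symFG_map (gabG_map (bc_mor K d)) xff).
  exact: af_ff.
rewrite /psi.
pose g1 : {additive tensFG G (CE XG 0) -> tens (ab H) (ab H)} :=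
  @projGG H (CE XH 0) \o (tensFG_bc (CE XH 0) \o ahom (tensFG G) (hCE h 0)).
pose g2 : {additive tensFG G (CE XG 0) -> tens (ab H) (ab H)} :=
  tens_map (ab_map phi) (ab_map phi) \o @projGG G (CE XG 0).
apply: (tens_ext (g := g1) (g' := g2)) => m n.
pose h0 : pmor idfun (base_pres G) (bc_fun K (base_pres H) : pres G) := h.
rewrite -[LHS]/(tens_map (ab_map (pproj (base_pres H))) idfun
  (tens_map (ab_map (bc_mor K (base_pres H))) (ab_map phi)
    (tens_map (ab_map h0) idfun (pure m n)))).
rewrite -[RHS]/(tens_map (ab_map phi) (ab_map phi)
  (tens_map (ab_map (pproj (base_pres G))) idfun (pure m n))).
rewrite !tens_map_pure; congr pure; elim/ab_ind: m => x.
rewrite -[LHS]/(ab_map (pproj (base_pres H)) (ab_map (bc_mor K (base_pres H))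
  (ab_map h0 (ab_pi x)))).
rewrite -[RHS]/(ab_map phi (ab_map (pproj (base_pres G)) (ab_pi x))).
rewrite (ab_map_pi h0 x) (ab_map_pi (bc_mor K (base_pres H)) (h0 x)).
rewrite (ab_map_pi (pproj (base_pres H)) (bc_mor K (base_pres H) (h0 x))).
by rewrite (ab_map_pi (pproj (base_pres G)) x) ab_map_pi !pmorP.
Qed.
End Rel2Nat.

Theorem mainTheorem9 (R : forall G : grp, injres (frF G)) :
  (* lim^2 (rr + ffr + rff) is isomorphic to G_ab (x) G_ab, naturally in G *)
  (exists alpha : forall G : grp, {additive rlim (R G) 2 -> tens (ab G) (ab G)},
     (forall G : grp, bijective (alpha G)) /\
     (forall (G H : grp) (phi : {ghom G -> H}) (K : base_change phi)
        (l : res_lift (frF_bc K) (R G) (R H)) (x : rlim (R G) 2),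
        alpha H (rlim_map l 2 x) =
        tens_map (ab_map phi) (ab_map phi) (alpha G x)))
  /\
  (* the short exact sequence *)
  (forall G : grp,
     exists (iota : abnat (sqfrF G) (abconst (pres_cat G) (rlim (R G) 1)))
            (p : {additive rlim (R G) 1 -> Tor (ab G) (ab G)}),
       (forall u, exists x, p x = u) /\
       (forall c : pres_cat G,
          injective (iota c) /\
          (forall x, p x = 0%R <-> exists q, iota c q = x)))
  /\
  (* its left-hand term is a constant functor on Pres(G) *)
  (forall G : grp, is_constant (sqfrF G))
  /\
  (* and a natural quotient of the tensor square of g^2 over Z[G] *)
  (exists s : forall (G : grp) (c : pres G),
                {additive aug2_tens G -> subquot (sqI c) (frI c)},
     (forall (G : grp) (c : pres G) q, exists t, s G c t = q) /\
     (forall (G H : grp) (phi : {ghom G -> H}) (c : pres G) (d : pres H)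
        (f : pmor phi c d) (t : aug2_tens G),
        s H d (aug2_tens_map phi t) = sqfr_map f (s G c t)))
  /\
  (* lim^3 vanishes *)
  (forall (G : grp) (x : rlim (R G) 3), x = 0%R).
Proof.
split.
  pose alpha G := projT1 (cid (rlim2_iso (R G))).
  have alphaP G : bijective (alpha G) /\
      forall (x : subz (kerz (cd (lim_complex (R G)) 2))) t,
    lim2_rel (val x) t -> alpha G (subquot_pi (bound _ 2) x) = t.
    by rewrite /alpha; case: cid.
  exists alpha; split=> [G|G H phi K l x]; first by case: (alphaP G).
  elim/subquot_ind: x => x.
  (* [alpha] is determined by [lim2_rel], so it suffices to push one related pair forward. *)
  have [t _ xt] := corr_tot (lim2_corr (R G)) ((limZP _).1 (subz_valP x)).
  rewrite ((alphaP G).2 _ _ xt) [rlim_map l 2 _]subquot_map_pi.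
  apply: (alphaP H).2; case: xt => xi xxi xit.
  exists (psi (cp_pt (pres_copr G) _) (frF_bc K) xi); last exact: cech2_rel_push.
  exact: stair2_push.
split=> [G|].
  have [ie [p [ie_inj p_surj p_ker]]] := rlim1_exact (R G).
  (* [ie] is defined at the base presentation; elsewhere it is preceded by a map to the base, whose
     effect on aa / fr does not depend on the map chosen. *)
  have iota_nat (c d : pres_cat G) (f : chom c d) x :
      (ie \o ahom (sqfrF G) (to_base d)) (ahom (sqfrF G) f x) =
      ahom (abconst (pres_cat G) (rlim (R G) 1)) f
        ((ie \o ahom (sqfrF G) (to_base c)) x).
    apply: (congr1 ie); apply: etrans (esym (ahom_comp _ _ x)) _.
    exact: sqfr_const.
  exists (@AbNat (pres_cat G) (sqfrF G) (abconst (pres_cat G) (rlim (R G) 1))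
    (fun c => ie \o ahom (sqfrF G) (to_base c)) iota_nat), p.
  split=> // c; have [g gK Kg] := sqfr_bij (to_base c).
  split=> [u v /ie_inj|x]; first exact: (can_inj gK).
  rewrite p_ker; split=> -[q qx]; last by eexists; exact: qx.
  by exists (g q); apply: etrans (congr1 ie (Kg q)) qx.
split; first by move=> G; exact: sqfr_is_constant.
split; last by move=> G x; exact: rlim3_eq0.
exists (fun G c => sq_quotient c); split=> [G c q|G H phi c d f t].
  exact: sq_quotient_surj.
exact: sq_quotient_nat.
Qed.
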